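(* Let $H\in(0,1)$ be arbitrary. Let $\{G_i\}_{i\in\mathbb N}$ be a centered stationary Gaussian sequence with $\mathbb E[G_iG_j]=s_H(i-j)$, where $$s_H(k)=\tfrac14\big(|k+1|^{2H}+|k-1|^{2H}-2|k|^{2H}\big),\qquad k\in\mathbb Z.$$ Let $\mathbf a=(a_1,\dots,a_n)$, $\mathbf b$, $\mathbf c$ be i.i.d. copies of $(G_1,\dots,G_n)$. Then, with probability tending to one as $n\to\infty$, $$\mathbf a\text{ beats }\mathbf b\quad\text{if and only if}\quad \sum_{i=1}^nF(a_i)>\sum_{i=1}^nF(b_i),$$ where $F(x)=\Phi(\sqrt2\,x)$ is the distribution function of $G_1\sim N(0,1/2)$. As a consequence, the probability that the three dice $\mathbf a,\mathbf b,\mathbf c$ are transitive tends to one as $n\to+\infty$.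
   Context: $\Phi$ is the standard normal CDF. An $n$-sided die is a vector in $\mathbb R^n$. Die $\mathbf a$ beats die $\mathbf b$ if $\sum_{i,j=1}^n\big(\mathbb 1[a_i>b_j]-\mathbb 1[a_i<b_j]\big)>0$. A finite set of dice is transitive if the ''beats'' relation on the set is a (strict) linear order. *)

(* Defs.v *)
From HB Require Import structures.
From mathcomp Require Import all_boot all_order all_algebra.
From mathcomp Require Import all_classical all_reals all_analysis.

Set Implicit Arguments.
Unset Strict Implicit.
Unset Printing Implicit Defensive.

Import Order.TTheory GRing.Theory Num.Theory.
Import numFieldNormedType.Exports.

Local Open Scope classical_set_scope.
Local Open Scope ring_scope.

Section gaussian.
Context {R : realType} {d : measure_display} {T : measurableType d}.
Variable P : probability T R.

(* The degenerate case is listed apart because [normal_prob m 0] is by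
   convention the uniform law on [0, 1], not the Dirac mass at [m]. *)
Definition gaussian_rv (X : T -> R) : Prop :=
  (exists m s : R, s != 0 /\
    forall A : set R, measurable A -> P (X @^-1` A) = normal_prob m s A) \/
  (exists m : R,
    forall A : set R, measurable A -> P (X @^-1` A) = \d_m A).

Definition gaussian_sequence (G : nat -> {RV P >-> R}) : Prop :=
  forall (n : nat) (t : 'I_n -> R),
    gaussian_rv (fun w => \sum_(i < n) t i * G i w).

Definition centered_sequence (G : nat -> {RV P >-> R}) : Prop :=
  forall i, ('E_P[G i] = 0)%E.

(* The window (G k, ..., G (k + n - 1)). *)
Definition window (G : nat -> {RV P >-> R}) (k n : nat) (w : T) : n.-tuple R :=
  [tuple G (k + i)%N w | i < n].

Definition stationary_sequence (G : nat -> {RV P >-> R}) : Prop :=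
  forall (k n : nat) (A : set (n.-tuple R)), measurable A ->
    P (window G k n @^-1` A) = P (window G 0 n @^-1` A).

End gaussian.

Definition same_law {R : realType} {d d' d'' : measure_display}
    {T : measurableType d} {T' : measurableType d'} {U : measurableType d''}
    (P : probability T R) (P' : probability T' R) (X : T -> U) (Y : T' -> U) :
    Prop :=
  forall A : set U, measurable A -> P (X @^-1` A) = P' (Y @^-1` A).

(* Taking some of the sets to be [setT] gives the product rule for pairs. *)
Definition independent3 {R : realType} {d d' : measure_display}
    {T : measurableType d} {U : measurableType d'}
    (P : probability T R) (X Y Z : T -> U) : Prop :=
  forall A B C : set U, measurable A -> measurable B -> measurable C ->
    P (X @^-1` A `&` Y @^-1` B `&` Z @^-1` C) =
    (P (X @^-1` A) * P (Y @^-1` B) * P (Z @^-1` C))%E.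

Definition s_H {R : realType} (H : R) (k : int) : R :=
  4^-1 * (`|k%:~R + 1| `^ (2 * H) + `|k%:~R - 1| `^ (2 * H)
          - 2 * `|k%:~R| `^ (2 * H)).

Definition Phi {R : realType} (x : R) : R := fine (normal_prob 0 1 `]-oo, x]).

Definition F {R : realType} (x : R) : R := Phi (Num.sqrt 2 * x).

Definition beats {R : realType} {n : nat} (a b : n.-tuple R) : Prop :=
  0 < \sum_(i < n) \sum_(j < n)
        ((tnth a i > tnth b j)%R%:Z - (tnth a i < tnth b j)%R%:Z).

Definition strict_linear_order_on {U : Type} (S : set U) (r : U -> U -> Prop) :
    Prop :=
  [/\ forall x, S x -> ~ r x x,
      forall x y z, S x -> S y -> S z -> r x y -> r y z -> r x z
    & forall x y, S x -> S y -> x <> y -> r x y \/ r y x].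

Definition transitive_dice {R : realType} {n : nat} (S : set (n.-tuple R)) :
    Prop :=
  finite_set S /\ strict_linear_order_on S beats.

(* Main.v *)
(** Let V(x) be the sum of the F(x_i). The score of a against b is
    2n (V(a) - V(b)) + W, where W sums the kernel
    g(x, y) = sgn(x - y) - 2 F(x) + 2 F(y) over all pairs of faces. This kernel
    averages to zero over each argument, so writing (G_i, G_k) as
    (u, rho u + sqrt(1 - rho^2) v) with u, v independent bounds the covariance
    of two terms of W by a multiple of |s_H(i - k)| |s_H(j - l)|; hence
    E W^2 = O(n^(2 max(1, 2H))).

    On the other hand V(a) is not concentrated at any scale below n^H.
    Resampling the component of the window along its normalised sum, by the
    shift z -> x_i + m_i z with m_i = Cov(x_i, sum) / sd(sum) >= 0, makes V
    monotone in z with slope D = sum_i m_i F'(x_i). Integrating the derivative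
    of k arctan((V - v) / k) bounds the expectation of D on {|V - v| <= k} by a
    multiple of k, while D is with high probability of the order of
    sum_i m_i = sd(sum) = n^H / sqrt 2.

    For k = n^theta with max(0, 2H - 1) < theta < H, both |V(a) - V(b)| > k and
    |W| < 2nk hold with probability tending to one, and then the sign of the
    score is that of V(a) - V(b). The laws are identified through
    characteristic functions: Gaussian smoothing of one coordinate at a time
    recovers the joint distribution function. *)

Require Import Defs.
From HB Require Import structures.
From mathcomp Require Import all_boot all_order all_algebra.
From mathcomp Require Import ring lra.
From mathcomp Require Import all_classical all_reals all_analysis.
From mathcomp Require Import measurable_realfun.

Import Order.TTheory GRing.Theory Num.Theory.
Import numFieldNormedType.Exports.

Set Implicit Arguments.
Unset Strict Implicit.
Unset Printing Implicit Defensive.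

Local Open Scope classical_set_scope.
Local Open Scope ring_scope.

(** * Bounded measurable functions *)

(** The decisive inequality is max(1, 2H) < 1 + H: it places the standard deviation of W below 2n
    times the scale n^H of V, and it says exactly that 0 < H < 1. The obstacle is dependence between
    the faces, with covariances that are nonpositive off the diagonal for H < 1/2 and whose sums
    grow faster than n for H > 1/2. No limit theorem for V is used. Resampling only asks the row
    sums of the covariance matrix to be nonnegative, and these telescope for every H. The lower
    bound on D needs no decorrelation either: F' lies above a multiple of e^(-M) (1 - y^2 / M), so a
    first-moment bound on a weighted sum of squares suffices. The price e^M is harmless because M is
    fixed before n grows. The arctangent replaces the indicator of |V - v| <= k by a smooth function
    comparable with it from below, of which a bounded primitive is explicit. Independence of the
    dice enters by freezing one of them: v is then V(b). *)

Section measurable_sets.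
Context {d : measure_display} {T : measurableType d}.

Lemma measurable_true_set (b : T -> bool) : measurable_fun setT b ->
  measurable [set w | b w].
Proof. by move=> mb; have := mb measurableT [set true]; rewrite setTI; exact. Qed.

Lemma measurable_forall (I : finType) (A : I -> set T) :
  (forall i, measurable (A i)) -> measurable [set w | forall i, A i w].
Proof.
move=> mA; rewrite (_ : mkset _ = \big[setI/setT]_(i <- enum I) A i).
  by apply: bigsetI_measurable => i _; exact: mA.
rewrite -bigcap_seq; apply/seteqP; split => o /= H i; first by move=> _; exact: H.
by apply: H; rewrite /= mem_enum.
Qed.

End measurable_sets.

(** Boundedness stands in for integrability: indicators, cosines, [F] and the dice kernel all
    qualify, the class is stable under products and partial integration, and Fubini needs no further
    condition. Moments of normal variables are treated by explicit domination instead. *)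
Definition bmeas {R : realType} {d : measure_display} {T : measurableType d}
    (f : T -> R) := measurable_fun setT f /\ exists M, forall x, `|f x| <= M.

Section bounded_measurable.
Context {R : realType} {d : measure_display} {T : measurableType d}.
Implicit Types (f g : T -> R).

Lemma bmeasW f : bmeas f -> measurable_fun setT f. Proof. by case. Qed.

Lemma bmeas_cst (c : R) : bmeas (fun _ : T => c).
Proof. by split=> //; exists `|c|. Qed.

Lemma bmeasD f g : bmeas f -> bmeas g -> bmeas (fun x => f x + g x).
Proof.
move=> [mf [M fM]] [mg [N gN]]; split; first exact: measurable_funD.
by exists (M + N) => x; rewrite (le_trans (ler_normD _ _))// lerD.
Qed.

Lemma bmeasN f : bmeas f -> bmeas (fun x => - f x).
Proof.
move=> [mf [M fM]]; split; last by exists M => x; rewrite normrN.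
by apply: measurableT_comp mf; exact: oppr_measurable.
Qed.

Lemma bmeasB f g : bmeas f -> bmeas g -> bmeas (fun x => f x - g x).
Proof. by move=> bf bg; apply: bmeasD => //; exact: bmeasN. Qed.

Lemma bmeasM f g : bmeas f -> bmeas g -> bmeas (fun x => f x * g x).
Proof.
move=> [mf [M fM]] [mg [N gN]]; split; first exact: measurable_funM.
by exists (M * N) => x; rewrite normrM ler_pM.
Qed.

Lemma bmeas_norm f : bmeas f -> bmeas (fun x => `|f x|).
Proof.
move=> [mf [M fM]]; split; last by exists M => x; rewrite normr_id.
by apply: measurableT_comp mf; exact: normr_measurable.
Qed.

Lemma bmeas_sum (I : Type) (r : seq I) (h : I -> T -> R) :
  (forall i, bmeas (h i)) -> bmeas (fun x => \sum_(i <- r) h i x).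
Proof.
move=> bh; elim: r => [|i r IH].
  by under eq_fun do rewrite big_nil; exact: bmeas_cst.
by under eq_fun do rewrite big_cons; exact: bmeasD.
Qed.

Lemma bmeas_indic (A : set T) : measurable A -> bmeas (\1_A : T -> R).
Proof.
move=> mA; split; first exact: measurable_indic.
by exists 1 => x; rewrite indicE; case: (_ \in _); rewrite ?normr1 ?normr0.
Qed.

Lemma bmeas_cos f : measurable_fun setT f -> bmeas (fun x => cos (f x)).
Proof.
move=> mf; split; last by exists 1 => x; exact: cos_max.
by apply: measurableT_comp mf; apply: continuous_measurable_fun;
   exact: continuous_cos.
Qed.

Lemma bmeas_sin f : measurable_fun setT f -> bmeas (fun x => sin (f x)).
Proof.
move=> mf; split; last by exists 1 => x; exact: sin_max.
by apply: measurableT_comp mf; apply: continuous_measurable_fun;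
   exact: continuous_sin.
Qed.

Lemma bmeas_comp (d' : measure_display) (T' : measurableType d') (h : T' -> T) f :
  measurable_fun setT h -> bmeas f -> bmeas (fun x => f (h x)).
Proof.
move=> mh [mf [M fM]]; split; last by exists M.
exact: measurableT_comp mf mh.
Qed.

Variable P : probability T R.

Lemma bmeas_integrable f : bmeas f -> P.-integrable setT (EFin \o f).
Proof.
move=> [mf [M fM]]; apply: measurable_bounded_integrable => //.
  by apply: le_lt_trans (probability_le1 P measurableT) (ltry _).
by exists M; split; [exact: num_real|move=> y My x _; exact: le_trans (ltW My)].
Qed.

Lemma RintegralM_cst f (c : R) : bmeas f ->
  \int[P]_x (c * f x) = c * \int[P]_x f x.
Proof. by move=> bf; apply: RintegralZl => //; exact: bmeas_integrable. Qed.

Lemma Rintegral_prob_cst (c : R) : \int[P]_x c = c.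
Proof. by rewrite Rintegral_cst//= probability_setT mulr1. Qed.

Lemma bRintegralD f g : bmeas f -> bmeas g ->
  \int[P]_x (f x + g x) = \int[P]_x f x + \int[P]_x g x.
Proof. by move=> bf bg; apply: RintegralD => //; exact: bmeas_integrable. Qed.

Lemma bRintegralB f g : bmeas f -> bmeas g ->
  \int[P]_x (f x - g x) = \int[P]_x f x - \int[P]_x g x.
Proof. by move=> bf bg; apply: RintegralB => //; exact: bmeas_integrable. Qed.

Lemma Rintegral_prob_sum (I : Type) (r : seq I) (h : I -> T -> R) :
  (forall i, P.-integrable setT (EFin \o h i)) ->
  \int[P]_x (\sum_(i <- r) h i x) = \sum_(i <- r) \int[P]_x h i x.
Proof.
move=> bh; elim: r => [|i r IH].
  by under eq_Rintegral do rewrite big_nil; rewrite big_nil Rintegral_prob_cst.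
under eq_Rintegral do rewrite big_cons.
rewrite big_cons -IH RintegralD//.
apply: (@eq_integrable _ _ _ P setT measurableT
  (fun x => \sum_(i <- r) (h i x)%:E)%E) => [x _|]; first by rewrite /= sumEFin.
by apply: integrable_sum => // i0 _; exact: bh.
Qed.

Lemma bRintegral_sum (I : Type) (r : seq I) (h : I -> T -> R) :
  (forall i, bmeas (h i)) ->
  \int[P]_x (\sum_(i <- r) h i x) = \sum_(i <- r) \int[P]_x h i x.
Proof.
by move=> bh; apply: Rintegral_prob_sum => i; exact: bmeas_integrable.
Qed.

Lemma ler_bRintegral f g : bmeas f -> bmeas g -> (forall x, f x <= g x) ->
  \int[P]_x f x <= \int[P]_x g x.
Proof.
by move=> bf bg fg; apply: le_Rintegral => //; exact: bmeas_integrable.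
Qed.

Lemma Rintegral_indic_prob (A : set T) : measurable A ->
  \int[P]_x \1_A x = fine (P A).
Proof. by move=> mA; rewrite /Rintegral integral_indic// setIT. Qed.

Lemma bRintegral_bound f M : bmeas f -> (forall x, `|f x| <= M) ->
  `|\int[P]_x f x| <= M.
Proof.
move=> bf fM; apply: le_trans (le_normr_Rintegral _ _) _ => //.
  exact: bmeas_integrable.
rewrite -[leRHS](Rintegral_prob_cst M); apply: ler_bRintegral => //.
- exact: bmeas_norm.
- exact: bmeas_cst.
Qed.

End bounded_measurable.

Section same_law_integral.
Context {R : realType} {d d' d'' : measure_display} {T : measurableType d}
  {T' : measurableType d'} {U : measurableType d''}.
Variables (P : probability T R) (P' : probability T' R).
Variables (X : T -> U) (Y : T' -> U).
Hypotheses (mX : measurable_fun setT X) (mY : measurable_fun setT Y).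
Hypothesis XY : same_law P P' X Y.

Lemma same_law_integral (f : U -> \bar R) : measurable_fun setT f ->
  (forall u, 0 <= f u)%E ->
  (\int[P]_x f (X x) = \int[P']_x f (Y x))%E.
Proof.
move=> mf f0; transitivity (\int[pushforward P X]_u f u)%E.
  by rewrite ge0_integral_pushforward.
transitivity (\int[pushforward P' Y]_u f u)%E; last first.
  by rewrite ge0_integral_pushforward.
by apply: eq_measure_integral => A mA _; exact: XY.
Qed.

Lemma same_law_Rintegral (f : U -> R) : bmeas f ->
  \int[P]_x f (X x) = \int[P']_x f (Y x).
Proof.
move=> bf; have mf : measurable_fun setT (EFin \o f).
  by apply/measurable_EFinP; case: bf.
rewrite /Rintegral; congr fine.
transitivity (\int[pushforward P X]_u (f u)%:E)%E.
  rewrite integral_pushforward//.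
  by apply: bmeas_integrable; exact: bmeas_comp bf.
transitivity (\int[pushforward P' Y]_u (f u)%:E)%E; last first.
  rewrite integral_pushforward//.
  by apply: bmeas_integrable; exact: bmeas_comp bf.
by apply: eq_measure_integral => A mA _; exact: XY.
Qed.

End same_law_integral.

Section bounded_fubini.
Context {R : realType} {d d' : measure_display} {T : measurableType d}
  {T' : measurableType d'}.
Variables (P : probability T R) (Q : probability T' R).

Lemma bmeas_pair1 (f : T * T' -> R) x : bmeas f -> bmeas (fun y => f (x, y)).
Proof. by apply: bmeas_comp; exact: measurable_pair1. Qed.

Lemma bmeas_pair2 (f : T * T' -> R) y : bmeas f -> bmeas (fun x => f (x, y)).
Proof. by apply: bmeas_comp; exact: measurable_pair2. Qed.

Lemma bmeas_fubini1 (f : T * T' -> R) : bmeas f ->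
  bmeas (fun x => \int[Q]_y f (x, y)).
Proof.
move=> bf; split.
  apply: measurableT_comp; first exact: fine_measurable.
  exact: (@measurable_fubini_F _ _ _ _ _ P Q (EFin \o f)
    (bmeas_integrable (P \x Q)%E bf)).
have [_ [M fM]] := bf; exists M => x.
by apply: bRintegral_bound => //; exact: bmeas_pair1.
Qed.

Lemma bmeas_fubini2 (f : T * T' -> R) : bmeas f ->
  bmeas (fun y => \int[P]_x f (x, y)).
Proof.
move=> bf; split.
  apply: measurableT_comp; first exact: fine_measurable.
  exact: (@measurable_fubini_G _ _ _ _ _ P Q (EFin \o f)
    (bmeas_integrable (P \x Q)%E bf)).
have [_ [M fM]] := bf; exists M => y.
by apply: bRintegral_bound => //; exact: bmeas_pair2.
Qed.

Lemma bfubini1 (f : T * T' -> R) : bmeas f ->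
  \int[(P \x Q)%E]_z f z = \int[P]_x \int[Q]_y f (x, y).
Proof.
move=> bf; rewrite /Rintegral; congr fine.
rewrite -integral12_prod_meas1; last exact: (bmeas_integrable (P \x Q)%E bf).
apply: eq_integral => x _; rewrite /fubini_F /Rintegral fineK//.
by apply: integrable_fin_num => //; apply: bmeas_integrable; exact: bmeas_pair1.
Qed.

Lemma bfubini2 (f : T * T' -> R) : bmeas f ->
  \int[(P \x Q)%E]_z f z = \int[Q]_y \int[P]_x f (x, y).
Proof.
move=> bf; rewrite /Rintegral; congr fine.
rewrite -integral21_prod_meas1; last exact: (bmeas_integrable (P \x Q)%E bf).
apply: eq_integral => x _; rewrite /fubini_G /Rintegral fineK//.
by apply: integrable_fin_num => //; apply: bmeas_integrable; exact: bmeas_pair2.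
Qed.

End bounded_fubini.

(** * The normal law *)

Section lebesgue_integrals.
Context {R : realType}.
Notation mu := (@lebesgue_measure R).

Lemma integrable_expRN_sqr (c m : R) : 0 < c ->
  mu.-integrable setT (EFin \o (fun x => expR (- (c * (x - m) ^+ 2)))).
Proof.
(* [s] solves 2 s^2 = 1 / c, which makes the integrand the normal density of mean [m] divided by its
   peak value. *)
move=> c0; pose s : R := Num.sqrt (c *+ 2)^-1.
have s0 : s != 0 by rewrite sqrtr_eq0 -ltNge invr_gt0 pmulrn_lgt0.
have := integrable_normal_pdf m s.
move=> /(integrableZl measurableT (normal_peak s)^-1).
apply: eq_integrable => // x _; rewrite normal_pdfE//= -EFinM.
rewrite mulKf ?gt_eqF ?normal_peak_gt0// /normal_fun; congr (expR _)%:E.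
rewrite /s sqr_sqrtr ?invr_ge0 ?mulrn_wge0 ?ltW// mulNr; congr (- _).
rewrite mulrC; congr (_ * _); rewrite -(mulr_natr c) -mulr_natr; field.
by rewrite gt_eqF.
Qed.

(** The fundamental theorem of calculus on [-n, n], then dominated convergence. With [h] a function
    times a normal density, this is integration by parts without boundary terms. *)
Lemma Rintegral_derivative (h h' : R -> R) :
  (forall x : R, is_derive x 1 h (h' x)) -> continuous h' ->
  mu.-integrable setT (EFin \o h') ->
  h n%:R @[n --> \oo] --> 0 -> h (- n%:R) @[n --> \oo] --> 0 ->
  \int[mu]_x h' x = 0.
Proof.
move=> dh ch ih hy hNy.
pose f_ n x := (h' x * \1_(`[- n%:R, n%:R]) x)%:E : \bar R.
have mh : measurable_fun setT h' by exact: continuous_measurable_fun.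
have mf_ n : measurable_fun setT (f_ n).
  by apply/measurable_EFinP; apply: measurable_funM => //; exact: measurable_indic.
have cvf_ : {ae mu, forall x, setT x -> f_ ^~ x @ \oo --> (EFin \o h') x}.
  apply: aeW => x _; apply: cvg_near_cst.
  near=> n; rewrite /f_ indicE mem_set ?mulr1//= in_itv/= -ler_norml.
  by near: n; exact: nbhs_infty_ger.
have f_le : {ae mu, forall x n, setT x ->
    (`|f_ n x| <= (abse \o (EFin \o h')) x)%E}.
  apply: aeW => x n _; rewrite /f_ /= lee_fin normrM ler_piMr//.
  by rewrite indicE; case: (_ \in _); rewrite ?normr1 ?normr0.
have mh'E : measurable_fun setT (EFin \o h') by exact/measurable_EFinP.
have [_ _] := @dominated_convergence _ _ R mu setT measurableT f_
  (EFin \o h') (abse \o (EFin \o h')) mf_ mh'E cvf_ (integrable_abse ih) f_le.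
rewrite /= => cvf.
(* The index is shifted by one because the fundamental theorem asks for a nondegenerate interval. *)
have fE n : (\int[mu]_x f_ n.+1 x = (h n.+1%:R - h (- n.+1%:R))%:E)%E.
  rewrite EFinB -(@continuous_FTC2 _ h').
  - rewrite [RHS]integral_mkcond; apply: eq_integral => x _.
    rewrite /f_ patchE indicE; case: ifPn => _; by rewrite ?mulr1 ?mulr0.
  - by rewrite gtrN// ltr0n.
  - exact: continuous_subspaceT.
  - split=> [x _||]; first exact: ex_derive.
    + apply: cvg_at_right_filter; apply: differentiable_continuous.
      by apply/derivable1_diffP; exact: ex_derive.
    + apply: cvg_at_left_filter; apply: differentiable_continuous.
      by apply/derivable1_diffP; exact: ex_derive.
  - by move=> x _; rewrite derive1E; exact: derive_val.
have cv0 : (fun n => (h n.+1%:R - h (- n.+1%:R))%:E) @ \oo --> (0 : \bar R)%E.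
  apply: cvg_EFin; first by near=> n.
  rewrite -[X in _ --> X](subr0 (0 : R)).
  by apply: cvgB; [rewrite -(cvg_shiftS (fun n => h n%:R)) in hy|
    rewrite -(cvg_shiftS (fun n => h (- n%:R))) in hNy].
move: cvf; rewrite -(cvg_shiftS (fun n => (\int[mu]_x f_ n x)%E)).
under eq_fun do rewrite /= fE.
by move=> /(cvg_unique _ cv0); rewrite /Rintegral => <-.
Unshelve. all: by end_near. Qed.

End lebesgue_integrals.

Section normal_law.
Context {R : realType}.
Notation mu := (@lebesgue_measure R).

Lemma cvg0_of_inv_bound (h : R -> R) (m C : R) :
  (forall x, `|h x| * `|x - m| <= C) ->
  h n%:R @[n --> \oo] --> (0 : R) /\ h (- n%:R) @[n --> \oo] --> (0 : R).
Proof.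
move=> hC; have C0 : 0 <= C by apply: le_trans (hC m); rewrite mulr_ge0.
have key x e : 0 < e -> `|m| + C / e + 1 <= `|x| -> `|h x| <= e.
  move=> e0 xm; have : C / e + 1 <= `|x - m|.
    have := ler_normD (x - m) m; rewrite subrK; lra.
  move=> H1; have := hC x => H2.
  have H3 : `|h x| * (C / e + 1) <= C.
    by apply: le_trans (H2); rewrite ler_wpM2l.
  have Ce : 0 < C / e + 1 by rewrite ltr_wpDl// divr_ge0// ltW.
  rewrite -(ler_pM2r Ce) (le_trans H3)// mulrDr mulr1 mulrCA divff ?gt_eqF//.
  by rewrite mulr1 lerDl ltW.
split; apply/cvgrPdist_le => e e0; near=> n; rewrite sub0r normrN;
  apply: key => //; rewrite ?normrN normr_nat; near: n; exact: nbhs_infty_ger.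
Unshelve. all: by end_near. Qed.

Variables (m s : R).
Hypothesis s0 : s != 0.
Notation p := (normal_pdf m s).

Let s2_gt0 : 0 < s ^+ 2. Proof. by rewrite exprn_even_gt0. Qed.

Lemma normal_pdf_expR x : p x = normal_peak s * expR (- ((2 * s ^+ 2)^-1 * (x - m) ^+ 2)).
Proof.
rewrite normal_pdfE// /normal_fun; congr (_ * expR _).
by rewrite mulNr mulrC mulr_natl.
Qed.

Lemma is_derive_normal_pdf (x : R) :
  is_derive x 1 p (- ((x - m) / s ^+ 2) * p x).
Proof.
rewrite (_ : p = fun x => normal_peak s *
  expR (- ((2 * s ^+ 2)^-1 * (x - m) ^+ 2))); last first.
  by apply/funext => y; rewrite normal_pdf_expR.
apply: is_derive_eq; rewrite /GRing.scale/= !(mulr1,mulr0,addr0,add0r,subr0).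
by field.
Qed.

(** The exponent (x - m)^2 / (2 s^2) is split into two equal halves [a]. One half stays as
    dominating function; the other absorbs the power, since |x - m|^k <= (4 s^2 + 1) (1 + a) and (1
    + a) e^(-a) <= 1. *)
Lemma normal_moment_le (k : nat) (x : R) : (k <= 2)%N ->
  `|x - m| ^+ k * p x <=
  (4 * s ^+ 2 + 1) * normal_peak s * expR (- ((4 * s ^+ 2)^-1 * (x - m) ^+ 2)).
Proof.
move=> k2; rewrite normal_pdf_expR.
set y := x - m; set a := (4 * s ^+ 2)^-1 * y ^+ 2.
have a0 : 0 <= a by rewrite mulr_ge0 ?sqr_ge0// invr_ge0 mulr_ge0 ?sqr_ge0.
have -> : - ((2 * s ^+ 2)^-1 * y ^+ 2) = - a + - a.
  by rewrite /a; field; exact: s0.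
rewrite expRD.
have y2 : y ^+ 2 = 4 * s ^+ 2 * a by rewrite /a mulVKf// gt_eqF// mulr_gt0.
have e1 : (1 + a) * expR (- a) <= 1.
  by rewrite expRN ler_pdivrMr ?expR_gt0// mul1r expR_ge1Dx.
have yk : `|y| ^+ k <= (4 * s ^+ 2 + 1) * (1 + a).
  have yn2 : `|y| ^+ 2 = 4 * s ^+ 2 * a by rewrite -y2 real_normK// num_real.
  have y0 := normr_ge0 y.
  case: k k2 => [|[|[|]]]// _; rewrite ?expr0 ?expr1.
  - nra.
  - have : 0 <= (`|y| - 1) ^+ 2 by rewrite sqr_ge0.
    nra.
  - nra.
have main : `|y| ^+ k * (expR (- a) * expR (- a)) <= (4 * s ^+ 2 + 1) * expR (- a).
  apply: (@le_trans _ _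
      ((4 * s ^+ 2 + 1) * (1 + a) * (expR (- a) * expR (- a)))).
    by rewrite ler_wpM2r// mulr_ge0 ?expR_ge0.
  have c0 : 0 <= 4 * s ^+ 2 + 1 by have := s2_gt0; lra.
  rewrite -mulrA ler_wpM2l//.
  by rewrite mulrA ler_piMl ?expR_ge0.
rewrite mulrCA -mulrA [leRHS]mulrCA ler_pM2l ?normal_peak_gt0//.
Qed.

Lemma integrable_normal_moment (k : nat) (k2 : (k <= 2)%N) :
  mu.-integrable setT (EFin \o (fun x => `|x - m| ^+ k * p x)).
Proof.
have i4 := @integrable_expRN_sqr R (4 * s ^+ 2)^-1 m.
have /i4 : 0 < (4 * s ^+ 2)^-1 by rewrite invr_gt0 mulr_gt0.
move=> /(integrableZl measurableT ((4 * s ^+ 2 + 1) * normal_peak s)).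
apply: le_integrable => //.
  apply/measurable_EFinP; apply: measurable_funM; last exact: measurable_normal_pdf.
  apply: measurable_funX; apply: measurableT_comp; first exact: normr_measurable.
  exact: measurable_funB.
move=> x _ /=; rewrite lee_fin ger0_norm; last first.
  by rewrite mulr_ge0 ?exprn_ge0// normal_pdf_ge0.
by rewrite (le_trans (normal_moment_le x k2))// ler_norm.
Qed.

End normal_law.

Section normal_cf.
Context {R : realType}.
Notation mu := (@lebesgue_measure R).
Variables (m s : R).
Hypothesis s0 : s != 0.
Notation p := (normal_pdf m s).

Let s2_gt0 : 0 < s ^+ 2. Proof. by rewrite exprn_even_gt0. Qed.

Lemma normal_moment_bound (k : nat) : (k <= 2)%N ->
  exists C, forall x, `|x - m| ^+ k * p x <= C.
Proof.
move=> k2; exists ((4 * s ^+ 2 + 1) * normal_peak s) => x.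
apply: le_trans (@normal_moment_le _ m s s0 k x k2) _.
rewrite ler_piMr//.
  by rewrite mulr_ge0 ?normal_peak_ge0//; have := s2_gt0; lra.
rewrite -[leRHS]expR0 ler_expR oppr_le0 mulr_ge0 ?sqr_ge0// invr_ge0.
have := s2_gt0; lra.
Qed.

Lemma integrable_normal_bounded (k : nat) (g : R -> R) : (k <= 2)%N -> bmeas g ->
  mu.-integrable setT (EFin \o (fun x => g x * ((x - m) ^+ k * p x))).
Proof.
move=> k2 [mg [M gM]].
have := integrableZl measurableT M (integrable_normal_moment m s0 k2).
apply: le_integrable => //.
  apply/measurable_EFinP; apply: measurable_funM => //.
  apply: measurable_funM; last exact: measurable_normal_pdf.
  by apply: measurable_funX; exact: measurable_funB.
move=> x _ /=; rewrite lee_fin !normrM !normrX (ger0_norm (normal_pdf_ge0 _ _ _)).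
rewrite normr_id ler_wpM2r// ?mulr_ge0 ?exprn_ge0 ?normal_pdf_ge0//.
by rewrite (le_trans (gM x))// ler_norm.
Qed.

(** Stein's identity: the derivative g' p - g (x - m) p / s^2 of g p integrates to zero. The mean is
    the case g = 1, the variance g = x - m, the characteristic function g = sin. *)
Lemma Rintegral_normal_stein (g g' : R -> R) (C : R) :
  (forall x : R, is_derive x 1 g (g' x)) -> continuous g' ->
  mu.-integrable setT (EFin \o (fun x => g' x * p x)) ->
  mu.-integrable setT (EFin \o (fun x => g x * ((x - m) * p x))) ->
  (forall x, `|g x * p x| * `|x - m| <= C) ->
  \int[mu]_x (g x * ((x - m) * p x)) = s ^+ 2 * \int[mu]_x (g' x * p x).
Proof.
move=> dg cg' ig' ig gC.
have dp x := is_derive_normal_pdf m s0 x.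
have cp : continuous p by exact: continuous_normal_pdf.
have cg : continuous g.
  move=> x; apply: differentiable_continuous; apply/derivable1_diffP.
  exact: ex_derive.
pose h' x := g' x * p x - (s ^+ 2)^-1 * (g x * ((x - m) * p x)).
have cxm : continuous (fun x : R => x - m).
  by move=> x; apply: cvgB; [exact: cvg_id|exact: cvg_cst].
have dh (x : R) : is_derive x 1 (fun x => g x * p x) (h' x).
  have /= H := is_deriveM (dg x) (dp x).
  apply: is_derive_eq; rewrite /h' /GRing.scale/=; ring.
have ch : continuous h'.
  move=> x; apply: cvgB; first by apply: cvgM; [exact: cg'|exact: cp].
  apply: cvgM; first exact: cvg_cst.
  by apply: cvgM; [exact: cg|apply: cvgM; [exact: cxm|exact: cp]].
have ig2 := integrableZl measurableT (s ^+ 2)^-1 ig.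
have ih : mu.-integrable setT (EFin \o h').
  by apply: eq_integrable (integrableB measurableT ig' ig2).
have ig3 : mu.-integrable setT
    (EFin \o (fun x => (s ^+ 2)^-1 * (g x * ((x - m) * p x)))).
  by apply: eq_integrable ig2.
have [hy hNy] := cvg0_of_inv_bound gC.
have := Rintegral_derivative dh ch ih hy hNy.
rewrite /h' RintegralB//.
rewrite RintegralZl// => /eqP; rewrite subr_eq0 => /eqP ->.
by rewrite mulVKf// gt_eqF.
Qed.

Lemma bmeas_subr_bound (g : R -> R) : bmeas g ->
  exists C, forall x, `|g x * p x| * `|x - m| <= C.
Proof.
move=> [_ [M gM]]; have [C pC] := normal_moment_bound (leqnSn 1).
exists (M * C) => x; rewrite normrM -mulrA ler_pM// ?mulr_ge0//.
by rewrite ger0_norm ?normal_pdf_ge0// mulrC -[`|x - m|]expr1.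
Qed.

Lemma normal_mean0 : \int[mu]_x ((x - m) * p x) = 0.
Proof.
have b1 := @bmeas_cst R _ (measurableTypeR R) 1.
have b0 := @bmeas_cst R _ (measurableTypeR R) 0.
have [C hC] := bmeas_subr_bound b1.
have i0 : mu.-integrable setT (EFin \o (fun x => 0 * p x)).
  apply: eq_integrable (integrable_normal_bounded (leq0n 2) b0) => // x _ /=.
  by rewrite !mul0r.
have i1 : mu.-integrable setT (EFin \o (fun x => 1 * ((x - m) * p x))).
  exact: (integrable_normal_bounded (leqnSn 1) b1).
have d1 (x : R) : is_derive x 1 (fun _ : R => 1 : R) 0 by exact: is_derive_cst.
have c0 : continuous (fun _ : R => 0 : R) by move=> x; exact: cvg_cst.
have := Rintegral_normal_stein d1 c0 i0 i1 hC.
under eq_Rintegral do rewrite mul1r.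
move=> ->; under eq_Rintegral do rewrite mul0r.
by rewrite Rintegral_cst// mul0r mulr0.
Qed.

Lemma normal_variance : \int[mu]_x ((x - m) ^+ 2 * p x) = s ^+ 2.
Proof.
have b1 := @bmeas_cst R _ (measurableTypeR R) 1.
have [C hC] := normal_moment_bound (leqnn 2).
have i0 : mu.-integrable setT (EFin \o (fun x => 1 * p x)).
  apply: eq_integrable (integrable_normal_bounded (leq0n 2) b1) => // x _ /=.
  by rewrite mul1r.
have i2 : mu.-integrable setT (EFin \o (fun x => (x - m) * ((x - m) * p x))).
  apply: eq_integrable (integrable_normal_bounded (leqnn 2) b1) => // x _ /=.
  by rewrite mul1r mulrA expr2.
have d1 (x : R) : is_derive x 1 (fun x : R => x - m) (1 : R).
  by apply: is_derive_eq; rewrite subr0.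
have c0 : continuous (fun _ : R => 1 : R) by move=> x; exact: cvg_cst.
have hC2 x : `|(x - m) * p x| * `|x - m| <= C.
  apply: le_trans (hC x).
  by rewrite normrM (ger0_norm (normal_pdf_ge0 _ _ _)) mulrAC -expr2.
have := Rintegral_normal_stein d1 c0 i0 i2 hC2.
under eq_Rintegral do rewrite mulrA -expr2.
move=> ->; under eq_Rintegral do rewrite mul1r.
by rewrite /Rintegral integral_normal_pdf mulr1.
Qed.

(** The characteristic function in real form: the phase [th] covers real and imaginary part at once,
    so that no complex-valued integral occurs. *)
Let cf (th t : R) := \int[mu]_x (cos (t * (x - m) + th) * p x).

Let mlin (t th : R) : measurable_fun setT (fun x : R => t * (x - m) + th).
Proof.
apply: measurable_funD => //; apply: measurable_funM => //.
exact: measurable_funB.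
Qed.

(** Differentiating under the integral brings out a factor x - m next to a sine, and Stein's
    identity trades this factor for s^2 t. *)
Let is_derive_cf (th t : R) : is_derive t 1 (cf th) (- (s ^+ 2 * t) * cf th t).
Proof.
have ic u : mu.-integrable setT (EFin \o (fun x => cos (u * (x - m) + th) * p x)).
  have := integrable_normal_bounded (leq0n 2) (bmeas_cos (mlin u th)).
  by apply: eq_integrable => // x _ /=; rewrite ?expr0 ?mul1r.
have is_ u : mu.-integrable setT
    (EFin \o (fun x => sin (u * (x - m) + th) * ((x - m) * p x))).
  have := integrable_normal_bounded (leqnSn 1) (bmeas_sin (mlin u th)).
  by apply: eq_integrable => // x _ /=; rewrite ?expr1.
have d1 (u x : R) : is_derive u 1 (fun u => cos (u * (x - m) + th) * p x)
    (- (sin (u * (x - m) + th) * ((x - m) * p x))).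
  apply: is_derive_eq; rewrite /GRing.scale/= !(mulr0,addr0,add0r,mulr1); ring.
pose G x := `|x - m| ^+ 1 * p x.
have d1E u x : (partial1of2 (fun u x => cos (u * (x - m) + th) * p x)) u x =
    - (sin (u * (x - m) + th) * ((x - m) * p x)).
  by rewrite partial1of2E; exact: derive_val.
have tI : `]t - 1, t + 1[%classic t by rewrite /= in_itv/=; apply/andP; split; lra.
have dd u x : derivable (fun u : R => cos (u * (x - m) + th) * p x) u 1.
  exact: ex_derive.
have Gge0 x : 0 <= G x by rewrite mulr_ge0 ?exprn_ge0 ?normal_pdf_ge0.
have G_ub u x : `|(partial1of2 (fun u x => cos (u * (x - m) + th) * p x)) u x| <= G x.
  rewrite d1E normrN !normrM (ger0_norm (normal_pdf_ge0 _ _ _)) /G expr1.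
  by rewrite ler_piMl ?mulr_ge0 ?normal_pdf_ge0// sin_max.
have iG := integrable_normal_moment m s0 (leqnSn 1).
have dcf := @derivable_under_integral R _ _ mu _ setT measurableT t (t - 1) (t + 1)
  tI (fun u _ => ic u) (fun u x _ _ => dd u x) G Gge0 iG (fun u x _ _ => G_ub u x).
have dvcf := @differentiation_under_integral R _ _ mu _ setT measurableT t (t - 1) (t + 1)
  tI (fun u _ => ic u) (fun u x _ _ => dd u x) G Gge0 iG (fun u x _ _ => G_ub u x).
have -> : - (s ^+ 2 * t) * cf th t = (cf th)^`()%classic t.
  rewrite dvcf; under eq_Rintegral do rewrite d1E.
  have [C hC] := bmeas_subr_bound (bmeas_sin (mlin t th)).
  have ds (x : R) : is_derive x 1 (fun x => sin (t * (x - m) + th))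
      (t * cos (t * (x - m) + th)).
    apply: is_derive_eq.
    by rewrite /GRing.scale/= !(mulr0,addr0,add0r,mulr1,subr0); ring.
  have cs : continuous (fun x => t * cos (t * (x - m) + th)).
    move=> x; apply: cvgM; first exact: cvg_cst.
    apply: (cvg_comp (fun x : R => t * (x - m) + th) cos); last exact: continuous_cos.
    apply: cvgD; last exact: cvg_cst.
    apply: cvgM; first exact: cvg_cst.
    by apply: cvgB; [exact: cvg_id|exact: cvg_cst].
  have itc : mu.-integrable setT (EFin \o (fun x => t * cos (t * (x - m) + th) * p x)).
    apply: eq_integrable (integrableZl measurableT t (ic t)) => // x _ /=.
    by rewrite -EFinM mulrA.
  have H := Rintegral_normal_stein ds cs itc (is_ t) hC.
  rewrite (_ : \int[mu]_x _ = -1 * \int[mu]_x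
    (sin (t * (x - m) + th) * ((x - m) * p x))); last first.
    rewrite -RintegralZl//; by under [RHS]eq_Rintegral do rewrite mulN1r.
  rewrite H; under [in RHS]eq_Rintegral do rewrite -mulrA.
  by rewrite RintegralZl// -/(cf th t); ring.
by rewrite derive1E; apply: DeriveDef => //; exact: dcf.
Qed.

Lemma Rintegral_cos_normal (t th : R) :
  \int[mu]_x (cos (t * (x - m) + th) * p x) = cos th * expR (- ((s * t) ^+ 2 / 2)).
Proof.
(* Integrating factor of the linear differential equation of [cf]: [psi] has derivative zero and
   keeps its value at t = 0. *)
pose psi (t : R) := cf th t * expR ((s * t) ^+ 2 / 2).
have dpsi (u : R) : is_derive u 1 psi 0.
  have H := is_derive_cf th u.
  apply: is_derive_eq; rewrite /GRing.scale/= !(mulr0,addr0,add0r,mulr1).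
  by field.
have psi0 : psi 0 = cos th.
  rewrite /psi /cf; under eq_Rintegral do rewrite mul0r add0r.
  rewrite RintegralZl//; last exact: integrable_normal_pdf.
  rewrite /Rintegral integral_normal_pdf/= mulr1.
  by rewrite mulr0 expr0n/= mul0r expR0 mulr1.
have : psi t = cos th by rewrite -psi0; exact: is_derive_0_is_cst.
rewrite /psi /cf => <-; rewrite -mulrA -expRD addrN expR0 mulr1.
by [].
Qed.

End normal_cf.

(** * Transfer of laws and centered Gaussian variables *)

Section law_transfer.
Context {R : realType} {d d' : measure_display} {T : measurableType d}
  {U : measurableType d'}.
Variables (P : probability T R) (nu : {measure set U -> \bar R}) (X : T -> U).
Hypothesis mX : measurable_fun setT X.
Hypothesis lawX : forall A, measurable A -> P (X @^-1` A) = nu A.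

Lemma law_integrable (f : U -> R) : measurable_fun setT f ->
  P.-integrable setT (EFin \o (fun w => f (X w))) ->
  nu.-integrable setT (EFin \o f).
Proof.
move=> mf iP.
have mEf : measurable_fun setT (EFin \o f) by exact/measurable_EFinP.
have /integrableP[_ H] := @integrable_pushforward _ _ _ _ R X mX P setT
  (EFin \o f) mEf iP measurableT.
apply/integrableP; split => //; apply: le_lt_trans H.
by rewrite le_eqVlt; apply/orP; left; apply/eqP; apply: eq_measure_integral => A mA _;
   rewrite -lawX.
Qed.

Lemma law_Rintegral (f : U -> R) : measurable_fun setT f ->
  P.-integrable setT (EFin \o (fun w => f (X w))) ->
  \int[P]_w f (X w) = \int[nu]_x f x.
Proof.
move=> mf iP.
have mEf : measurable_fun setT (EFin \o f) by exact/measurable_EFinP.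
rewrite /Rintegral; congr fine.
transitivity (\int[pushforward P X]_x (f x)%:E)%E.
  by rewrite integral_pushforward.
by apply: eq_measure_integral => A mA _; rewrite -lawX.
Qed.

End law_transfer.

Section normal_probability.
Context {R : realType}.
Notation mu := (@lebesgue_measure R).

(** The change of variables goes through the Radon-Nikodym derivative, which agrees almost
    everywhere with the density because both have the same integral over every measurable set. *)
Lemma Rintegral_normal_prob (m s : R) (f : R -> R) :
  measurable_fun setT f ->
  (normal_prob m s).-integrable setT (EFin \o f) ->
  \int[normal_prob m s]_x f x = \int[mu]_x (f x * normal_pdf m s x).
Proof.
move=> mf intf; rewrite /Rintegral; congr fine.
have dom := normal_prob_dominates m s.
rewrite -(Radon_Nikodym_change_of_variables dom)//.
apply: ae_eq_integral => //.
- apply: emeasurable_funM; first exact/measurable_EFinP.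
  by apply: (measurable_int mu); exact: Radon_Nikodym_integrable.
- apply/measurable_EFinP; apply: measurable_funM => //.
  exact: measurable_normal_pdf.
under [X in ae_eq _ _ _ X]eq_fun do rewrite EFinM.
apply: ae_eqe_mul2l; rewrite Radon_NikodymE//=.
case: cid => /= h [h1 h2 h3].
apply: integral_ae_eq => //.
- by apply/measurable_EFinP; exact: measurable_normal_pdf.
- by move=> E E01 mE; rewrite -h3.
Qed.

Lemma Rintegral_dirac (a : R) (f : R -> R) : measurable_fun setT f ->
  \int[dirac a]_x f x = f a.
Proof.
move=> mf; have mEf : measurable_fun setT (EFin \o f) by exact/measurable_EFinP.
have := integral_dirac a measurableT mEf.
by rewrite /Rintegral /= diracT mul1e => ->.
Qed.

Lemma Rintegral_cos_normal_prob (s t th : R) : s != 0 ->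
  \int[normal_prob 0 s]_x cos (t * x + th) =
  cos th * expR (- ((s * t) ^+ 2 / 2)).
Proof.
move=> s0; have mc : measurable_fun setT (fun x : R => t * x + th).
  by apply: measurable_funD => //; exact: measurable_funM.
have bc := bmeas_cos mc.
rewrite Rintegral_normal_prob//; last exact: bmeas_integrable.
  by rewrite -(Rintegral_cos_normal 0)//; under [RHS]eq_Rintegral do rewrite subr0.
by case: bc.
Qed.

Section gaussian_rv.
Context {d : measure_display} {T : measurableType d} (P : probability T R).
Variables (X : T -> R) (v : R).
Hypotheses (mX : measurable_fun setT X) (gX : gaussian_rv P X).
Hypothesis iX : P.-integrable setT (EFin \o X).
Hypothesis iX2 : P.-integrable setT (EFin \o (fun w => X w ^+ 2)).
Hypotheses (EX : \int[P]_w X w = 0) (EX2 : \int[P]_w X w ^+ 2 = v).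

(** The first two moments determine the parameters in either alternative of [gaussian_rv]. The
    degenerate one must be kept: a linear combination of the sequence may vanish. *)
Lemma gaussian_rv_cases :
  (exists s, [/\ s != 0, s ^+ 2 = v &
    forall A : set R, measurable A -> P (X @^-1` A) = normal_prob 0 s A]) \/
  (v = 0 /\ forall A : set R, measurable A -> P (X @^-1` A) = \d_(0:R) A).
Proof.
have mid : measurable_fun setT (@id R) by exact: measurable_id.
have msq : measurable_fun setT (fun x : R => x ^+ 2).
  exact: measurable_funX.
case: gX => [[m [s [s0 law]]]|[m law]].
- left; exists s.
  have i1 := law_integrable (nu := normal_prob m s) mX law mid iX.
  have i2 := law_integrable (nu := normal_prob m s) mX law msq iX2.
  have b1 := @bmeas_cst R _ (measurableTypeR R) 1.
  have j0 : mu.-integrable setT (EFin \o normal_pdf m s).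
    exact: integrable_normal_pdf.
  have j1 : mu.-integrable setT (EFin \o (fun x => (x - m) * normal_pdf m s x)).
    apply: eq_integrable (integrable_normal_bounded m s0 (leqnSn 1) b1) => // x _ /=.
    by rewrite mul1r.
  have j0m : mu.-integrable setT (EFin \o (fun x => m * normal_pdf m s x)).
    by apply: eq_integrable (integrableZl measurableT m j0).
  have m0 : m = 0.
    rewrite -EX (law_Rintegral (nu := normal_prob m s) mX law mid iX) Rintegral_normal_prob//.
    transitivity (\int[mu]_x ((x - m) * normal_pdf m s x + m * normal_pdf m s x)).
      rewrite RintegralD// normal_mean0// add0r RintegralZl//.
      by rewrite /Rintegral integral_normal_pdf mulr1.
    by apply: eq_Rintegral => x _; rewrite -mulrDl subrK.
  subst m; split => //.
  rewrite -EX2 (law_Rintegral (nu := normal_prob 0 s) mX law msq iX2) Rintegral_normal_prob//.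
  by rewrite -(normal_variance 0 s0); apply: eq_Rintegral => x _; rewrite subr0.
- right.
  have m0 : m = 0.
    by rewrite -EX (law_Rintegral (nu := dirac m) mX law mid iX) Rintegral_dirac.
  subst m; split => //.
  rewrite -EX2 (law_Rintegral (nu := dirac (0 : R)) mX law msq iX2) Rintegral_dirac//.
  by rewrite expr0n.
Qed.

Lemma gaussian_rv_law : 0 < v ->
  forall A : set R, measurable A -> P (X @^-1` A) = normal_prob 0 (Num.sqrt v) A.
Proof.
move=> v0; case: gaussian_rv_cases => [[s [s0 sv law]] A mA|[]]; last first.
  by move=> v00; move: v0; rewrite v00 ltxx.
(* [s] may be negative; the density depends on it only through s^2, so it can be replaced by its
   absolute value. *)
rewrite law// -sv sqrtr_sqr /normal_prob.
apply: eq_integral => x _; rewrite !normal_pdfE ?normr_eq0//.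
by rewrite /normal_peak /normal_fun real_normK ?num_real.
Qed.

(** Degenerate and nondegenerate laws obey one formula, v = 0 giving the constant cos th: in terms
    of characteristic functions the case distinction disappears. *)
Lemma gaussian_rv_cf (t th : R) :
  \int[P]_w cos (t * X w + th) = cos th * expR (- (v * t ^+ 2 / 2)).
Proof.
have mc : measurable_fun setT (fun x : R => t * x + th).
  by apply: measurable_funD => //; exact: measurable_funM.
have bc := bmeas_cos mc.
have ic : P.-integrable setT (EFin \o (fun w => cos (t * X w + th))).
  exact: bmeas_integrable (bmeas_comp mX bc).
case: gaussian_rv_cases => [[s [s0 sv law]]|[-> law]].
- rewrite (law_Rintegral (nu := normal_prob 0 s) mX law (bmeasW bc) ic) Rintegral_cos_normal_prob//.
  by rewrite exprMn sv.
- rewrite (law_Rintegral (nu := dirac (0 : R)) mX law (bmeasW bc) ic).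
  rewrite Rintegral_dirac ?mulr0 ?add0r ?mul0r ?oppr0 ?expR0 ?mulr1//.
  exact: bmeasW.
Qed.

End gaussian_rv.
End normal_probability.

(** * Uniqueness of characteristic functions *)

Section bounded_convergence.
Context {R : realType} {d : measure_display} {T : measurableType d}.

Lemma bmeas_bool (b : T -> bool) : measurable_fun setT b ->
  bmeas (fun x => (b x)%:R : R).
Proof.
move=> /measurable_true_set mB.
rewrite (_ : (fun x => _) = \1_[set x | b x]); first exact: bmeas_indic.
by apply/funext => x; rewrite indicE mem_setE.
Qed.

Lemma Rintegral_bool (P : probability T R) (b : T -> bool) : measurable_fun setT b ->
  \int[P]_x (b x)%:R = fine (P [set x | b x]).
Proof.
move=> /measurable_true_set mB.
rewrite -Rintegral_indic_prob//; apply: eq_Rintegral => x _.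
by rewrite indicE mem_setE.
Qed.

Lemma bounded_convergence (P : probability T R) (f_ : nat -> T -> R) (f : T -> R) (M : R) :
  (forall n, measurable_fun setT (f_ n)) -> measurable_fun setT f ->
  (forall n x, `|f_ n x| <= M) -> (forall x, f_ n x @[n --> \oo] --> f x) ->
  \int[P]_x f_ n x @[n --> \oo] --> \int[P]_x f x.
Proof.
move=> mf_ mf fM ff.
have mf_E n : measurable_fun setT (EFin \o f_ n) by exact/measurable_EFinP.
have mfE : measurable_fun setT (EFin \o f) by exact/measurable_EFinP.
have iM : P.-integrable setT (EFin \o (fun _ : T => M)).
  by apply: bmeas_integrable; exact: bmeas_cst.
have c1 : {ae P, forall x, setT x -> (fun n => EFin \o f_ n) ^~ x @ \oo --> (EFin \o f) x}.
  apply: aeW => x _; apply: cvg_EFin; [exact: nearW|exact: ff].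
have c2 : {ae P, forall x n, setT x -> (`|(EFin \o f_ n) x| <= (EFin \o (fun _ : T => M)) x)%E}.
  by apply: aeW => x n _; rewrite /= lee_fin.
have [intf _ H] := @dominated_convergence _ _ R P setT measurableT
  (fun n => EFin \o f_ n) (EFin \o f) (EFin \o (fun _ => M)) mf_E mfE c1 iM c2.
have : fine (\int[P]_x (f_ n x)%:E)%E @[n --> \oo] --> fine (\int[P]_x (f x)%:E)%E.
  apply: fine_cvg; rewrite fineK//; exact: integrable_fin_num.
by [].
Qed.

End bounded_convergence.

Section normal_halfline.
Context {R : realType}.
Notation mu := (@lebesgue_measure R).

(** The distribution function at [y] of a normal law, to be read as a function of its mean [m]: for
    small [s] it smooths the indicator of m <= y. *)
Definition normal_halfline (s y m : R) : R :=
  \int[mu]_x ((x <= y)%R%:R * normal_pdf m s x).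

Variables (s : R).
Hypothesis s0 : s != 0.

Let mle (y : R) : measurable_fun setT (fun x : R => x <= y).
Proof. exact: measurable_fun_ler. Qed.

Let ib (m : R) (b : R -> bool) : measurable_fun setT b ->
  mu.-integrable setT (EFin \o (fun x => (b x)%:R * normal_pdf m s x)).
Proof.
move=> mb; have := integrable_normal_bounded m s0 (leq0n 2) (@bmeas_bool R _ _ b mb).
by apply: eq_integrable => // x _ /=; rewrite expr0 mul1r.
Qed.

Let i2 (m c : R) : mu.-integrable setT
  (EFin \o (fun x => c * ((x - m) ^+ 2 * normal_pdf m s x))).
Proof.
exact: (integrable_normal_bounded m s0 (leqnn 2) (@bmeas_cst R _ (measurableTypeR R) c)).
Qed.

Let cheb (m c : R) (b : R -> bool) : measurable_fun setT b -> 0 < c ->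
  (forall x, b x -> c <= `|x - m|) ->
  \int[mu]_x ((b x)%:R * normal_pdf m s x) <= s ^+ 2 / c ^+ 2.
Proof.
move=> mb c0 bc; rewrite -(normal_variance m s0) mulrC -RintegralZl//; last first.
  by have := i2 m 1; under eq_fun do rewrite mul1r.
apply: le_Rintegral => //; [exact: ib|move=> x _].
rewrite mulrA ler_wpM2r ?normal_pdf_ge0//.
case: (b x) (bc x) => [/(_ isT) cx|_]; last by rewrite mulr_ge0 ?invr_ge0 ?sqr_ge0.
rewrite mulrC ler_pdivlMr ?exprn_gt0// mul1r -(ger0_norm (ltW c0)).
by rewrite -[leRHS]real_normK ?num_real// lerXn2r ?nnegrE ?normr_ge0// (ger0_norm (ltW c0)).
Qed.

Lemma normal_halfline_ge0 (y m : R) : 0 <= normal_halfline s y m.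
Proof.
by apply: Rintegral_ge0 => x _; rewrite mulr_ge0// normal_pdf_ge0.
Qed.

Lemma normal_halflineC (y m : R) :
  1 - normal_halfline s y m = \int[mu]_x ((y < x)%R%:R * normal_pdf m s x).
Proof.
have H1 : \int[mu]_x normal_pdf m s x = 1.
  by rewrite /Rintegral integral_normal_pdf.
rewrite -[X in X - normal_halfline _ _ _]H1.
rewrite -RintegralB//; [|exact: integrable_normal_pdf|exact: ib].
apply: eq_Rintegral => x _; rewrite -[X in X - _]mul1r -mulrBl; congr (_ * _).
by case: leP => _ /=; rewrite ?subrr ?subr0.
Qed.

Lemma normal_halfline_le1 (y m : R) : normal_halfline s y m <= 1.
Proof.
rewrite -subr_ge0 normal_halflineC.
by apply: Rintegral_ge0 => x _; rewrite mulr_ge0// normal_pdf_ge0.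
Qed.

Lemma normal_halfline_lt (y m : R) : y < m ->
  normal_halfline s y m <= s ^+ 2 / (m - y) ^+ 2.
Proof.
move=> ym; apply: cheb; rewrite ?subr_gt0// => x xy.
by rewrite distrC ger0_norm; lra.
Qed.

Lemma normal_halfline_gt (y m : R) : m < y ->
  1 - normal_halfline s y m <= s ^+ 2 / (y - m) ^+ 2.
Proof.
move=> ym; rewrite normal_halflineC; apply: cheb; rewrite ?subr_gt0//.
  exact: measurable_fun_ltr.
move=> x xy.
by rewrite ger0_norm; lra.
Qed.

End normal_halfline.

Section normal_halfline_cvg.
Context {R : realType}.

(** The deviation (n + 1)^-2 is of smaller order than the shift (n + 1)^-1 of the threshold. Hence
    the limit is 1 even at m = y, convergence holds at every point, and atoms need no separate
    treatment. *)
Let sg (n : nat) : R := n.+1%:R^-1 ^+ 2.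
Let yn (y : R) (n : nat) : R := y + n.+1%:R^-1.

Lemma cvg_normal_halfline (y m : R) :
  normal_halfline (sg n) (yn y n) m @[n --> \oo] --> ((m <= y)%R%:R : R).
Proof.
have sg0 n : sg n != 0 by rewrite /sg expf_neq0// invr_eq0 pnatr_eq0.
have cv1 : (n.+1%:R^-1 : R) @[n --> \oo] --> (0 : R).
  exact: cvg_harmonic.
have sg2 n : sg n ^+ 2 <= n.+1%:R^-1 ^+ 2 * n.+1%:R^-1.
  rewrite /sg [leRHS]mulrC [leLHS]expr2 ler_wpM2r ?sqr_ge0//.
  by rewrite expr2 ler_piMl ?invr_ge0// invf_le1 ?ltr0n// ler1n.
suff [C HC] : exists C : R, \forall n \near \oo,
    `|(m <= y)%R%:R - normal_halfline (sg n) (yn y n) m| <= C * n.+1%:R^-1.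
  apply/cvgrPdist_le => e e0; near=> n.
  have Hn : C * n.+1%:R^-1 <= e.
    have : `|C| * n.+1%:R^-1 <= e.
      near: n; have : (`|C| * n.+1%:R^-1 : R) @[n --> \oo] --> (`|C| * 0 : R).
        by apply: cvgM => //; exact: cvg_cst.
      rewrite mulr0 => /cvgrPdist_le /(_ e e0); apply: filterS => n.
      by rewrite sub0r normrN; apply: le_trans; exact: ler_norm.
    by apply: le_trans; rewrite ler_wpM2r// ler_norm.
  by apply: le_trans Hn; near: n.
have [my|ym] := leP m y.
  exists 1; apply: nearW => n /=.
  rewrite ger0_norm ?subr_ge0 ?normal_halfline_le1//.
  have ip : 0 < n.+1%:R^-1 :> R by rewrite invr_gt0 ltr0n.
  have myn : m < yn y n by apply: (le_lt_trans my); rewrite ltrDl.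
  apply: le_trans (normal_halfline_gt (sg0 n) myn) _.
  rewrite ler_pdivrMr ?exprn_gt0 ?subr_gt0// mul1r mulrC.
  apply: le_trans (sg2 n) _; rewrite ler_wpM2r ?(ltW ip)//.
  by rewrite lerXn2r ?nnegrE ?(ltW ip)// ?subr_ge0 ?(ltW myn)// /yn addrAC lerDr subr_ge0.
have e0 : 0 < (m - y) / 2 by lra.
(* Once 1 / (n + 1) is at most (m - y) / 2, the shifted threshold stays at distance at least (m - y)
   / 2 from [m], which bounds the Chebyshev denominator. *)
exists (((m - y) / 2) ^- 2); near=> n => /=.
have ip : 0 < n.+1%:R^-1 :> R by rewrite invr_gt0 ltr0n.
have ny : n.+1%:R^-1 <= (m - y) / 2.
  near: n; move: cv1 => /cvgrPdist_le /(_ _ e0); apply: filterS => n.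
  by rewrite sub0r normrN; apply: le_trans; exact: ler_norm.
rewrite sub0r normrN ger0_norm ?normal_halfline_ge0//.
have myn : yn y n < m.
  by rewrite /yn; move: (n.+1%:R^-1) ip ny => z ip ny; lra.
apply: le_trans (normal_halfline_lt (sg0 n) myn) _.
rewrite mulrC ler_pM ?invr_ge0 ?sqr_ge0//.
  have h2 : 0 < m - yn y n by rewrite subr_gt0.
  have h3 : (m - y) / 2 <= m - yn y n.
    by rewrite /yn; move: (n.+1%:R^-1) ip ny => z ip ny; lra.
  rewrite lef_pV2 ?posrE ?exprn_gt0//.
  by rewrite lerXn2r// nnegrE ltW.
apply: le_trans (sg2 n) _; rewrite ler_piMl ?(ltW ip)//.
by rewrite expr_le1// ?(ltW ip)// invf_le1 ?ltr0n// ler1n.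
Unshelve. all: by end_near. Qed.

End normal_halfline_cvg.

Section measurable_halfline.
Context {R : realType}.
Notation mu := (@lebesgue_measure R).

Lemma measurable_normal_pdf2 (d : measure_display) (T : measurableType d)
    (f g : T -> R) (s : R) : s != 0 ->
  measurable_fun setT f -> measurable_fun setT g ->
  measurable_fun setT (fun z => normal_pdf (f z) s (g z)).
Proof.
move=> s0 mf mg; under eq_fun do rewrite normal_pdf_expR//.
apply: measurable_funM => //; apply: measurableT_comp; first exact: measurable_expR.
apply: measurableT_comp; first exact: oppr_measurable.
by apply: measurable_funM => //; apply: measurable_funX; exact: measurable_funB.
Qed.

Lemma measurable_normal_halfline (s y : R) : s != 0 ->
  measurable_fun setT (normal_halfline s y).
Proof.
move=> s0; pose f (z : R * measurableTypeR R) : \bar R :=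
  ((z.2 <= y)%R%:R * normal_pdf z.1 s z.2)%:E.
have mle : measurable_fun setT (fun x : R => x <= y) by exact: measurable_fun_ler.
have ble := @bmeas_bool R _ (measurableTypeR R) _ mle.
have mf : measurable_fun setT f.
  apply/measurable_EFinP; apply: measurable_funM.
    by apply: (measurableT_comp (bmeasW ble)); exact: measurable_snd.
  by apply: measurable_normal_pdf2 => //; exact: measurable_snd.
apply: (measurableT_comp (fine_measurable measurableT)).
apply: (@measurable_fun_fubini_tonelli_F _ _ _ _ _ mu f) => //.
by move=> z; rewrite /f lee_fin mulr_ge0// normal_pdf_ge0.
Qed.

End measurable_halfline.

Section smoothing.
Context {R : realType} {d : measure_display} {T : measurableType d}.
Variables (P : probability T R) (w X : T -> R).
Hypotheses (bw : bmeas w) (mX : measurable_fun setT X).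
Notation mu := (@lebesgue_measure R).

(* The normal density is, up to scaling, its own Fourier transform: this takes
   the place of an inversion formula. *)
Lemma Rintegral_normal_pdf_cf (s x : R) : s != 0 ->
  \int[P]_o (w o * normal_pdf (X o) s x) =
  normal_peak s * \int[normal_prob 0 1]_u
    \int[P]_o (w o * cos (u / s * X o + - (u / s * x))).
Proof.
move=> s0; pose f (z : T * R) := w z.1 * cos (z.2 / s * X z.1 + - (z.2 / s * x)).
have bf : bmeas f.
  apply: bmeasM; first by apply: bmeas_comp bw; exact: measurable_fst.
  apply: bmeas_cos; apply: measurable_funD.
    apply: measurable_funM; last exact: measurableT_comp.
    by apply: measurable_funM => //; exact: measurable_snd.
  apply: measurableT_comp; first exact: oppr_measurable.
  by do 2 (apply: measurable_funM => //); exact: measurable_snd.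
rewrite -(bfubini2 P (normal_prob 0 1) bf) bfubini1// -RintegralM_cst; last first.
  exact: bmeas_fubini1.
apply: eq_Rintegral => o _; rewrite /f /=.
have bc : bmeas (fun u : R => cos (u / s * X o - u / s * x)).
  apply: bmeas_cos; apply: measurable_funB;
    by do 2 (apply: measurable_funM => //).
rewrite RintegralM_cst// mulrCA; congr (_ * _).
transitivity (normal_peak s * \int[normal_prob 0 1]_u cos ((X o - x) / s * u + 0)).
  rewrite Rintegral_cos_normal_prob ?oner_neq0// cos0 !mul1r normal_pdf_expR//.
  congr (_ * expR (- _)); by field.
congr (_ * _); apply: eq_Rintegral => u _; congr cos; by field.
Qed.

(** Lebesgue measure is infinite, so the exchange of integrals rests on domination: [w] is bounded
    and each normal density has mass one. What remains depends on the law only through density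
    smoothings, hence through cosine integrals. *)
Lemma Rintegral_normal_halfline (s y : R) : s != 0 ->
  \int[P]_o (w o * normal_halfline s y (X o)) =
  \int[mu]_x ((x <= y)%R%:R * \int[P]_o (w o * normal_pdf (X o) s x)).
Proof.
move=> s0; pose f (z : T * measurableTypeR R) : \bar R :=
  (w z.1 * ((z.2 <= y)%R%:R * normal_pdf (X z.1) s z.2))%:E.
have mle : measurable_fun setT (fun x : R => x <= y) by exact: measurable_fun_ler.
have ble := @bmeas_bool R _ (measurableTypeR R) _ mle.
have mf : measurable_fun setT f.
  apply/measurable_EFinP; apply: measurable_funM.
    by apply: measurableT_comp; [exact: bmeasW|exact: measurable_fst].
  apply: measurable_funM.
    exact: (measurableT_comp (bmeasW ble) (@measurable_snd _ _ T (measurableTypeR R))).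
  apply: measurable_normal_pdf2 => //.
  exact: (measurableT_comp mX (@measurable_fst _ _ T (measurableTypeR R))).
have [_ [M wM]] := bw.
have ipdf o : mu.-integrable setT
    (EFin \o (fun x : R => w o * ((x <= y)%R%:R * normal_pdf (X o) s x))).
  have b2 : bmeas (fun x : measurableTypeR R => w o * (x <= y)%R%:R).
    by apply: bmeasM => //; exact: bmeas_cst.
  have := integrable_normal_bounded (X o) s0 (leq0n 2) b2.
  by apply: eq_integrable => // x _ /=; rewrite expr0 mul1r mulrA.
have if_ : (P \x mu)%E.-integrable setT f.
  apply/(integrable12ltyP P mu mf).
  apply: (@le_lt_trans _ _ (\int[P]_o `|M|%:E)%E); last first.
    by rewrite integral_cst//= probability_setT mule1 ltry.
  apply: ge0_le_integral => //.
  - by move=> o _; apply: integral_ge0 => x _; exact: abse_ge0.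
  - apply: (@measurable_fun_fubini_tonelli_F _ _ _ _ _ mu (abse \o f)).
      by apply: measurableT_comp => //; exact: abse_measurable.
    by move=> o; rewrite /f /= lee_fin.
  - move=> o _; apply: (@le_trans _ _ (\int[mu]_x (`|M| * normal_pdf (X o) s x)%:E)%E).
      apply: ge0_le_integral => //.
      + apply: measurableT_comp; first exact: abse_measurable.
        exact: (measurable_int mu (ipdf o)).
      + apply/measurable_EFinP; apply: measurable_funM => //.
        exact: measurable_normal_pdf.
      + move=> x _; rewrite /f /= lee_fin normrM ler_pM//.
          by rewrite (le_trans (wM o))// ler_norm.
        rewrite ger0_norm ?mulr_ge0 ?normal_pdf_ge0//.
        by case: (x <= y) => /=; rewrite ?mul1r ?mul0r ?normal_pdf_ge0.
    under eq_integral do rewrite EFinM.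
    rewrite integralZl//; last exact: integrable_normal_pdf.
    by rewrite integral_normal_pdf mule1.
have := Fubini if_; rewrite /f /= => F.
transitivity (fine (\int[P]_o \int[mu]_x (w o * ((x <= y)%R%:R * normal_pdf (X o) s x))%:E)%E).
  rewrite /Rintegral; congr fine; apply: eq_integral => o _.
  rewrite /normal_halfline -RintegralZl//; last first.
    have := integrable_normal_bounded (X o) s0 (leq0n 2) ble.
    by apply: eq_integrable => // x _ /=; rewrite expr0 mul1r.
  by rewrite /Rintegral fineK//; apply: integrable_fin_num => //; exact: ipdf.
rewrite F /Rintegral; congr fine; apply: eq_integral => x _.
have bwp : bmeas (fun o => w o * normal_pdf (X o) s x).
  apply: bmeasM => //; split; first exact: measurable_normal_pdf2.
  exists (normal_peak s) => o; rewrite ger0_norm ?normal_pdf_ge0//.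
  exact: normal_pdf_ub.
under [LHS]eq_integral do rewrite mulrCA.
rewrite -[RHS]/((_ * \int[P]_o _)%:E) -RintegralM_cst//.
rewrite /Rintegral fineK//; apply: integrable_fin_num => //.
by apply: bmeas_integrable; apply: bmeasM => //; exact: bmeas_cst.
Qed.

End smoothing.

Section charfun.
Context {R : realType} {d d' : measure_display} {T : measurableType d}
  {T' : measurableType d'}.
Variables (P : probability T R) (P' : probability T' R).

(* The weights are signed: this is what lets one replace the coordinates of a
   random vector one at a time. *)
Lemma weighted_charfun_unique (w X : T -> R) (w' X' : T' -> R) :
  bmeas w -> bmeas w' -> measurable_fun setT X -> measurable_fun setT X' ->
  (forall t th, \int[P]_o (w o * cos (t * X o + th)) =
                \int[P']_o (w' o * cos (t * X' o + th))) ->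
  forall y, \int[P]_o (w o * (X o <= y)%R%:R) =
            \int[P']_o (w' o * (X' o <= y)%R%:R).
Proof.
move=> bw bw' mX mX' H y.
have key (s z : R) : s != 0 -> \int[P]_o (w o * normal_halfline s z (X o)) =
    \int[P']_o (w' o * normal_halfline s z (X' o)).
  move=> s0; rewrite !Rintegral_normal_halfline//; apply: eq_Rintegral => x _.
  congr (_ * _); rewrite !Rintegral_normal_pdf_cf//; congr (_ * _).
  by apply: eq_Rintegral => u _; exact: H.
pose sg (n : nat) : R := n.+1%:R^-1 ^+ 2.
have sg0 n : sg n != 0 by rewrite /sg expf_neq0// invr_eq0 pnatr_eq0.
have cv (d1 : measure_display) (T1 : measurableType d1) (Q : probability T1 R)
    (v Z : T1 -> R) : bmeas v -> measurable_fun setT Z ->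
    \int[Q]_o (v o * normal_halfline (sg n) (y + n.+1%:R^-1) (Z o)) @[n --> \oo]
      --> \int[Q]_o (v o * (Z o <= y)%R%:R).
  move=> bv mZ; have [mv [M vM]] := bv.
  apply: (@bounded_convergence _ _ _ Q _ _ M) => [n||n o|o].
  - apply: measurable_funM => //; apply: measurableT_comp mZ.
    exact: measurable_normal_halfline.
  - apply: measurable_funM => //; apply: bmeasW; apply: bmeas_bool.
    exact: measurable_fun_ler.
  - rewrite normrM -[M]mulr1 ler_pM//.
    by rewrite ger0_norm ?normal_halfline_ge0// normal_halfline_le1.
  - by apply: cvgM; [exact: cvg_cst|exact: cvg_normal_halfline].
have H1 := cv _ _ P w X bw mX; have H2 := cv _ _ P' w' X' bw' mX'.
rewrite (_ : (fun n => _) = (fun n =>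
  \int[P']_o (w' o * normal_halfline (sg n) (y + n.+1%:R^-1) (X' o)))) in H1.
  exact: (cvg_unique _ H1 H2).
by apply/funext => n; exact: key.
Qed.

End charfun.

Lemma measurable_box (R : realType) (I : finType) (d : measure_display)
    (T : measurableType d) (Z : I -> T -> R) (y : I -> R) :
  (forall i, measurable_fun setT (Z i)) ->
  measurable [set o | forall i, Z i o <= y i].
Proof.
move=> mZ; apply: measurable_forall => i; apply: measurable_true_set.
exact: measurable_fun_ler.
Qed.

Section cramer_wold.
Context {R : realType} {d d' : measure_display} {T : measurableType d}
  {T' : measurableType d'}.
Variables (P : probability T R) (P' : probability T' R).

Section box.
Variables (I : finType) (X : I -> T -> R) (X' : I -> T' -> R).
Hypotheses (mX : forall i, measurable_fun setT (X i))
           (mX' : forall i, measurable_fun setT (X' i)).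
Hypothesis cfX : forall (t : I -> R) th,
  \int[P]_o cos (\sum_i t i * X i o + th) =
  \int[P']_o cos (\sum_i t i * X' i o + th).

Let box (d1 : measure_display) (T1 : measurableType d1) (Z : I -> T1 -> R)
  (y : I -> R) (r : seq I) o : R := \prod_(i <- r) (Z i o <= y i)%R%:R.

(** Coordinates in [r] have already been turned into indicators by [box]; the remaining ones still
    sit in the cosine. *)
Let phase (d1 : measure_display) (T1 : measurableType d1) (Z : I -> T1 -> R)
  (t : I -> R) th (r : seq I) o : R := \sum_(i | i \notin r) t i * Z i o + th.

Let bbox (d1 : measure_display) (T1 : measurableType d1) (Z : I -> T1 -> R) y r :
  (forall i, measurable_fun setT (Z i)) -> bmeas (box Z y r).
Proof.
move=> mZ; elim: r => [|i r IH].
  by rewrite /box; under eq_fun do rewrite big_nil; exact: bmeas_cst.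
rewrite /box; under eq_fun do rewrite big_cons; apply: bmeasM => //.
by apply: bmeas_bool; exact: measurable_fun_ler.
Qed.

Let mphase (d1 : measure_display) (T1 : measurableType d1) (Z : I -> T1 -> R)
    t th r : (forall i, measurable_fun setT (Z i)) ->
  measurable_fun setT (phase Z t th r).
Proof.
move=> mZ; apply: measurable_funD => //.
rewrite /phase; under eq_fun do rewrite -big_filter.
apply: measurable_sum => i; exact: measurable_funM.
Qed.

Let phase_cons (d1 : measure_display) (T1 : measurableType d1) (Z : I -> T1 -> R)
    t th i r o u : i \notin r ->
  u * Z i o + phase Z t th (i :: r) o =
  phase Z (fun j => if j == i then u else t j) th r o.
Proof.
move=> ir; rewrite /phase [in RHS](bigD1 i)//= eqxx -addrA; congr (_ + (_ + _)).
apply: eq_big => [j|j]; first by rewrite inE negb_or andbC.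
by rewrite inE negb_or => /andP[/negbTE ->].
Qed.

Let cos_prod (a b : R) : cos a * cos b = 2^-1 * cos (b + a) + 2^-1 * cos (- b + a).
Proof. by rewrite !cosD cosN sinN; field. Qed.

(** Induction moves one coordinate at a time from the cosine to the indicators. Everything but
    coordinate i serves as signed weight for [weighted_charfun_unique]; the product of cosines that
    arises is a sum of two cosines with coefficients u and -u at i, both covered by the induction
    hypothesis. *)
Let box_phase (y t : I -> R) th (r : seq I) : uniq r ->
  \int[P]_o (box X y r o * cos (phase X t th r o)) =
  \int[P']_o (box X' y r o * cos (phase X' t th r o)).
Proof.
elim: r t th => [|i r IH] t th /= => [_|/andP[ir ur]].
  rewrite /box /phase.
  under [LHS]eq_Rintegral do rewrite big_nil mul1r.
  under [RHS]eq_Rintegral do rewrite big_nil mul1r.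
  exact: cfX.
rewrite /box.
under [LHS]eq_Rintegral do rewrite big_cons -mulrA mulrC.
under [RHS]eq_Rintegral do rewrite big_cons -mulrA mulrC.
apply: weighted_charfun_unique => //.
- by apply: bmeasM; [exact: bbox|apply: bmeas_cos; exact: mphase].
- by apply: bmeasM; [exact: bbox|apply: bmeas_cos; exact: mphase].
move=> u ph.
have E (d1 : measure_display) (T1 : measurableType d1) (Q : probability T1 R)
  (Z : I -> T1 -> R) : (forall i, measurable_fun setT (Z i)) ->
  \int[Q]_o (box Z y r o * cos (phase Z t th (i :: r) o) * cos (u * Z i o + ph)) =
  2^-1 * \int[Q]_o (box Z y r o *
    cos (phase Z (fun j => if j == i then u else t j) (th + ph) r o)) +
  2^-1 * \int[Q]_o (box Z y r o *
    cos (phase Z (fun j => if j == i then - u else t j) (th - ph) r o)).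
  move=> mZ; have bb (t' : I -> R) th' : bmeas (fun o => box Z y r o * cos (phase Z t' th' r o)).
    by apply: bmeasM; [exact: bbox|apply: bmeas_cos; exact: mphase].
  rewrite -!RintegralM_cst// -bRintegralD//; last 2 first.
    by apply: bmeasM => //; exact: bmeas_cst.
    by apply: bmeasM => //; exact: bmeas_cst.
  apply: eq_Rintegral => o _; rewrite -mulrA cos_prod -!phase_cons//.
  rewrite mulrDr !(mulrCA (box _ _ _ _)); congr (_ * (_ * cos _) + _ * (_ * cos _)).
    rewrite /phase; ring.
  rewrite /phase; ring.
rewrite !E// !IH//.
Qed.

Lemma box_unique (y : I -> R) :
  P [set o | forall i, X i o <= y i] = P' [set o | forall i, X' i o <= y i].
Proof.
have E (d1 : measure_display) (T1 : measurableType d1) (Q : probability T1 R)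
  (Z : I -> T1 -> R) : (forall i, measurable_fun setT (Z i)) ->
  \int[Q]_o (box Z y (enum I) o * cos (phase Z (fun=> 0) 0 (enum I) o)) =
  fine (Q [set o | forall i, Z i o <= y i]).
  move=> mZ.
  have mB := measurable_box y mZ.
  rewrite -Rintegral_indic_prob//; apply: eq_Rintegral => o _.
  rewrite /phase big1 ?add0r ?cos0 ?mulr1 => [|i]; last by rewrite mul0r.
  rewrite /box indicE; have [oB|oB] := pselect (forall i, Z i o <= y i).
    by rewrite mem_set// big1_seq// => i _; rewrite oB.
  rewrite memNset//; move/existsNP : oB => [i /negP/negbTE Zi].
  by apply/eqP; rewrite prodf_seq_eq0; apply/hasP; exists i; rewrite ?mem_enum//= Zi.
(* With all coordinates moved, the cosine is cos 0 = 1 and only the box remains. *)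
have := box_phase y (fun=> 0) 0 (enum_uniq I).
rewrite !E// => H.
have mB := measurable_box y mX; have mB' := measurable_box y mX'.
by rewrite -[LHS]fineK ?fin_num_measure// -[RHS]fineK ?fin_num_measure// H.
Qed.

End box.
End cramer_wold.

Definition mfun_of {d d' : measure_display} {T : measurableType d}
    {U : measurableType d'} {X : T -> U} (mX : measurable_fun setT X) :
    {mfun T >-> U} :=
  HB.pack X (isMeasurableFun.Build _ _ _ _ X mX).

Section tuple_law.
Context {R : realType} {d d' : measure_display} {T : measurableType d}
  {T' : measurableType d'}.
Variables (P : probability T R) (P' : probability T' R) (n : nat).

(** Lower orthants: a family stable under intersection, whose probabilities are the values of the
    joint distribution function. *)
Let G : set (set (n.-tuple R)) :=
  [set A | exists y : 'I_n -> R, A = [set x | forall i, tnth x i <= y i]].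

Let G_sigma : @measurable _ (n.-tuple R) `<=` <<s G >>.
Proof.
pose GT := g_sigma_algebraType G.
have mt (i : 'I_n) : measurable_fun [set: GT] (fun x : GT => tnth (x : n.-tuple R) i).
  apply: (measurability (@RGenOInfty.G R)) => [|/= _ [_] [r] -> <-].
    exact: RGenOInfty.measurableE.
  rewrite setTI -[X in measurable X]setCK; apply: measurableC.
  (* A bound on the single coordinate i is recovered as the increasing union of the orthants whose
     other bounds are all k. *)
  rewrite (_ : ~` _ = \bigcup_k [set x : GT | forall j : 'I_n,
      tnth (x : n.-tuple R) j <= if j == i then r else k%:R]); last first.
    apply/seteqP; split => [x /=|x /= [k _ /(_ i)]]; last first.
      by rewrite eqxx => xr; rewrite in_itv/= andbT; apply/negP; rewrite -leNgt.
    rewrite in_itv/= andbT => /negP; rewrite -leNgt => xr.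
    have [k _ Hk] : \forall k \near \oo, (\sum_j `|tnth (x : n.-tuple R) j|) <= k%:R.
      exact: nbhs_infty_ger.
    exists k => // j; case: eqVneq => [->//|_].
    apply: le_trans (Hk k (leqnn k)); apply: le_trans (ler_norm _) _.
    by rewrite (bigD1 j)//= lerDl sumr_ge0.
  apply: bigcupT_measurable => k; apply: sub_sigma_algebra.
  by exists (fun j => if j == i then r else k%:R).
have mid : measurable_fun [set: GT] (id : GT -> n.-tuple R).
  by apply/measurable_fun_tnthP.
by move=> A mA; have := mid measurableT A mA; rewrite setTI.
Qed.

Lemma tuple_charfun_unique (X : T -> n.-tuple R) (X' : T' -> n.-tuple R) :
  measurable_fun setT X -> measurable_fun setT X' ->
  (forall (t : 'I_n -> R) th,
    \int[P]_o cos (\sum_i t i * tnth (X o) i + th) =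
    \int[P']_o cos (\sum_i t i * tnth (X' o) i + th)) ->
  same_law P P' X X'.
Proof.
move=> mX mX' cf A mA.
pose m1 := distribution P (mfun_of mX); pose m2 := distribution P' (mfun_of mX').
suff : m1 A = m2 A by [].
pose g (k : nat) := [set x : n.-tuple R | forall i, tnth x i <= k%:R].
have mG : G `<=` measurable.
  move=> B [y ->]; apply: measurable_box => i; exact: measurable_tnth.
apply: (@g_sigma_algebra_measure_unique _ R _ G mG g) => //.
- by move=> k; exists (fun=> k%:R).
- apply/seteqP; split => // x _.
  have [k _ Hk] : \forall k \near \oo, (\sum_j `|tnth x j|) <= k%:R.
    exact: nbhs_infty_ger.
  exists k => // j /=; apply: le_trans (Hk k (leqnn k)); apply: le_trans (ler_norm _) _.
  by rewrite (bigD1 j)//= lerDl sumr_ge0.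
- move=> _ _ [y ->] [z ->]; exists (fun i => Num.min (y i) (z i)).
  apply/seteqP; split => x /=.
    by move=> [h1 h2] i; rewrite le_min h1 h2.
  by move=> h; split => i; have := h i; rewrite le_min => /andP[].
- move=> _ [y ->]; apply: (@box_unique _ _ _ _ _ P P' _ (fun i o => tnth (X o) i)
    (fun i o => tnth (X' o) i)) => // i.
  + exact: ((measurable_fun_tnthP X).1 mX i).
  + exact: ((measurable_fun_tnthP X').1 mX' i).
- by move=> k; apply: le_lt_trans (ltry 1); apply: probability_le1; apply: mG; exists (fun=> k%:R).
- exact: G_sigma.
Qed.

End tuple_law.

Lemma same_law_comp {R : realType} {d d' d1 d2 : measure_display}
    {T : measurableType d} {T' : measurableType d'} {U : measurableType d1}
    {V : measurableType d2} (P : probability T R) (P' : probability T' R)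
    (X : T -> U) (Y : T' -> U) (h : U -> V) :
  measurable_fun setT h -> same_law P P' X Y ->
  same_law P P' (fun o => h (X o)) (fun o => h (Y o)).
Proof.
move=> mh XY A mA; have := mh measurableT A mA; rewrite setTI => mhA.
exact: (XY _ mhA).
Qed.

Lemma pair_charfun_unique {R : realType} {d d' : measure_display}
    {T : measurableType d} {T' : measurableType d'}
    (P : probability T R) (P' : probability T' R)
    (X Y : T -> R) (X' Y' : T' -> R) :
  measurable_fun setT X -> measurable_fun setT Y ->
  measurable_fun setT X' -> measurable_fun setT Y' ->
  (forall s t th, \int[P]_o cos (s * X o + t * Y o + th) =
                  \int[P']_o cos (s * X' o + t * Y' o + th)) ->
  same_law P P' (fun o => (X o, Y o)) (fun o => (X' o, Y' o)).
Proof.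
move=> mX mY mX' mY' cf.
pose h (x : 2.-tuple R) := (tnth x ord0, tnth x ord_max).
have mh : measurable_fun setT h.
  by apply/measurable_fun_pairP; split; exact: measurable_tnth.
pose Z o := [tuple X o; Y o]; pose Z' o := [tuple X' o; Y' o].
have mZ (d1 : measure_display) (T1 : measurableType d1) (A B : T1 -> R) :
    measurable_fun setT A -> measurable_fun setT B ->
    measurable_fun setT (fun o => [tuple A o; B o]).
  move=> mA mB; apply/measurable_fun_tnthP => i.
  have [->|->] : i = ord0 \/ i = ord_max by case: i => [[|[|]]]// ?; [left|right]; exact/val_inj.
  + exact: mA.
  + exact: mB.
apply: (@same_law_comp _ _ _ _ _ _ _ _ _ P P' Z Z' h mh).
apply: tuple_charfun_unique; [exact: mZ|exact: mZ|].
move=> t th; have := cf (t ord0) (t ord_max) th.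
have E (A B : R) : \sum_i t i * tnth [tuple A; B] i = t ord0 * A + t ord_max * B.
  by rewrite big_ord_recl big_ord1 (_ : lift ord0 ord0 = ord_max)//; exact/val_inj.
by under [in X in _ -> X]eq_Rintegral do rewrite E;
   under [in X in _ -> _ = X]eq_Rintegral do rewrite E.
Qed.

(** * Gaussian sequences *)

Section gaussian_sequence.
Context {R : realType} {d : measure_display} {T : measurableType d}.
Variables (P : probability T R) (G : nat -> {RV P >-> R}) (r : nat -> nat -> R).
Hypothesis hgauss : gaussian_sequence G.
Hypothesis hcent : centered_sequence G.
Hypothesis hcov : forall i j,
  ('E_P[fun w => (G i w * G j w)%R] = (r i j)%:E)%E.

Let mG i : measurable_fun setT (G i). Proof. exact: measurable_funP. Qed.

(** Square integrability is extracted from [hcov]: the expectation of the nonnegative function G_i^2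
    is a real number, hence finite. *)
Lemma gaussian_sequence_integrable2 i :
  P.-integrable setT (EFin \o (fun w => G i w ^+ 2)).
Proof.
have mG2 : measurable_fun setT (EFin \o (fun w => G i w ^+ 2)).
  by apply/measurable_EFinP; exact: measurable_funX.
apply/integrableP; split => //.
have := hcov i i; rewrite unlock => H.
rewrite (_ : (\int[P]_x _)%E = (r i i)%:E) ?ltry// -H.
by apply: eq_integral => x _; rewrite /= ger0_norm ?sqr_ge0// expr2.
Qed.

Lemma gaussian_sequence_integrable i : P.-integrable setT (EFin \o (G i)).
Proof.
have iS : P.-integrable setT (fun x => (1 + (G i x ^+ 2))%:E).
  have i1 := bmeas_integrable P (@bmeas_cst R _ T 1).
  by apply: eq_integrable (integrableD measurableT i1 (gaussian_sequence_integrable2 i)).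
apply: le_integrable iS => //; first exact/measurable_EFinP.
move=> x _ /=; rewrite lee_fin [leRHS]ger0_norm ?addr_ge0 ?sqr_ge0//.
rewrite -(real_normK (num_real (G i x))).
by have := sqr_ge0 (`|G i x| - 1); nra.
Qed.

Lemma gaussian_sequence_integrableM i j :
  P.-integrable setT (EFin \o (fun w => G i w * G j w)).
Proof.
have iS : P.-integrable setT (fun x => (G i x ^+ 2 + G j x ^+ 2)%:E).
  by apply: eq_integrable (integrableD measurableT
    (gaussian_sequence_integrable2 i) (gaussian_sequence_integrable2 j)).
apply: le_integrable iS => //.
  by apply/measurable_EFinP; exact: measurable_funM.
move=> x _ /=; rewrite lee_fin [leRHS]ger0_norm ?addr_ge0 ?sqr_ge0//.
rewrite normrM -(real_normK (num_real (G i x))) -(real_normK (num_real (G j x))).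
by have := sqr_ge0 (`|G i x| - `|G j x|); have := normr_ge0 (G i x);
  have := normr_ge0 (G j x); nra.
Qed.

Lemma gaussian_sequence_mean i : \int[P]_w G i w = 0.
Proof. by have := hcent i; rewrite unlock /Rintegral => ->. Qed.

Lemma gaussian_sequence_cov i j : \int[P]_w (G i w * G j w) = r i j.
Proof. by have := hcov i j; rewrite unlock /Rintegral => ->. Qed.

Section linear_combination.
Variables (n : nat) (t : 'I_n -> R).
Let L w := \sum_(i < n) t i * G i w.

Lemma lin_sqr w : L w ^+ 2 = \sum_(i < n) \sum_(j < n) t i * t j * (G i w * G j w).
Proof.
rewrite expr2 mulr_suml; apply: eq_bigr => i _; rewrite mulr_sumr.
by apply: eq_bigr => j _; rewrite mulrACA.
Qed.

Let mL : measurable_fun setT L.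
Proof. by apply: measurable_sum => i; exact: measurable_funM. Qed.

Let itG (c : R) (f : T -> R) : P.-integrable setT (EFin \o f) ->
  P.-integrable setT (EFin \o (fun w => c * f w)).
Proof. by move=> /(integrableZl measurableT c); apply: eq_integrable. Qed.

Let itS (I : Type) (s : seq I) (f : I -> T -> R) :
  (forall i, P.-integrable setT (EFin \o f i)) ->
  P.-integrable setT (EFin \o (fun w => \sum_(i <- s) f i w)).
Proof.
move=> fi; have H := @integrable_sum _ T R P setT measurableT I s xpredT
  (fun i => EFin \o f i) (fun i _ => fi i).
by apply: eq_integrable H => // x _; rewrite /= sumEFin.
Qed.

Lemma lin_integrable : P.-integrable setT (EFin \o L).
Proof. by apply: itS => i; apply: itG; exact: gaussian_sequence_integrable. Qed.

Lemma lin_integrable2 : P.-integrable setT (EFin \o (fun w => L w ^+ 2)).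
Proof.
under eq_fun do rewrite lin_sqr.
by apply: itS => i; apply: itS => j; apply: itG; exact: gaussian_sequence_integrableM.
Qed.

Lemma lin_mean : \int[P]_w L w = 0.
Proof.
rewrite Rintegral_prob_sum => [|i]; last first.
  by apply: itG; exact: gaussian_sequence_integrable.
rewrite big1// => i _; rewrite RintegralZl//; last exact: gaussian_sequence_integrable.
by rewrite gaussian_sequence_mean mulr0.
Qed.

Lemma lin_variance : \int[P]_w L w ^+ 2 = \sum_(i < n) \sum_(j < n) t i * t j * r i j.
Proof.
under eq_Rintegral do rewrite lin_sqr.
rewrite Rintegral_prob_sum => [|i]; last first.
  by apply: itS => j; apply: itG; exact: gaussian_sequence_integrableM.
apply: eq_bigr => i _; rewrite Rintegral_prob_sum => [|j]; last first.
  by apply: itG; exact: gaussian_sequence_integrableM.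
apply: eq_bigr => j _; rewrite RintegralZl//; last exact: gaussian_sequence_integrableM.
by rewrite gaussian_sequence_cov.
Qed.

Lemma lin_cf th : \int[P]_w cos (L w + th) =
  cos th * expR (- ((\sum_(i < n) \sum_(j < n) t i * t j * r i j) / 2)).
Proof.
have := gaussian_rv_cf mL (hgauss t) lin_integrable lin_integrable2 lin_mean
  lin_variance 1 th.
by under eq_Rintegral do rewrite mul1r; rewrite expr1n mulr1.
Qed.

End linear_combination.

Lemma gaussian_sequence_pair_cf i k s t th :
  \int[P]_w cos (s * G i w + t * G k w + th) =
  cos th * expR (- ((s ^+ 2 * r i i + s * t * (r i k + r k i) + t ^+ 2 * r k k) / 2)).
Proof.
pose n := (maxn i k).+1.
have li : (i < n)%N by rewrite ltnS leq_maxl.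
have lk : (k < n)%N by rewrite ltnS leq_maxr.
pose I := Ordinal li; pose K := Ordinal lk.
(* For i = k the two weights add up on one index, so the diagonal needs no separate case. *)
pose u (j : 'I_n) := s * (j == I)%:R + t * (j == K)%:R.
have sumu (f : 'I_n -> R) : \sum_j u j * f j = s * f I + t * f K.
  rewrite /u; under eq_bigr do rewrite mulrDl -!mulrA.
  rewrite big_split/= -!mulr_sumr (bigD1 I)//= eqxx mul1r big1 ?addr0; last first.
    by move=> j /negbTE ->; rewrite mul0r.
  rewrite (bigD1 K)//= eqxx mul1r big1 ?addr0// => j /negbTE ->.
  by rewrite mul0r.
have := lin_cf u th; under eq_Rintegral do rewrite sumu.
move=> ->; congr (_ * expR (- (_ / 2))).
under eq_bigr do (under eq_bigr do rewrite -mulrA; rewrite -mulr_sumr).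
by rewrite sumu !sumu/=; ring.
Qed.

Lemma gaussian_sequence_law0 : 0 < r 0%N 0%N ->
  forall A : set R, measurable A ->
  P (G 0%N @^-1` A) = normal_prob 0 (Num.sqrt (r 0%N 0%N)) A.
Proof.
have := @lin_mean 1 (fun=> 1).
have := @lin_variance 1 (fun=> 1); have := hgauss (fun _ : 'I_1 => 1).
have E : (fun w => \sum_(i < 1) 1 * G i w) = G 0%N.
  by apply/funext => w; rewrite big_ord1 mul1r.
rewrite E; have Ew w : \sum_(i < 1) 1 * G i w = G 0%N w by rewrite -E.
under [in X in _ -> X -> _]eq_Rintegral do rewrite Ew.
rewrite !big_ord1 !mul1r => g v m r0 A mA.
exact: (gaussian_rv_law (mG 0%N) g (gaussian_sequence_integrable 0%N)
  (gaussian_sequence_integrable2 0%N) m v).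
Qed.

End gaussian_sequence.

Lemma sqr_sqrt_half (R : realType) : Num.sqrt (2^-1 : R) ^+ 2 = 2^-1.
Proof. by rewrite sqr_sqrtr// invr_ge0. Qed.

Lemma sqrt_half_neq0 (R : realType) : Num.sqrt (2^-1 : R) != 0.
Proof. by rewrite sqrtr_eq0 -ltNge invr_gt0. Qed.

Section pair_representation.
Context {R : realType} {d : measure_display} {T : measurableType d}.
Variables (P : probability T R) (G : nat -> {RV P >-> R}) (r : nat -> nat -> R).
Hypothesis hgauss : gaussian_sequence G.
Hypothesis hcent : centered_sequence G.
Hypothesis hcov : forall i j,
  ('E_P[fun w => (G i w * G j w)%R] = (r i j)%:E)%E.
Hypotheses (r_diag : forall i, r i i = 2^-1) (r_sym : forall i j, r i j = r j i).
Notation ga := (normal_prob 0 (Num.sqrt (2^-1 : R))).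

(** Read off the characteristic function: the integral of a cosine is at most 1, so the quadratic
    form in the exponent is nonnegative. The vectors (1, 1) and (1, -1) give the two bounds. *)
Lemma corr_le1 i k : `|2 * r i k| <= 1.
Proof.
have key t : 0 <= 2^-1 + t * (2 * r i k) + t ^+ 2 / 2.
  have H := gaussian_sequence_pair_cf hgauss hcent hcov i k 1 t 0.
  have mc : measurable_fun setT (fun w => 1 * G i w + t * G k w + 0).
    by apply: measurable_funD => //; apply: measurable_funD; apply: measurable_funM.
  have := bRintegral_bound P (bmeas_cos mc) (fun x => cos_max _).
  rewrite H cos0 mul1r ger0_norm ?expR_ge0// -[leRHS]expR0 ler_expR oppr_le0.
  rewrite pmulr_lge0 ?invr_gt0// !r_diag (r_sym k i).
  by move=> h; apply: le_trans h _; rewrite le_eqVlt; apply/orP; left; apply/eqP; field.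
by rewrite ler_norml; have := key 1; have := key (-1); rewrite expr1n sqrrN expr1n => *; lra.
Qed.

(** Both variances are 1/2, so 2 r is the correlation. Integrating the cosine over z.2 and then over
    z.1 reproduces the characteristic function of the pair. The diagonal i = k is included, with rho
    = 1. *)
Lemma pair_representation i k (rho := 2 * r i k) :
  same_law P (ga \x ga)%E (fun w => (G i w, G k w))
    (fun z => (z.1, rho * z.1 + Num.sqrt (1 - rho ^+ 2) * z.2)).
Proof.
have s0 := sqrt_half_neq0 R; have s2 := sqr_sqrt_half R.
have rho2 : Num.sqrt (1 - rho ^+ 2) ^+ 2 = 1 - rho ^+ 2.
  rewrite sqr_sqrtr// subr_ge0 -(real_normK (num_real rho)) expr_le1//.
  exact: corr_le1.
set c := Num.sqrt _ in rho2 *.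
have m1 : measurable_fun setT (fun z : R * R => z.1) by exact: measurable_fst.
have m2 : measurable_fun setT (fun z : R * R => rho * z.1 + c * z.2).
  by apply: measurable_funD; apply: measurable_funM.
apply: (@pair_charfun_unique _ _ _ _ _ P (ga \x ga)%E) => // s t th.
rewrite (gaussian_sequence_pair_cf hgauss hcent hcov) !r_diag (r_sym k i).
rewrite bfubini1; last first.
  apply: bmeas_cos; apply: measurable_funD => //.
  by apply: measurable_funD; apply: measurable_funM.
transitivity (\int[ga]_u (expR (- ((Num.sqrt 2^-1 * (t * c)) ^+ 2 / 2)) *
    cos ((s + t * rho) * u + th))).
  rewrite RintegralM_cst; last first.
    apply: bmeas_cos; apply: measurable_funD => //; exact: measurable_funM.
  rewrite Rintegral_cos_normal_prob// mulrCA -expRD; congr (_ * expR _).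
  by rewrite !exprMn s2 rho2 /rho; field.
apply: eq_Rintegral => u _ /=.
rewrite mulrC -Rintegral_cos_normal_prob//; apply: eq_Rintegral => v _.
congr cos; ring.
Qed.

End pair_representation.

(** * Resampling a Gaussian vector along a linear functional *)

Section decomposition.
Context {R : realType} {n : nat}.
Variables (mu : probability (n.-tuple R) R) (K : 'I_n -> 'I_n -> R).
Hypothesis K_sym : forall i j, K i j = K j i.
Hypothesis cf_mu : forall (t : 'I_n -> R) th,
  \int[mu]_x cos (\sum_i t i * tnth x i + th) =
  cos th * expR (- ((\sum_i \sum_j t i * t j * K i j) / 2)).
Variables (a m : 'I_n -> R).
Hypothesis m_def : forall i, \sum_j K i j * a j = m i.
Hypothesis am : \sum_i a i * m i = 1.

(* The component along the functional [a] is replaced by a fresh normal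
   variable; the residual is uncorrelated with it, hence independent of it. *)
Definition resample (z : n.-tuple R * R) : n.-tuple R :=
  [tuple tnth z.1 i + m i * (z.2 - \sum_j a j * tnth z.1 j) | i < n].

Lemma measurable_resample : measurable_fun setT resample.
Proof.
apply/measurable_fun_tnthP => i.
rewrite (_ : _ \o _ = fun z => tnth z.1 i + m i * (z.2 - \sum_j a j * tnth z.1 j)); last first.
  by apply/funext => z; rewrite /= tnth_mktuple.
have mt j : measurable_fun setT (fun z : n.-tuple R * R => tnth z.1 j).
  exact: (measurableT_comp (measurable_tnth j) measurable_fst).
apply: measurable_funD => //; apply: measurable_funM => //; apply: measurable_funB => //.
by apply: measurable_sum => j; exact: measurable_funM.
Qed.

(** Integrating over the fresh variable gives exp(-tm^2 / 2). The residual combination t - tm a has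
    variance Q(t) - tm^2, with Q the quadratic form of [K], because m = K a and the product of a and
    m is 1. The two exponents add up to -Q(t) / 2. *)
Lemma resample_law : same_law mu (mu \x normal_prob 0 1)%E id resample.
Proof.
apply: tuple_charfun_unique => //; first exact: measurable_resample.
move=> t th; pose tm := \sum_i t i * m i; pose t' i := t i - tm * a i.
have E z : \sum_i t i * tnth (resample z) i + th =
    tm * z.2 + (\sum_i t' i * tnth z.1 i + th).
  rewrite addrA; congr (_ + th).
  under eq_bigr do rewrite tnth_mktuple mulrDr mulrA.
  rewrite big_split/= -mulr_suml -/tm.
  rewrite (_ : \sum_i t' i * tnth z.1 i =
    \sum_i t i * tnth z.1 i - tm * \sum_j a j * tnth z.1 j); first ring.
  by rewrite mulr_sumr -sumrB; apply: eq_bigr => i _; rewrite /t'; ring.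
under [in RHS]eq_Rintegral do rewrite E.
have mt j : measurable_fun setT (fun z : n.-tuple R * R => tnth z.1 j).
  exact: (measurableT_comp (measurable_tnth j) measurable_fst).
have mS : measurable_fun setT (fun x : n.-tuple R => \sum_i t' i * tnth x i + th).
  apply: measurable_funD => //; apply: measurable_sum => i; apply: measurable_funM => //.
  exact: measurable_tnth.
rewrite bfubini1/=; last first.
  apply: bmeas_cos; apply: measurable_funD; first exact: measurable_funM.
  exact: (measurableT_comp mS measurable_fst).
under [in RHS]eq_Rintegral do rewrite Rintegral_cos_normal_prob ?oner_neq0// mul1r mulrC.
rewrite RintegralM_cst; last exact: bmeas_cos.
rewrite !cf_mu mulrCA -expRD; congr (_ * expR _).
have q (u v : 'I_n -> R) : \sum_i \sum_j u i * v j * K i j = \sum_i u i * \sum_j K i j * v j.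
  apply: eq_bigr => i _; rewrite mulr_sumr; apply: eq_bigr => j _; ring.
have Ea (v : 'I_n -> R) : \sum_i a i * \sum_j K i j * v j = \sum_j v j * m j.
  rewrite -q exchange_big/=; apply: eq_bigr => j _; rewrite -m_def mulr_sumr.
  by apply: eq_bigr => i _; rewrite (K_sym j i); ring.
rewrite !q.
have Et' i : \sum_j K i j * t' j = \sum_j K i j * t j - tm * m i.
  rewrite -m_def mulr_sumr -sumrB; apply: eq_bigr => j _; rewrite /t'; ring.
under [in RHS]eq_bigr do rewrite Et' /t' mulrBl mulrBr [X in _ - X]mulrBr.
rewrite !sumrB.
rewrite (_ : \sum_i t i * (tm * m i) = tm ^+ 2); last first.
  rewrite (_ : tm ^+ 2 = tm * \sum_i t i * m i) ?expr2//.
  by rewrite mulr_sumr; apply: eq_bigr => i _; ring.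
rewrite (_ : \sum_i tm * a i * (tm * m i) = tm ^+ 2); last first.
  rewrite -[RHS]mulr1 -am mulr_sumr; apply: eq_bigr => i _; ring.
rewrite (_ : \sum_i tm * a i * (\sum_j K i j * t j) = tm ^+ 2); last first.
  rewrite (_ : tm ^+ 2 = tm * \sum_i t i * m i) ?expr2// -Ea mulr_sumr.
  by apply: eq_bigr => i _; ring.
by field.
Qed.

End decomposition.

(** * The dice kernel *)

Section normal_square.
Context {R : realType}.
Notation mu := (@lebesgue_measure R).

(** For nonnegative functions the change of variables presupposes no integrability, which is what
    [normal_prob_sqr] has to establish. *)
Lemma ge0_integral_normal_prob (m s : R) (f : R -> \bar R) :
  (forall x, 0 <= f x)%E -> measurable_fun setT f ->
  (\int[normal_prob m s]_x f x = \int[mu]_x (f x * (normal_pdf m s x)%:E))%E.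
Proof.
move=> f0 mf; have dom := normal_prob_dominates m s.
rewrite -(Radon_Nikodym_SigmaFinite.change_of_variables dom)//.
have iRN := Radon_Nikodym_SigmaFinite.f_integrable dom.
have mpdf : measurable_fun setT (EFin \o normal_pdf m s).
  by apply/measurable_EFinP; exact: measurable_normal_pdf.
apply: ae_eq_integral => //.
- by apply: emeasurable_funM => //; exact: (measurable_int mu iRN).
- exact: emeasurable_funM.
apply: ae_eqe_mul2l; apply: integral_ae_eq => // E _ mE.
by rewrite -Radon_Nikodym_SigmaFinite.f_integral.
Qed.

Lemma normal_prob_sqr (s : R) : s != 0 ->
  (normal_prob 0 s).-integrable setT (EFin \o (fun x : R => x ^+ 2)) /\
  \int[normal_prob 0 s]_x (x ^+ 2) = s ^+ 2.
Proof.
move=> s0; have m2 : measurable_fun setT (EFin \o (fun x : R => x ^+ 2)).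
  by apply/measurable_EFinP; exact: measurable_funX.
have b1 := @bmeas_cst R _ (measurableTypeR R) 1.
have i2 : mu.-integrable setT (EFin \o (fun x => x ^+ 2 * normal_pdf 0 s x)).
  apply: eq_integrable (integrable_normal_bounded 0 s0 (leqnn 2) b1) => // x _ /=.
  by rewrite mul1r subr0.
have E : (\int[normal_prob 0 s]_x (x ^+ 2)%:E = (s ^+ 2)%:E)%E.
  rewrite ge0_integral_normal_prob//; last by move=> x; rewrite lee_fin sqr_ge0.
  rewrite -(normal_variance 0 s0) /Rintegral.
  under [in RHS]eq_integral do rewrite subr0.
  rewrite fineK; last exact: integrable_fin_num.
  by apply: eq_integral => x _; rewrite -EFinM.
split; last by rewrite /Rintegral E.
apply/integrableP; split => //.
under eq_integral do rewrite /= ger0_norm ?sqr_ge0//.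
by rewrite E ltry.
Qed.

Lemma normal_prob_set1 (m s x : R) : normal_prob m s [set x] = 0%E.
Proof.
have /null_content_dominatesP := normal_prob_dominates m s.
by apply; [exact: measurable_set1|exact: lebesgue_measure_set1].
Qed.

Lemma normal_prob_lt (m s y : R) :
  fine (normal_prob m s [set x | x < y]) = fine (normal_prob m s [set x | x <= y]).
Proof.
have -> : [set x : R | x <= y] = [set x | x < y] `|` [set y].
  apply/seteqP; split => x /=; first by rewrite le_eqVlt => /predU1P[->|]; [right|left].
  by move=> [/ltW//|/= ->].
rewrite measureU//=; [|by rewrite -set_itvNyo; exact: measurable_itv|].
  by rewrite [X in (_ + X)%E](_ : _ = 0%E) ?adde0//; exact: normal_prob_set1.
by rewrite -subset0 => x /= [xy yx]; move: xy; rewrite yx ltxx.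
Qed.

End normal_square.

Section cdf_F.
Context {R : realType}.
Notation mu := (@lebesgue_measure R).
Notation sg := (Num.sqrt (2^-1 : R)).
Notation ga := (normal_prob 0 sg).

(** The scaling of N(0, 1/2) by sqrt 2 into the standard normal law is read off characteristic
    functions, with the constant weight 1. *)
Lemma F_normal (x : R) : F x = fine (ga [set u | u <= x]).
Proof.
have sg0 := sqrt_half_neq0 R.
have m1 : measurable_fun setT (fun u : R => Num.sqrt 2 * u) by exact: measurable_funM.
have b1 : bmeas (fun _ : R => 1 : R) by exact: bmeas_cst.
have cf t th : \int[ga]_u (1 * cos (t * (Num.sqrt 2 * u) + th)) =
    \int[normal_prob 0 1]_u (1 * cos (t * u + th)).
  under eq_Rintegral do rewrite mul1r mulrA.
  under [in RHS]eq_Rintegral do rewrite mul1r.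
  rewrite !Rintegral_cos_normal_prob ?oner_neq0//.
  by rewrite mulrCA -sqrtrM ?invr_ge0// mulVf// sqrtr1 mulr1 mul1r.
have := @weighted_charfun_unique R _ _ _ _ ga (normal_prob 0 1) (fun=> 1)
  (fun u => Num.sqrt 2 * u) (fun=> 1) id b1 b1 m1 (@measurable_id _ R setT) cf
  (Num.sqrt 2 * x).
under eq_Rintegral do rewrite mul1r.
under [X in _ = X -> _]eq_Rintegral do rewrite mul1r.
rewrite !Rintegral_bool; last 2 first.
  exact: measurable_fun_ler.
  exact: measurable_fun_ler.
have -> : [set u | Num.sqrt 2 * u <= Num.sqrt 2 * x] = [set u | u <= x].
  by apply/funext => u /=; rewrite ler_pM2l// sqrtr_gt0.
by move=> ->; rewrite /F /Phi set_itvNyc.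
Qed.

Lemma F_ge0 (x : R) : 0 <= F x.
Proof. by rewrite F_normal fine_ge0. Qed.

Lemma F_le1 (x : R) : F x <= 1.
Proof.
have mx : measurable [set u : R | u <= x] by rewrite -set_itvNyc; exact: measurable_itv.
by rewrite F_normal -lee_fin fineK ?fin_num_measure// probability_le1.
Qed.

Lemma is_derive_F (x : R) : is_derive x 1 F (normal_pdf 0 sg x).
Proof.
have FE : F = fun x => \int[mu]_(t in [set` `]-oo, x]]) normal_pdf 0 sg t.
  by apply/funext => y; rewrite F_normal /Rintegral set_itvNyc.
have xx1 : x < x + 1 by rewrite ltrDl.
have ip : mu.-integrable [set` `]-oo, x + 1]] (EFin \o normal_pdf 0 sg).
  apply: (integrableS measurableT) => //; exact: integrable_normal_pdf.
have cp : {for x, continuous (normal_pdf 0 sg)}.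
  exact: (continuous_normal_pdf (sqrt_half_neq0 R)).
have [dF eF] := continuous_FTC1 xx1 ip (ltNyr _) cp.
by rewrite FE -eF derive1E; apply: DeriveDef.
Qed.

Lemma normal_pdf_half (x : R) : normal_pdf 0 sg x = (Num.sqrt pi)^-1 * expR (- x ^+ 2).
Proof.
rewrite normal_pdf_expR ?sqrt_half_neq0// sqr_sqrt_half subr0 mulfV// invr1 mul1r.
congr (_^-1 * _); rewrite /normal_peak sqr_sqrt_half.
by congr (Num.sqrt _); rewrite -mulr_natr; field.
Qed.

Lemma normal_pdf_half_le1 (x : R) : normal_pdf 0 sg x <= 1.
Proof.
rewrite normal_pdf_half mulr_ile1 ?expR_ge0 ?invr_ge0 ?sqrtr_ge0//; last first.
  by rewrite -[leRHS]expR0 ler_expR oppr_le0 sqr_ge0.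
have p2 := pi_ge2 R.
rewrite invf_le1 ?sqrtr_gt0 ?pi_gt0// -[leLHS]sqrtr1 ler_sqrt ?pi_gt0//; lra.
Qed.

Lemma F_continuous : continuous (F : R -> R).
Proof.
move=> x; apply: differentiable_continuous; apply/derivable1_diffP.
by have := is_derive_F x => H; exact: ex_derive.
Qed.

Lemma F_lipschitz (x y : R) : `|F x - F y| <= `|x - y|.
Proof.
wlog xy : x y / x <= y => [W|].
  by have [/W//|/ltW/W] := leP x y; rewrite distrC (distrC x).
have [|c _ H] := @MVT_segment R F (normal_pdf 0 sg) x y xy (fun z _ => is_derive_F z).
  by apply: continuous_subspaceT; exact: F_continuous.
rewrite distrC H (distrC x) normrM ler_piMl//.
by rewrite ger0_norm ?normal_pdf_ge0// normal_pdf_half_le1.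
Qed.

Lemma measurable_F : measurable_fun setT (F : R -> R).
Proof. exact: continuous_measurable_fun F_continuous. Qed.

Lemma bmeas_F : bmeas (F : R -> R).
Proof.
split; first exact: measurable_F.
by exists 1 => x; rewrite ger0_norm ?F_ge0// F_le1.
Qed.

Let mlt (y : R) : measurable_fun setT (fun u : R => u < y).
Proof. exact: measurable_fun_ltr. Qed.
Let mgt (y : R) : measurable_fun setT (fun u : R => y < u).
Proof. exact: measurable_fun_ltr. Qed.
Let mle (y : R) : measurable_fun setT (fun u : R => u <= y).
Proof. exact: measurable_fun_ler. Qed.

Lemma Rintegral_lt_F (y : R) : \int[ga]_u (u < y)%R%:R = F y.
Proof.
transitivity (fine (ga [set u | u < y])); first exact: (Rintegral_bool ga (mlt y)).
by rewrite F_normal; exact: normal_prob_lt.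
Qed.

Lemma Rintegral_gt_F (y : R) : \int[ga]_u (y < u)%R%:R = 1 - F y.
Proof.
have -> : F y = \int[ga]_u (u <= y)%R%:R.
  by rewrite F_normal; exact/esym/(Rintegral_bool ga (mle y)).
rewrite -[X in _ = X - _](Rintegral_prob_cst ga).
rewrite -bRintegralB; [|exact: bmeas_cst|exact: (bmeas_bool (mle y))].
by apply: eq_Rintegral => u _; case: leP => _ /=; rewrite ?subrr ?subr0.
Qed.

(** The probability that one of two independent copies lies below the other, computed in both orders
    of integration, gives I = 1 - I. The absence of atoms enters through [Rintegral_lt_F]. *)
Lemma Rintegral_F : \int[ga]_v F v = 2^-1.
Proof.
have bl : bmeas (fun z : R * R => (z.1 < z.2)%R%:R : R).
  by apply: bmeas_bool; exact: measurable_fun_ltr.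
have := bfubini1 ga ga bl; rewrite bfubini2//=.
under eq_Rintegral do rewrite Rintegral_lt_F.
under [X in _ = X -> _]eq_Rintegral do rewrite Rintegral_gt_F.
rewrite bRintegralB; [|exact: bmeas_cst|exact: bmeas_F].
rewrite Rintegral_prob_cst; clear bl; move: (\int[ga]_v F v) => x H; lra.
Qed.

End cdf_F.

(** The sign kernel averages to 2 F(x) - 1 over y and to 1 - 2 F(y) over x; removing both leaves the
    degenerate part of its Hoeffding decomposition. *)
Definition dice_kernel {R : realType} (x y : R) : R :=
  (y < x)%R%:R - (x < y)%R%:R - 2 * F x + 2 * F y.

Section dice_kernel.
Context {R : realType}.
Notation sg := (Num.sqrt (2^-1 : R)).
Notation ga := (normal_prob 0 sg).

Lemma dice_kernelC (x y : R) : dice_kernel x y = - dice_kernel y x.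
Proof. by rewrite /dice_kernel; ring. Qed.

Lemma dice_kernel_bound (x y : R) : `|dice_kernel x y| <= 3.
Proof.
rewrite /dice_kernel; have := F_ge0 x; have := F_le1 x; have := F_ge0 y.
have := F_le1 y => *; rewrite ler_norml.
by case: (ltgtP x y) => _ /=; apply/andP; split; lra.
Qed.

Lemma bmeas_dice_kernel (d : measure_display) (T : measurableType d) (f h : T -> R) :
  measurable_fun setT f -> measurable_fun setT h ->
  bmeas (fun z => dice_kernel (f z) (h z)).
Proof.
move=> mf mh; have c2 := @bmeas_cst R _ T 2.
apply: bmeasD; [apply: bmeasB; [apply: bmeasB|]|].
- by apply: bmeas_bool; exact: measurable_fun_ltr.
- by apply: bmeas_bool; exact: measurable_fun_ltr.
- by apply: bmeasM => //; apply: (bmeas_comp mf); exact: bmeas_F.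
- by apply: bmeasM => //; apply: (bmeas_comp mh); exact: bmeas_F.
Qed.

(** The conditional expectation of g(Y, p) given X = u, for jointly normal X and Y of variance 1/2
    and correlation [rho]. *)
Definition smoothed_kernel (rho u p : R) : R :=
  \int[ga]_v dice_kernel (rho * u + Num.sqrt (1 - rho ^+ 2) * v) p.

Lemma bmeas_smoothed_kernel (rho : R) :
  bmeas (fun z : R * R => smoothed_kernel rho z.1 z.2).
Proof.
have := @bmeas_fubini1 R _ _ _ _ (ga \x ga)%E ga (fun w : (R * R) * R =>
  dice_kernel (rho * w.1.1 + Num.sqrt (1 - rho ^+ 2) * w.2) w.1.2).
apply; apply: bmeas_dice_kernel; last exact: (measurableT_comp measurable_snd).
apply: measurable_funD; apply: measurable_funM => //.
exact: (measurableT_comp measurable_fst).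
Qed.

Lemma normal_abs_le1 : ga.-integrable setT (EFin \o (fun v : R => `|v|)) /\
  \int[ga]_v `|v| <= 1.
Proof.
have [i2 e2] := normal_prob_sqr (sqrt_half_neq0 R).
have i1 := bmeas_integrable ga (@bmeas_cst R _ R 1).
have iS : ga.-integrable setT (EFin \o (fun v : R => 1 + v ^+ 2)).
  by apply: eq_integrable (integrableD measurableT i1 i2).
have le (v : R) : `|v| <= 2^-1 * (1 + v ^+ 2).
  by rewrite -(real_normK (num_real v)); have := sqr_ge0 (`|v| - 1); nra.
have iS2 : ga.-integrable setT (EFin \o (fun v : R => 2^-1 * (1 + v ^+ 2))).
  by apply: eq_integrable (integrableZl measurableT 2^-1 iS).
have ia : ga.-integrable setT (EFin \o (fun v : R => `|v|)).
  apply: le_integrable iS2 => //.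
    by apply/measurable_EFinP; exact: measurableT_comp.
  move=> v _ /=; rewrite lee_fin normr_id; apply: le_trans (le v) _.
  exact: ler_norm.
split => //; apply: le_trans (le_Rintegral measurableT ia iS2 (fun v _ => le v)) _.
rewrite RintegralZl// RintegralD//= Rintegral_prob_cst e2 sqr_sqrt_half.
lra.
Qed.

(* The kernel averages to zero over either argument, so that the bound vanishes
   with the correlation; for a large correlation it is trivial. *)
Lemma smoothed_kernel_bound (rho u p : R) : `|rho| <= 1 ->
  `|smoothed_kernel rho u p| <= 6 * `|rho| * (1 + `|u| + `|p|).
Proof.
move=> rho1; rewrite /smoothed_kernel; set c := Num.sqrt (1 - rho ^+ 2).
have mx : measurable_fun setT (fun v : R => rho * u + c * v).
  by apply: measurable_funD => //; exact: measurable_funM.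
have bk := bmeas_dice_kernel mx (@measurable_cst _ _ _ _ setT p).
have u0 := normr_ge0 u; have p0 := normr_ge0 p.
have [rb|rs] := leP 2^-1 `|rho|.
  apply: (@le_trans _ _ 3); first by apply: bRintegral_bound => // v; exact: dice_kernel_bound.
  by clear bk mx; nra.
have r2 : rho ^+ 2 <= 4^-1.
  by rewrite -(real_normK (num_real rho)); have := normr_ge0 rho; nra.
have c2 : c ^+ 2 = 1 - rho ^+ 2 by rewrite sqr_sqrtr//; lra.
have c0 : 0 <= c by exact: sqrtr_ge0.
have c1 : c <= 1 by have := sqr_ge0 rho; nra.
have chalf : 2^-1 <= c by nra.
have cpos : 0 < c by lra.
have c21 : 0 <= 2 * c - 1 by lra.
have rr : rho ^+ 2 <= `|rho|.
  by rewrite -(real_normK (num_real rho)); have := normr_ge0 rho; nra.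
(* Since 0 <= c <= 1, 1 - c <= 1 - c^2 = rho^2 <= |rho|. *)
have c1r : 1 - c <= `|rho| by nra.
(* The argument rho u + c v passes [p] exactly when v passes [q]. *)
set q := (p - rho * u) / c.
have bF := bmeas_F (R := R).
have bF' : bmeas (fun v => F (rho * u + c * v)) by exact: bmeas_comp bF.
have i1 : \int[ga]_v (p < rho * u + c * v)%R%:R = 1 - F q.
  rewrite -Rintegral_gt_F; apply: eq_Rintegral => v _; congr (nat_of_bool _)%:R.
  by rewrite /q ltr_pdivrMr// ltrBlDl (mulrC v).
have i2 : \int[ga]_v (rho * u + c * v < p)%R%:R = F q.
  rewrite -Rintegral_lt_F; apply: eq_Rintegral => v _; congr (nat_of_bool _)%:R.
  by rewrite /q ltr_pdivlMr// ltrBrDl (mulrC v).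
have bb1 : bmeas (fun v => (p < rho * u + c * v)%R%:R : R).
  by apply: bmeas_bool; exact: measurable_fun_ltr.
have bb2 : bmeas (fun v => (rho * u + c * v < p)%R%:R : R).
  by apply: bmeas_bool; exact: measurable_fun_ltr.
have cst2 := @bmeas_cst R _ R 2; have cstp := @bmeas_cst R _ R (2 * F p).
(* The mean 1/2 of [F] lets the constants be regrouped into two differences of values of [F], each
   of order |rho| by the Lipschitz bound. *)
have -> : \int[ga]_v dice_kernel (rho * u + c * v) p =
    2 * (F p - F q) + 2 * \int[ga]_v (F v - F (rho * u + c * v)).
  rewrite /dice_kernel.
  rewrite bRintegralD//; last first.
    by apply: bmeasB; [exact: bmeasB|exact: bmeasM].
  rewrite bRintegralB//; [|exact: bmeasB|exact: bmeasM].
  rewrite bRintegralB// i1 i2 RintegralM_cst// Rintegral_prob_cst.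
  rewrite bRintegralB// Rintegral_F.
  by clear; move: (\int[ga]_v F _) => I; field.
have [ia a1] := normal_abs_le1.
have h1 : `|F p - F q| <= 2 * `|rho| * (`|p| + `|u|).
  apply: le_trans (F_lipschitz _ _) _.
  have -> : p - q = (rho * u - (1 - c) * p) / c by rewrite /q; field; rewrite gt_eqF.
  rewrite normrM [`|c^-1|]gtr0_norm ?invr_gt0// ler_pdivrMr//.
  apply: le_trans (ler_normB _ _) _; rewrite !normrM [`|1 - c|]ger0_norm ?subr_ge0//.
  have r0 := normr_ge0 rho.
  have t1 : (1 - c) * `|p| <= `|rho| * `|p| by rewrite ler_wpM2r.
  have t2 : 0 <= `|rho| * (`|p| + `|u|) * (2 * c - 1).
    apply: mulr_ge0 => //; apply: mulr_ge0 => //; exact: addr_ge0.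
  clear bb1 bb2 i1 i2 bF bF' ia a1 bk mx.
  lra.
have h2 : `|\int[ga]_v (F v - F (rho * u + c * v))| <= `|rho| * (`|u| + 1).
  apply: le_trans (le_normr_Rintegral _ _) _ => //.
    by apply: bmeas_integrable; exact: bmeasB.
  have iU : ga.-integrable setT (EFin \o (fun v : R => `|u| + `|v|)).
    have iu := bmeas_integrable ga (@bmeas_cst R _ R `|u|).
    by apply: eq_integrable (integrableD measurableT iu ia).
  have iU2 : ga.-integrable setT (EFin \o (fun v : R => `|rho| * (`|u| + `|v|))).
    by apply: eq_integrable (integrableZl measurableT `|rho| iU).
  apply: (@le_trans _ _ (\int[ga]_v (`|rho| * (`|u| + `|v|)))).
    apply: le_Rintegral => //.
      by apply: bmeas_integrable; apply: bmeas_norm; exact: bmeasB.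
    move=> v _; apply: le_trans (F_lipschitz _ _) _.
    have -> : v - (rho * u + c * v) = (1 - c) * v - rho * u by ring.
    apply: le_trans (ler_normB _ _) _; rewrite !normrM [`|1 - c|]ger0_norm ?subr_ge0//.
    by rewrite addrC mulrDr lerD2l ler_wpM2r.
  rewrite RintegralZl// ler_wpM2l//.
  rewrite RintegralD//; last exact: (bmeas_integrable ga (@bmeas_cst R _ R `|u|)).
  by rewrite Rintegral_prob_cst lerD2l.
apply: le_trans (ler_normD _ _) _; rewrite !normrM normr_nat.
have r0 := normr_ge0 rho.
move: h1 h2; move: `|F p - F q| `|\int[ga]_v _| => x y h1 h2.
clear bb1 bb2 i1 i2 bF bF' ia a1 bk mx.
move: h1 h2; rewrite !mulrDr ?mulr1; have := mulr_ge0 r0 u0; have := mulr_ge0 r0 p0; lra.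
Qed.

End dice_kernel.

Section kernel_covariance.
Context {R : realType} {d : measure_display} {T : measurableType d}.
Variables (P : probability T R) (G : nat -> {RV P >-> R}) (r : nat -> nat -> R).
Hypothesis hgauss : gaussian_sequence G.
Hypothesis hcent : centered_sequence G.
Hypothesis hcov : forall i j,
  ('E_P[fun w => (G i w * G j w)%R] = (r i j)%:E)%E.
Hypotheses (r_diag : forall i, r i i = 2^-1) (r_sym : forall i j, r i j = r j i).
Notation ga := (normal_prob 0 (Num.sqrt (2^-1 : R))).
Notation g := (@dice_kernel R).

Let mG i : measurable_fun setT (G i). Proof. exact: measurable_funP. Qed.

Let mcomb (rho : R) : measurable_fun setT
  (fun z : R * R => (z.1, rho * z.1 + Num.sqrt (1 - rho ^+ 2) * z.2)).
Proof.
apply/measurable_fun_pairP; split; first exact: measurable_fst.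
rewrite (_ : _ \o _ = fun z => rho * z.1 + Num.sqrt (1 - rho ^+ 2) * z.2)//.
by apply: measurable_funD; apply: measurable_funM.
Qed.

Lemma pair_Rintegral i k (rho := 2 * r i k) (f : R * R -> R) : bmeas f ->
  \int[P]_w f (G i w, G k w) =
  \int[ga]_u \int[ga]_v f (u, rho * u + Num.sqrt (1 - rho ^+ 2) * v).
Proof.
move=> bf; have /= L := pair_representation hgauss hcent hcov r_diag r_sym i k.
have mp : measurable_fun setT (fun w => (G i w, G k w)).
  by apply/measurable_fun_pairP; split.
rewrite (same_law_Rintegral (P' := (ga \x ga)%E) mp (@mcomb rho) L bf) bfubini1//.
exact: (bmeas_comp (@mcomb rho) bf).
Qed.

Let pos_quad (u p : R) : (1 + `|u| + `|p|) * (1 + `|p| + `|u|) <= 3 * (1 + u ^+ 2 + p ^+ 2).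
Proof.
rewrite -(real_normK (num_real u)) -(real_normK (num_real p)).
have := sqr_ge0 (`|u| - `|p|); have := sqr_ge0 (`|u| - 1); have := sqr_ge0 (`|p| - 1).
nra.
Qed.

(** 216 = 6 * 6 * 3 * 2: a factor 6 from each smoothed kernel, the 3 of [pos_quad], and the mean 2
    of 1 + u^2 + p^2 under variances 1/2. *)
Lemma smoothed_kernel_product (rho tau : R) : `|rho| <= 1 -> `|tau| <= 1 ->
  `|\int[ga]_u \int[ga]_p (smoothed_kernel tau p u * smoothed_kernel rho u p)| <=
  216 * `|rho| * `|tau|.
Proof.
move=> rho1 tau1; set C := 108 * `|rho| * `|tau|.
have C0 : 0 <= C by rewrite !mulr_ge0.
have [i2 e2] := normal_prob_sqr (sqrt_half_neq0 R).
have bst : bmeas (fun z : R * R => smoothed_kernel tau z.2 z.1 * smoothed_kernel rho z.1 z.2).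
  apply: bmeasM; last exact: bmeas_smoothed_kernel.
  have msw : measurable_fun setT (fun z : R * R => (z.2, z.1)).
    by apply/measurable_fun_pairP; split; [exact: measurable_snd|exact: measurable_fst].
  exact: (bmeas_comp msw (bmeas_smoothed_kernel tau)).
have bp u : bmeas (fun p => smoothed_kernel tau p u * smoothed_kernel rho u p).
  exact: (bmeas_pair1 u bst).
have quad (c e : R) : 0 <= c ->
    ga.-integrable setT (EFin \o (fun x : R => c * (e + x ^+ 2))) /\
    \int[ga]_x (c * (e + x ^+ 2)) = c * (e + 2^-1).
  move=> c0; have ie := bmeas_integrable ga (@bmeas_cst R _ R e).
  have iS : ga.-integrable setT (EFin \o (fun x : R => e + x ^+ 2)).
    by apply: eq_integrable (integrableD measurableT ie i2).
  split; first by apply: eq_integrable (integrableZl measurableT c iS).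
  by rewrite RintegralZl// RintegralD// Rintegral_prob_cst e2 sqr_sqrt_half.
have inner u : `|\int[ga]_p (smoothed_kernel tau p u * smoothed_kernel rho u p)| <=
    C * ((1 + 2^-1) + u ^+ 2).
  have [iq eq_] := quad C (1 + u ^+ 2) C0.
  apply: le_trans (le_normr_Rintegral _ _) _ => //; first exact: (bmeas_integrable ga (bp u)).
  rewrite addrAC -eq_; apply: le_Rintegral => //.
    exact: (bmeas_integrable ga (bmeas_norm (bp u))).
  move=> p _; rewrite normrM.
  apply: le_trans (ler_pM (normr_ge0 _) (normr_ge0 _)
    (smoothed_kernel_bound p u tau1) (smoothed_kernel_bound u p rho1)) _.
  have := ler_wpM2l (mulr_ge0 (normr_ge0 rho) (normr_ge0 tau)) (pos_quad u p).
  by rewrite /C; lra.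
have [iq eq_] := quad C (1 + 2^-1) C0.
have bi := bmeas_fubini1 ga ga bst.
apply: le_trans (le_normr_Rintegral _ _) _ => //; first exact: (bmeas_integrable ga bi).
apply: (@le_trans _ _ (\int[ga]_u (C * ((1 + 2^-1) + u ^+ 2)))).
  apply: le_Rintegral => //.
    exact: (bmeas_integrable ga (bmeas_norm bi)).
rewrite eq_ /C; lra.
Qed.

(* Conditionally on the first and the last of the four variables, the two
   kernels are independent and each is averaged over a fresh normal variable. *)
Lemma dice_kernel_cov i j k l :
  `|\int[P]_w \int[P]_w' (g (G i w) (G j w') * g (G k w) (G l w'))| <=
  864 * `|r i k| * `|r j l|.
Proof.
(* The variables kept are [G i] at w and [G l] at w'; [G k] and [G j] are averaged given them,
   whence the order l, j in [tau]. Both correlations are twice a covariance, so 864 = 4 * 216. *)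
pose rho := 2 * r i k; pose tau := 2 * r l j.
have rho1 : `|rho| <= 1 := corr_le1 hgauss hcent hcov r_diag r_sym i k.
have tau1 : `|tau| <= 1 := corr_le1 hgauss hcent hcov r_diag r_sym l j.
(* The variable averaged at w' is the second argument of its kernel; antisymmetry moves it to the
   first, at the cost of a sign. *)
have inner x x' : \int[P]_w' (g x (G j w') * g x' (G l w')) =
    - \int[ga]_p (smoothed_kernel tau p x * g x' p).
  have mc (c : R) : measurable_fun setT (fun _ : R * R => c) by [].
  have bf : bmeas (fun z : R * R => g x z.2 * g x' z.1).
    by apply: bmeasM; apply: bmeas_dice_kernel.
  rewrite (@pair_Rintegral l j _ bf)/=.
  rewrite -[RHS]mulN1r -RintegralM_cst; last first.
    apply: bmeasM; last by apply: bmeas_dice_kernel.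
    exact: (bmeas_pair2 x (bmeas_smoothed_kernel tau)).
  apply: eq_Rintegral => p _; rewrite -/tau mulN1r /smoothed_kernel.
  have mx : measurable_fun setT (fun v : R => tau * p + Num.sqrt (1 - tau ^+ 2) * v).
    by apply: measurable_funD => //; exact: measurable_funM.
  transitivity (g x' p * \int[ga]_v g x (tau * p + Num.sqrt (1 - tau ^+ 2) * v)).
    rewrite -RintegralM_cst; last by apply: bmeas_dice_kernel.
    by apply: eq_Rintegral => v _; exact: mulrC.
  rewrite -[RHS]mulNr [RHS]mulrC; congr (_ * _).
  rewrite -[RHS]mulN1r -RintegralM_cst; last by apply: bmeas_dice_kernel.
  by apply: eq_Rintegral => v _; rewrite mulN1r -dice_kernelC.
under eq_Rintegral do rewrite inner.
have mstk : measurable_fun setT (fun z : (R * R) * R => (z.2, z.1.1)).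
  by apply/measurable_fun_pairP; split;
    [exact: measurable_snd|exact: (measurableT_comp measurable_fst measurable_fst)].
have bst : bmeas (fun z : (R * R) * R => smoothed_kernel tau z.2 z.1.1 * g z.1.2 z.2).
  apply: bmeasM; first exact: (bmeas_comp mstk (bmeas_smoothed_kernel tau)).
  apply: bmeas_dice_kernel; last exact: measurable_snd.
  exact: (measurableT_comp measurable_snd measurable_fst).
have bout := bmeasN (bmeas_fubini1 (ga \x ga)%E ga bst).
rewrite (@pair_Rintegral i k _ bout)/= -/rho.
rewrite (_ : \int[ga]_u _ = - \int[ga]_u \int[ga]_p
  (smoothed_kernel tau p u * smoothed_kernel rho u p)).
  rewrite normrN; apply: le_trans (smoothed_kernel_product rho1 tau1) _.
  rewrite /rho /tau !normrM (r_sym l j) normr_nat; lra.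
have bsk : bmeas (fun z : R * R => smoothed_kernel tau z.2 z.1 * smoothed_kernel rho z.1 z.2).
  apply: bmeasM; last exact: bmeas_smoothed_kernel.
  have msw : measurable_fun setT (fun z : R * R => (z.2, z.1)).
    by apply/measurable_fun_pairP; split; [exact: measurable_snd|exact: measurable_fst].
  exact: (bmeas_comp msw (bmeas_smoothed_kernel tau)).
rewrite -[RHS]mulN1r -RintegralM_cst; last exact: (bmeas_fubini1 ga ga bsk).
apply: eq_Rintegral => u _.
have mv : measurable_fun setT (fun z : R * R => rho * u + Num.sqrt (1 - rho ^+ 2) * z.1).
  by apply: measurable_funD => //; apply: measurable_funM.
have bvp : bmeas (fun z : R * R => smoothed_kernel tau z.2 u *
    g (rho * u + Num.sqrt (1 - rho ^+ 2) * z.1) z.2).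
  apply: bmeasM; last by apply: bmeas_dice_kernel.
  exact: (bmeas_comp measurable_snd (bmeas_pair2 u (bmeas_smoothed_kernel tau))).
transitivity (-1 * \int[ga]_v \int[ga]_p (smoothed_kernel tau p u *
    g (rho * u + Num.sqrt (1 - rho ^+ 2) * v) p)).
  rewrite -RintegralM_cst; last exact: (bmeas_fubini1 ga ga bvp).
  by apply: eq_Rintegral => v _; rewrite mulN1r.
congr (_ * _); rewrite -(bfubini1 ga ga bvp) (bfubini2 ga ga bvp)/=.
apply: eq_Rintegral => p _; rewrite RintegralM_cst//.
apply: bmeas_dice_kernel => //.
by apply: measurable_funD => //; exact: measurable_funM.
Qed.

(** Expanding the square gives a fourfold sum whose bound factors into a covariance in (i, k) and
    one in (j, l), hence into the square of a double sum. *)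
Lemma dice_kernel_sum_sqr n :
  \int[P]_w \int[P]_w' (\sum_(i < n) \sum_(j < n) g (G i w) (G j w')) ^+ 2 <=
  864 * (\sum_(i < n) \sum_(k < n) `|r i k|) ^+ 2.
Proof.
have bq i j k l : bmeas (fun z : T * T => g (G i z.1) (G j z.2) * g (G k z.1) (G l z.2)).
  by apply: bmeasM; apply: bmeas_dice_kernel; exact: measurableT_comp.
have E w w' : (\sum_(i < n) \sum_(j < n) g (G i w) (G j w')) ^+ 2 =
  \sum_(i < n) \sum_(k < n) \sum_(j < n) \sum_(l < n)
    (g (G i w) (G j w') * g (G k w) (G l w')).
  rewrite expr2 mulr_suml; apply: eq_bigr => i _; rewrite mulr_sumr.
  apply: eq_bigr => k _; rewrite mulr_suml; apply: eq_bigr => j _.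
  by rewrite mulr_sumr.
have -> : \int[P]_w \int[P]_w' (\sum_(i < n) \sum_(j < n) g (G i w) (G j w')) ^+ 2 =
  \sum_(i < n) \sum_(k < n) \sum_(j < n) \sum_(l < n)
    \int[P]_w \int[P]_w' (g (G i w) (G j w') * g (G k w) (G l w')).
  transitivity (\int[P]_w \sum_(i < n) \sum_(k < n) \sum_(j < n) \sum_(l < n)
    \int[P]_w' (g (G i w) (G j w') * g (G k w) (G l w'))).
    apply: eq_Rintegral => w _; under eq_Rintegral do rewrite E.
    do 4 (rewrite bRintegral_sum; [apply: eq_bigr => ? _|by move=> ?;
      repeat (apply: bmeas_sum => ?); exact: (bmeas_pair1 w (bq _ _ _ _))]).
    by [].
  do 4 (rewrite bRintegral_sum; [apply: eq_bigr => ? _|by move=> ?;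
      repeat (apply: bmeas_sum => ?); exact: (bmeas_fubini1 P P (bq _ _ _ _))]).
  by [].
rewrite expr2 mulrCA mulr_suml; apply: ler_sum => i _.
rewrite mulr_suml; apply: ler_sum => k _.
rewrite mulrCA mulrA mulr_sumr; apply: ler_sum => j _.
rewrite mulr_sumr; apply: ler_sum => l _.
exact: le_trans (ler_norm _) (dice_kernel_cov i j k l).
Qed.

End kernel_covariance.

(** * Covariances of fractional Gaussian noise *)

Lemma powR_midpoint (R : realType) (p x y : R) : 1 <= p -> 0 <= x -> 0 <= y ->
  ((x + y) / 2) `^ p <= (x `^ p + y `^ p) / 2.
Proof.
move=> p1 x0 y0.
rewrite (_ : (x + y) / 2 = 2^-1 * x + (1 - 2^-1) * y); last by field.
rewrite (_ : (_ + _ `^ p) / 2 = 2^-1 * x `^ p + (1 - 2^-1) * y `^ p); last by field.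
have h0 : (0 : R) <= 2^-1 by rewrite invr_ge0.
have h1 : (2^-1 : R) <= 1 by rewrite invf_le1 ?ler1n.
by apply: (convex_powR p1 (Itv01 h0 h1)); rewrite inE/= in_itv/= ?x0 ?y0.
Qed.

Section fbm_covariance.
Context {R : realType}.
Variable H : R.
Hypothesis hH : 0 < H < 1.
Notation p := (2 * H).
Let r (i j : nat) : R := s_H H (i%:Z - j%:Z).
Let phi (x : R) : R := `|x| `^ p.

Let p_gt0 : 0 < p. Proof. by move/andP : hH => [h _]; lra. Qed.

Let phi0 : phi 0 = 0.
Proof. by rewrite /phi normr0 powR0// gt_eqF. Qed.

Let phiN x : phi (- x) = phi x. Proof. by rewrite /phi normrN. Qed.

Let rE i j : r i j = 4^-1 * (phi (i%:R - j%:R + 1) + phi (i%:R - j%:R - 1)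
  - 2 * phi (i%:R - j%:R)).
Proof. by rewrite /r /s_H intrB !pmulrn. Qed.

Lemma fbm_cov_diag i : s_H H (i%:Z - i%:Z) = 2^-1.
Proof.
rewrite -[LHS]/(r i i) rE subrr sub0r add0r phiN phi0 mulr0 subr0.
by rewrite /phi normr1 powR1; field.
Qed.

Lemma fbm_cov_sym i j : s_H H (i%:Z - j%:Z) = s_H H (j%:Z - i%:Z).
Proof.
rewrite -[LHS]/(r i j) -[RHS]/(r j i) !rE -(opprB (j%:R : R)) phiN.
congr (_ * (_ - _)); rewrite addrC -(phiN (_ - 1)) -(phiN (_ + 1)).
by congr (phi _ + phi _); ring.
Qed.

(** [r] is a quarter of the second difference of [phi], so a row telescopes to first differences at
    the two ends of the window. *)
Let row_sum i n : \sum_(k < n) r i k =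
  4^-1 * (phi (i%:R + 1) - phi i%:R + (phi (i%:R - n%:R) - phi (i%:R - n%:R + 1))).
Proof.
elim: n => [|n IH]; first by rewrite big_ord0 subr0; ring.
rewrite big_ord_recr/= IH rE -[n.+1%:R]natr1.
rewrite (_ : i%:R - (n%:R + 1) + 1 = i%:R - n%:R); last by ring.
rewrite (_ : i%:R - (n%:R + 1) = i%:R - n%:R - 1); last by ring.
by ring.
Qed.

(** Both boundary differences are nonnegative because |x|^(2H) increases with |x|. This holds for
    every H, even for H < 1/2, where no off-diagonal covariance is positive. *)
Lemma fbm_cov_row_ge0 (n : nat) (i : 'I_n) : 0 <= \sum_(k < n) s_H H (i%:Z - k%:Z).
Proof.
have := row_sum i n; rewrite /r => ->; rewrite mulr_ge0// addr_ge0// subr_ge0.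
- rewrite /phi ge0_ler_powR ?nnegrE ?(ltW p_gt0)//.
  by rewrite !ger0_norm ?addr_ge0// lerDl.
- rewrite /phi ge0_ler_powR ?nnegrE ?(ltW p_gt0)//.
  have hi : (i.+1%:R : R) <= n%:R by rewrite ler_nat.
  by rewrite -[i.+1%:R]natr1 in hi; rewrite !ler0_norm; lra.
Qed.

(** A second telescoping, on top of [row_sum]; the value is half the variance at time n of standard
    fractional Brownian motion. *)
Lemma fbm_cov_sum n : \sum_(i < n) \sum_(k < n) s_H H (i%:Z - k%:Z) = n%:R `^ p / 2.
Proof.
under eq_bigr do rewrite row_sum.
rewrite -mulr_sumr.
have E m : \sum_(i < m) (phi (i%:R + 1) - phi i%:R +
    (phi (i%:R - n%:R) - phi (i%:R - n%:R + 1))) =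
  phi m%:R + (phi n%:R - phi (m%:R - n%:R)).
  elim: m => [|m IH]; first by rewrite big_ord0 phi0 sub0r phiN subrr addr0.
  by rewrite big_ord_recr/= IH -[m.+1%:R]natr1 (addrAC m%:R 1); ring.
by rewrite E subrr phi0 subr0 /phi ger0_norm//; field.
Qed.

Let off_diag_ge0 (m : nat) : 1 <= p ->
  0 <= phi (m.+1%:R + 1) + phi (m.+1%:R - 1) - 2 * phi m.+1%:R.
Proof.
move=> p1; have m0 : 0 <= m.+1%:R - 1 :> R by rewrite -[m.+1%:R]natr1 addrK.
have := powR_midpoint p1 (addr_ge0 (ler0n R m.+1) ler01) m0.
rewrite (_ : (_ + _) / 2 = m.+1%:R); last by field.
have k0 : 0 <= m.+1%:R + 1 :> R by rewrite addr_ge0.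
by rewrite /phi !ger0_norm//; lra.
Qed.

(** Concavity of x^p is obtained from convexity of x^(1/p), applied to the p-th powers of m and m +
    2. *)
Let off_diag_le0 (m : nat) : p <= 1 ->
  phi (m.+1%:R + 1) + phi (m.+1%:R - 1) - 2 * phi m.+1%:R <= 0.
Proof.
move=> p1; have m0 : 0 <= m.+1%:R - 1 :> R by rewrite -[m.+1%:R]natr1 addrK.
have pi1 : 1 <= p^-1 by rewrite invf_ge1.
have k0 : 0 <= m.+1%:R + 1 :> R by rewrite addr_ge0.
have := powR_midpoint pi1 (powR_ge0 (m.+1%:R + 1) p) (powR_ge0 (m.+1%:R - 1) p).
rewrite -!powRrM mulfV ?gt_eqF// !powRr1//.
rewrite (_ : (m.+1%:R + 1 + _) / 2 = m.+1%:R); last by field.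
set a := (_ + _) / 2 => ha.
have a0 : 0 <= a by rewrite divr_ge0// addr_ge0// powR_ge0.
have : a <= m.+1%:R `^ p.
  have aE : a = (a `^ p^-1) `^ p by rewrite -powRrM mulVf ?gt_eqF// powRr1.
  rewrite [leLHS]aE.
  by rewrite ge0_ler_powR ?nnegrE ?powR_ge0 ?(ltW p_gt0).
by rewrite /a /phi !ger0_norm//; lra.
Qed.

Let off_diag i j : i != j -> exists m : nat,
  r i j = 4^-1 * (phi (m.+1%:R + 1) + phi (m.+1%:R - 1) - 2 * phi m.+1%:R).
Proof.
wlog ij : i j / (j < i)%N => [W ij|_].
  have [ji|ji|ji] := ltngtP j i; first exact: W.
    rewrite /r fbm_cov_sym; apply: W => //; by rewrite eq_sym.
  by rewrite ji eqxx in ij.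
exists (i - j).-1; rewrite rE prednK ?subn_gt0// natrB//; exact: ltnW.
Qed.

Lemma fbm_cov_abs_sum n : \sum_(i < n) \sum_(k < n) `|s_H H (i%:Z - k%:Z)| <=
  n%:R `^ (Num.max 1 p).
Proof.
have [p1|p1] := leP 1 p.
  apply: (@le_trans _ _ (n%:R `^ p / 2)).
    rewrite -fbm_cov_sum; apply: ler_sum => i _; apply: ler_sum => k _.
    rewrite ger0_norm//; have [->|/off_diag[m ]] := eqVneq (i : nat) k.
      by rewrite fbm_cov_diag invr_ge0.
    by rewrite /r => ->; rewrite mulr_ge0// off_diag_ge0.
  by have := powR_ge0 (n%:R : R) p; lra.
rewrite powRr1//.
apply: (@le_trans _ _ (\sum_(i < n) \sum_(k < n)
    ((i == k)%:R - s_H H (i%:Z - k%:Z)))).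
  apply: ler_sum => i _; apply: ler_sum => k _.
  have [->|ik] := eqVneq i k.
    by rewrite fbm_cov_diag ger0_norm ?invr_ge0//=; lra.
  have /off_diag[m] : (i : nat) != k by [].
  rewrite /r sub0r => ->; rewrite ler0_norm// mulr_ge0_le0//.
  by rewrite off_diag_le0// ltW.
under eq_bigr do rewrite sumrB.
rewrite sumrB fbm_cov_sum.
rewrite (_ : \sum_(i < n) _ = n%:R); last first.
  rewrite -[n in RHS]card_ord -sumr_const; apply: eq_bigr => i _.
  by rewrite (bigD1 i)//= eqxx big1 ?addr0// => j; rewrite eq_sym => /negbTE ->.
by have := powR_ge0 (n%:R : R) p; lra.
Qed.

End fbm_covariance.

(** * Anticoncentration *)

Section derivative_mass.
Context {R : realType}.
Notation mu := (@lebesgue_measure R).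

(** The standard normal density is at most 1, so on each bounded interval the integral is at most
    the increment of [theta], hence at most 2 B. *)
Lemma normal_prob_derivative_le (theta theta' : R -> R) (B : R) :
  (forall x : R, is_derive x 1 theta (theta' x)) -> continuous theta' ->
  (forall x, 0 <= theta' x) -> bmeas theta' -> (forall x, `|theta x| <= B) ->
  \int[normal_prob 0 1]_z theta' z <= 2 * B.
Proof.
move=> dt ct t0 bt tB; have [mt [M tM]] := bt.
pose f_ (n : nat) z := theta' z * \1_(`[- n.+1%:R, n.+1%:R]%classic) z.
have bf n : bmeas (f_ n) by apply: bmeasM => //; exact: bmeas_indic.
have cvf : \int[normal_prob 0 1]_z f_ n z @[n --> \oo] --> \int[normal_prob 0 1]_z theta' z.
  apply: (@bounded_convergence _ _ _ (normal_prob 0 1) f_ theta' M) => //.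
  - by move=> n; exact: (bmeasW (bf n)).
  - move=> n z; rewrite normrM -[M]mulr1 ler_pM//.
    by rewrite indicE; case: (_ \in _); rewrite ?normr1 ?normr0.
  - move=> z; apply: cvg_near_cst; near=> n.
    rewrite /f_ indicE mem_set ?mulr1//= in_itv/= -ler_norml.
    apply: (@le_trans _ _ n%:R); last by rewrite ler_nat.
    by near: n; exact: nbhs_infty_ger.
apply: (cvgr_to_le cvf); near=> n.
rewrite Rintegral_normal_prob; [|exact: (bmeasW (bf n))|exact: (bmeas_integrable (normal_prob 0 1) (bf n))].
have nn : (- n.+1%:R : R) < n.+1%:R by rewrite gtrN// ltr0n.
have E : (\int[mu]_x (f_ n x)%:E = (theta n.+1%:R - theta (- n.+1%:R))%:E)%E.
  rewrite EFinB -(@continuous_FTC2 _ theta')//.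
  - rewrite [RHS]integral_mkcond; apply: eq_integral => x _.
    by rewrite /f_ patchE indicE; case: ifPn => _; rewrite ?mulr1 ?mulr0.
  - exact: continuous_subspaceT.
  - split=> [x _||]; first exact: ex_derive.
    + apply: cvg_at_right_filter; apply: differentiable_continuous.
      by apply/derivable1_diffP; exact: ex_derive.
    + apply: cvg_at_left_filter; apply: differentiable_continuous.
      by apply/derivable1_diffP; exact: ex_derive.
  - by move=> x _; rewrite derive1E; exact: derive_val.
have f0 x : 0 <= f_ n x by rewrite mulr_ge0// indicE.
have if_ : mu.-integrable setT (EFin \o f_ n).
  apply/integrableP; split; first by apply/measurable_EFinP; exact: (bmeasW (bf n)).
  by under eq_integral do rewrite /= ger0_norm//; rewrite E ltry.
apply: (@le_trans _ _ (\int[mu]_x f_ n x)).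
  apply: le_Rintegral => //.
    have := integrable_normal_bounded 0 (oner_neq0 R) (leq0n 2) (bf n).
    by apply: eq_integrable => // x _ /=; rewrite expr0 mul1r.
  move=> x _; rewrite ler_piMr//.
  apply: le_trans (normal_pdf_ub 0 x (oner_neq0 R)) _.
  have p2 : (1 : R) <= pi *+ 2 by have := pi_ge2 R; rewrite -mulr_natr; lra.
  have p0 : (0 : R) < pi *+ 2 by apply: lt_le_trans p2.
  rewrite /normal_peak expr1n mul1r invf_le1 ?sqrtr_gt0// -[leLHS]sqrtr1.
  by rewrite ler_sqrt// ltW.
rewrite /Rintegral E/=; have := tB n.+1%:R; have := tB (- n.+1%:R).
by rewrite !ler_norml => /andP[? ?] /andP[? ?]; lra.
Unshelve. all: by end_near. Qed.

End derivative_mass.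

Section anticoncentration.
Context {R : realType} {n : nat}.
Notation sg := (Num.sqrt (2^-1 : R)).
Notation f := (normal_pdf 0 sg).
Variables (mu : probability (n.-tuple R) R) (K : 'I_n -> 'I_n -> R).
Hypothesis K_sym : forall i j, K i j = K j i.
Hypothesis cf_mu : forall (t : 'I_n -> R) th,
  \int[mu]_x cos (\sum_i t i * tnth x i + th) =
  cos th * expR (- ((\sum_i \sum_j t i * t j * K i j) / 2)).
Variables (a m : 'I_n -> R).
Hypothesis m_def : forall i, \sum_j K i j * a j = m i.
Hypothesis am : \sum_i a i * m i = 1.
Hypothesis m_ge0 : forall i, 0 <= m i.
Hypothesis int_sqr : forall i,
  mu.-integrable setT (EFin \o (fun x : n.-tuple R => tnth x i ^+ 2)).
Hypothesis E_sqr : forall i, \int[mu]_x (tnth x i ^+ 2) = 2^-1.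

Definition cdf_sum (x : n.-tuple R) : R := \sum_i F (tnth x i).

Let D (x : n.-tuple R) : R := \sum_i m i * f (tnth x i).
Let S : R := \sum_i m i.

Lemma bmeas_cdf_sum : bmeas cdf_sum.
Proof.
apply: bmeas_sum => i; apply: bmeas_comp bmeas_F; exact: measurable_tnth.
Qed.

Let f_ge0 x : 0 <= f x. Proof. exact: normal_pdf_ge0. Qed.

Let bf : bmeas (f : R -> R).
Proof.
split; first exact: measurable_normal_pdf.
by exists 1 => x; rewrite ger0_norm// normal_pdf_half_le1.
Qed.

Let bD : bmeas D.
Proof.
apply: bmeas_sum => i; apply: bmeasM; first exact: bmeas_cst.
apply: bmeas_comp bf; exact: measurable_tnth.
Qed.

Let D_ge0 x : 0 <= D x.
Proof. by apply: sumr_ge0 => i _; rewrite mulr_ge0. Qed.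

Variables (v0 k : R).
Hypothesis k_gt0 : 0 < k.

(** 1 / q is the derivative of k arctan((v - v0) / k); it is at most 1 everywhere and at least 1/2
    when |v - v0| <= k. *)
Let q (v : R) : R := 1 + ((v - v0) / k) ^+ 2.
Let q_ge1 v : 1 <= q v. Proof. by rewrite lerDl sqr_ge0. Qed.
Let q_neq0 v : q v != 0. Proof. by rewrite gt_eqF// (lt_le_trans _ (q_ge1 v)). Qed.

Let h (x : n.-tuple R) := D x * (q (cdf_sum x))^-1.

Let cq : continuous q.
Proof.
move=> x; apply: cvgD; first exact: cvg_cst.
apply: cvgM; (apply: cvgM; last exact: cvg_cst); apply: cvgB;
  by [exact: cvg_id|exact: cvg_cst].
Qed.

Let cqV : continuous (fun v => (q v)^-1).
Proof. by move=> x; apply: cvgV => //; exact: cq. Qed.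

Let bh : bmeas h.
Proof.
apply: bmeasM => //; split.
  exact: (measurableT_comp (continuous_measurable_fun cqV) (bmeasW bmeas_cdf_sum)).
exists 1 => x; rewrite ger0_norm ?invr_ge0 ?(le_trans _ (q_ge1 _))//.
by rewrite invf_le1 ?q_ge1// (lt_le_trans _ (q_ge1 _)).
Qed.

Let path (x : n.-tuple R) i (z : R) : R := tnth x i + m i * (z - \sum_j a j * tnth x j).

Let dpath x i (z : R) : is_derive z 1 (path x i) (m i).
Proof.
rewrite /path; apply: is_derive_eq.
by rewrite /GRing.scale/= !(mulr0,addr0,add0r,subr0,mulr1,mul1r).
Qed.

Let cdf_path (x : n.-tuple R) (z : R) :
  cdf_sum (resample a m (x, z)) = (\sum_(i < n) (F \o path x i)) z.
Proof. by rewrite fct_sumE; apply: eq_bigr => i _; rewrite tnth_mktuple. Qed.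

Let D_path (x : n.-tuple R) (z : R) :
  D (resample a m (x, z)) = (\sum_(i < n) (fun z => m i * f (path x i z))) z.
Proof. by rewrite fct_sumE; apply: eq_bigr => i _; rewrite tnth_mktuple. Qed.

Let dcdf_path x (z : R) : is_derive z 1 (fun z => cdf_sum (resample a m (x, z)))
  (D (resample a m (x, z))).
Proof.
rewrite (_ : (fun z => _) = \sum_(i < n) (F \o path x i)); last first.
  by apply/funext => ?; exact: cdf_path.
rewrite D_path [in X in is_derive _ _ _ X]fct_sumE; apply: is_derive_sum => i.
by have := is_derive1_comp (is_derive_F (path x i z)) (dpath x i z); rewrite mulrC.
Qed.

Let cD_path x : continuous (fun z => D (resample a m (x, z))).
Proof.
move=> z; apply: differentiable_continuous; apply/derivable1_diffP.
rewrite (_ : (fun z => _) = \sum_(i < n) (fun z => m i * f (path x i z))); last first.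
  by apply/funext => ?; exact: D_path.
apply: derivable_sum => i.
have H := is_derive1_comp (is_derive_normal_pdf 0 (sqrt_half_neq0 R) (path x i z)) (dpath x i z).
by apply: derivableM => //; exact: ex_derive.
Qed.

Let h_le : \int[mu]_x h x <= k * pi.
Proof.
have mr := measurable_resample (n := n) a m.
have L := resample_law K_sym cf_mu m_def am.
rewrite (same_law_Rintegral (P' := (mu \x normal_prob 0 1)%E) (@measurable_id _ _ setT) mr L bh).
have bhr := bmeas_comp mr bh.
rewrite bfubini1// -[leRHS](Rintegral_prob_cst mu); apply: ler_bRintegral.
- exact: (bmeas_fubini1 mu (normal_prob 0 1) bhr).
- exact: bmeas_cst.
(* By the chain rule [h] is the derivative of [theta] along the resampling path, and |theta| stays
   below k pi / 2. *)
move=> x; pose theta z := k * atan ((cdf_sum (resample a m (x, z)) - v0) / k).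
have dtheta (z : R) : is_derive z 1 theta (h (resample a m (x, z))).
  have d1 := dcdf_path x z; rewrite /theta.
  have d2 : is_derive z 1 (fun z => (cdf_sum (resample a m (x, z)) - v0) / k)
      (D (resample a m (x, z)) / k).
    by apply: is_derive_eq; rewrite /GRing.scale/= !(mulr0,addr0,add0r,subr0,mulr1,mul1r) mulrC.
  have d3 := is_derive1_comp (is_derive1_atan _) d2.
  apply: is_derive_eq; rewrite /GRing.scale/= /h.
  have := q_neq0 (cdf_sum (resample a m (x, z))); rewrite /q.
  by move: (1 + _) => Q Q0; field; rewrite Q0 gt_eqF.
have -> : k * pi = 2 * (k * (pi / 2)) by field.
apply: (normal_prob_derivative_le dtheta).
- move=> z; apply: cvgM; first exact: cD_path.
  have cc : {for z, continuous (fun z => cdf_sum (resample a m (x, z)))}.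
    apply: differentiable_continuous; apply/derivable1_diffP.
    by have := dcdf_path x z => ?; exact: ex_derive.
  have ccq : {for cdf_sum (resample a m (x, z)), continuous (fun v => (q v)^-1)}.
    exact: cqV.
  exact: (continuous_comp cc ccq).
- by move=> z; rewrite mulr_ge0// invr_ge0 (le_trans _ (q_ge1 _)).
- exact: (bmeas_pair1 x bhr).
- move=> z; rewrite normrM ger0_norm ?(ltW k_gt0)// ler_wpM2l ?(ltW k_gt0)//.
  by rewrite ler_norml !ltW// ?atan_gtNpi2 ?atan_ltpi2.
Qed.

(* On the event, either the weighted second moment is at least M / 2, or the
   slope D is at least a fixed fraction of S. *)
Lemma cdf_sum_anticoncentration (M : R) : 0 < S -> 0 < M ->
  \int[mu]_x (`|cdf_sum x - v0| <= k)%R%:R <=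
  M^-1 + 4 * pi * Num.sqrt pi * expR M * k / S.
Proof.
move=> S0 M0; have spi : 0 < Num.sqrt pi :> R by rewrite sqrtr_gt0 pi_gt0.
(* 1 / c bounds [h] from below on the event when Q < 1: [D] contributes S e^(-M) / (2 sqrt(pi)) and
   1 / q contributes 1/2. *)
pose c : R := 4 * Num.sqrt pi * expR M / S.
have c0 : 0 < c by rewrite divr_gt0// !mulr_gt0// expR_gt0.
(* Normalised to have mean 1 / M, every second moment being 1/2; where Q >= 1 it dominates the
   indicator by itself. *)
pose Q (x : n.-tuple R) := 2 / (M * S) * \sum_i m i * tnth x i ^+ 2.
have Q0 x : 0 <= Q x.
  rewrite mulr_ge0 ?divr_ge0 ?mulr_ge0 ?(ltW M0) ?(ltW S0)// sumr_ge0// => i _.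
  by rewrite mulr_ge0// sqr_ge0.
(* A lower bound affine in y^2, so that it can be averaged with the weights m_i. For y^2 <= M it
   follows from e^(-y^2) >= e^(-M); beyond, its left side is negative. *)
have fM y : (Num.sqrt pi)^-1 * expR (- M) * (1 - y ^+ 2 / M) <= f y.
  rewrite normal_pdf_half -mulrA ler_pM2l ?invr_gt0//.
  have [yM|yM] := leP (y ^+ 2) M.
    apply: (@le_trans _ _ (expR (- M))); last by rewrite ler_expR lerN2.
    rewrite ler_piMr ?expR_ge0// gerBl divr_ge0 ?sqr_ge0// ltW//.
  apply: (@le_trans _ _ 0); last exact: expR_ge0.
  by rewrite mulr_ge0_le0 ?expR_ge0// subr_le0 ler_pdivlMr// mul1r ltW.
have DQ x : S * ((Num.sqrt pi)^-1 * expR (- M)) * (1 - Q x / 2) <= D x.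
  have -> : S * ((Num.sqrt pi)^-1 * expR (- M)) * (1 - Q x / 2) =
      \sum_i m i * ((Num.sqrt pi)^-1 * expR (- M) * (1 - tnth x i ^+ 2 / M)).
    transitivity ((Num.sqrt pi)^-1 * expR (- M) *
        (S - (\sum_i m i * tnth x i ^+ 2) / M)).
      by rewrite /Q; field; rewrite !gt_eqF.
    rewrite mulrBr /S mulr_suml !mulr_sumr -sumrB.
    by apply: eq_bigr => i _; field; rewrite !gt_eqF.
  by apply: ler_sum => i _; rewrite ler_wpM2l.
have qA x : `|cdf_sum x - v0| <= k -> 2^-1 <= (q (cdf_sum x))^-1.
  move=> xk; rewrite lef_pV2 ?posrE ?(lt_le_trans _ (q_ge1 _))//.
  rewrite /q -[leRHS]/(1 + 1) lerD2l -(real_normK (num_real _)) expr_le1//.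
  by rewrite normrM [`|k^-1|]gtr0_norm ?invr_gt0// ler_pdivrMr// mul1r.
have key x : (`|cdf_sum x - v0| <= k)%R%:R <= c * h x + Q x.
  have hx0 : 0 <= h x by rewrite mulr_ge0// invr_ge0 (le_trans _ (q_ge1 _)).
  have [/qA xk|_] := leP `|cdf_sum x - v0| k; last by rewrite addr_ge0// mulr_ge0// ltW.
  have [Q1|Q1] := leP 1 (Q x); first by rewrite -[leLHS]add0r lerD// mulr_ge0// ltW.
  rewrite -[leLHS]addr0 lerD//.
  have D1 : S * ((Num.sqrt pi)^-1 * expR (- M)) * 2^-1 <= D x.
    apply: le_trans (DQ x); rewrite ler_wpM2l//; last by lra.
    by rewrite !mulr_ge0 ?invr_ge0 ?expR_ge0 ?(ltW S0) ?(ltW spi).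
  have : S * ((Num.sqrt pi)^-1 * expR (- M)) * 2^-1 * 2^-1 <= h x.
    by rewrite /h ler_pM// !mulr_ge0 ?invr_ge0 ?expR_ge0 ?(ltW S0) ?(ltW spi).
  move=> hh; apply: le_trans (ler_wpM2l (ltW c0) hh).
  rewrite /c expRN (_ : _ * (_ / 2 / 2) = 1)//.
  by field; rewrite !gt_eqF// expR_gt0.
have iQ0 : mu.-integrable setT (EFin \o (fun x : n.-tuple R => \sum_i m i * tnth x i ^+ 2)).
  have H := @integrable_sum _ _ R mu setT measurableT _ (index_enum 'I_n) xpredT
    (fun i => EFin \o (fun x : n.-tuple R => m i * tnth x i ^+ 2)) _.
  apply: eq_integrable (H _) => // [x _|i _]; first by rewrite /= sumEFin.
  by apply: eq_integrable (integrableZl measurableT (m i) (int_sqr i)).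
have iQ : mu.-integrable setT (EFin \o Q).
  by apply: eq_integrable (integrableZl measurableT (2 / (M * S)) iQ0).
have EQ : \int[mu]_x Q x = M^-1.
  rewrite /Q RintegralZl// Rintegral_prob_sum => [|i]; last first.
    by apply: eq_integrable (integrableZl measurableT (m i) (int_sqr i)).
  under eq_bigr do rewrite RintegralZl// E_sqr.
  by rewrite -mulr_suml -/S; field; rewrite !gt_eqF.
have bch : bmeas (fun x => c * h x) by apply: bmeasM => //; exact: bmeas_cst.
have ich := bmeas_integrable mu bch.
have iU : mu.-integrable setT (EFin \o (fun x => c * h x + Q x)).
  by apply: eq_integrable (integrableD measurableT ich iQ).
apply: (@le_trans _ _ (\int[mu]_x (c * h x + Q x))).
  apply: le_Rintegral => //.
  apply: bmeas_integrable; apply: bmeas_bool; apply: measurable_fun_ler => //.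
  apply: measurableT_comp => //; apply: measurable_funB => //.
  exact: (bmeasW bmeas_cdf_sum).
rewrite RintegralD// EQ RintegralM_cst// addrC lerD2l.
apply: le_trans (ler_wpM2l (ltW c0) h_le) _.
by rewrite /c le_eqVlt; apply/orP; left; apply/eqP; field; rewrite gt_eqF.
Qed.

End anticoncentration.

(** * Dice *)

Section dice_deterministic.
Context {R : realType} {n : nat}.
Implicit Types x y z : n.-tuple R.

Definition beats_score x y : R :=
  \sum_(i < n) \sum_(j < n) ((tnth y j < tnth x i)%R%:R - (tnth x i < tnth y j)%R%:R).

Definition kernel_sum x y : R :=
  \sum_(i < n) \sum_(j < n) dice_kernel (tnth x i) (tnth y j).

Lemma beatsE x y : beats x y = (0 < beats_score x y) :> Prop.
Proof.
rewrite /beats -(ltr0z R) (_ : _%:~R = beats_score x y)//.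
rewrite rmorph_sum; apply: eq_bigr => i _; rewrite rmorph_sum; apply: eq_bigr => j _.
by rewrite rmorphB/= !pmulrn.
Qed.

Lemma beats_scoreC x y : beats_score x y = - beats_score y x.
Proof.
rewrite /beats_score exchange_big -sumrN; apply: eq_bigr => i _.
by rewrite -sumrN; apply: eq_bigr => j _; rewrite opprB.
Qed.

Lemma beats_scoreE x y :
  beats_score x y = kernel_sum x y + 2 * n%:R * (cdf_sum x - cdf_sum y).
Proof.
have -> : kernel_sum x y = beats_score x y -
    (\sum_(i < n) \sum_(j < n) 2 * F (tnth x i)) +
    \sum_(i < n) \sum_(j < n) 2 * F (tnth y j).
  rewrite /kernel_sum /beats_score -sumrB -big_split; apply: eq_bigr => i _.
  by rewrite -sumrB -big_split; apply: eq_bigr => j _.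
have c (v : R) : \sum_(j < n) v = n%:R * v by rewrite sumr_const card_ord mulr_natl.
under [X in _ - X + _]eq_bigr do rewrite c.
by rewrite c -!mulr_sumr /cdf_sum; ring.
Qed.

Definition regular_pair (k : R) x y : bool :=
  (k < `|cdf_sum x - cdf_sum y|) && (`|kernel_sum x y| < 2 * n%:R * k).

Lemma regular_pair_beats (k : R) x y : 0 < k -> regular_pair k x y ->
  [/\ beats x y <-> cdf_sum y < cdf_sum x, beats y x <-> cdf_sum x < cdf_sum y
    & cdf_sum x <> cdf_sum y].
Proof.
move=> k0 /andP[kV Wk]; rewrite !beatsE (beats_scoreC y x) oppr_gt0 beats_scoreE.
have nn : 0 <= n%:R :> R by [].
move: Wk; rewrite ltr_norml => /andP[W1 W2].
have [Vxy|Vxy] := leP 0 (cdf_sum x - cdf_sum y).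
  rewrite ger0_norm// in kV.
  have h := ler_wpM2l nn (ltW kV); split.
  - by split=> ?; lra.
  - by split=> ?; lra.
  - by move=> E; move: kV; rewrite E subrr; lra.
rewrite ltr0_norm// in kV.
have h := ler_wpM2l nn (ltW kV); split.
- by split=> ?; lra.
- by split=> ?; lra.
- by move=> E; move: kV; rewrite E subrr; lra.
Qed.

(** On pairwise regular dice [beats] is the order of the values of [cdf_sum], and these are
    distinct, so the strict linear order is inherited from the reals. *)
Lemma regular_transitive (k : R) x y z : 0 < k ->
  regular_pair k x y -> regular_pair k y z -> regular_pair k x z ->
  transitive_dice [set x; y; z].
Proof.
move=> k0 /(regular_pair_beats k0)[xy yx Vxy] /(regular_pair_beats k0)[yz zy Vyz]
  /(regular_pair_beats k0)[xz zx Vxz].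
have bxx (u : n.-tuple R) : ~ beats u u.
  by move=> uu; move: (uu); rewrite beatsE; have := beats_scoreC u u; lra.
have H (u v : n.-tuple R) : [set x; y; z] u -> [set x; y; z] v -> beats u v <-> cdf_sum v < cdf_sum u.
  by move=> [[]|] /= -> [[]|] /= ->; rewrite ?ltxx//; split=> // /bxx.
split.
  by rewrite !finite_setU; do !split; exact: finite_set1.
split => [u _|u v w Su Sv Sw|u v Su Sv uv]; first exact: bxx.
  by rewrite !H// => vu wv; exact: lt_trans vu.
have : cdf_sum u <> cdf_sum v.
  by move: Su Sv uv => [[]|] /= -> [[]|] /= -> // _; exact: nesym.
by move/eqP; rewrite neq_lt !H// => /orP[]; [right|left].
Qed.

End dice_deterministic.

Section dice_measurable.
Context {R : realType} {n : nat} {d : measure_display} {T : measurableType d}.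

Lemma measurable_imply (A B : set T) : measurable A -> measurable B ->
  measurable [set w | A w -> B w].
Proof.
move=> mA mB; rewrite (_ : mkset _ = ~` A `|` B).
  by apply: measurableU => //; exact: measurableC.
apply/seteqP; split => w /=; first by move=> AB; have [/AB|] := pselect (A w); [right|left].
by move=> [].
Qed.

Lemma measurable_iff (A B : set T) : measurable A -> measurable B ->
  measurable [set w | A w <-> B w].
Proof.
move=> mA mB; rewrite (_ : mkset _ = [set w | A w -> B w] `&` [set w | B w -> A w]).
  by apply: measurableI; exact: measurable_imply.
by apply/seteqP; split => w /= -[].
Qed.

Variables (X Y : T -> n.-tuple R).
Hypotheses (mX : measurable_fun setT X) (mY : measurable_fun setT Y).

Let mXi i : measurable_fun setT (fun w => tnth (X w) i).
Proof. exact: ((measurable_fun_tnthP X).1 mX i). Qed.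

Let mYi i : measurable_fun setT (fun w => tnth (Y w) i).
Proof. exact: ((measurable_fun_tnthP Y).1 mY i). Qed.

Lemma measurable_beats : measurable [set w | beats (X w) (Y w)].
Proof.
rewrite (_ : mkset _ = [set w | 0 < beats_score (X w) (Y w)]); last first.
  by apply/seteqP; split => w /=; rewrite beatsE.
apply: measurable_true_set; apply: measurable_fun_ltr => //.
apply: measurable_sum => i; apply: measurable_sum => j.
by apply: measurable_funB; apply: bmeasW; apply: bmeas_bool; exact: measurable_fun_ltr.
Qed.

Lemma measurable_tuple_eq : measurable [set w | X w = Y w].
Proof.
rewrite (_ : mkset _ = [set w | forall i, tnth (X w) i == tnth (Y w) i]).
  by apply: measurable_forall => i; apply: measurable_true_set; exact: measurable_fun_eqr.
apply/seteqP; split => w /= H; first by move=> i; rewrite H.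
by apply: eq_from_tnth => i; exact/eqP.
Qed.

Lemma bmeas_kernel_sum : bmeas (fun w => kernel_sum (X w) (Y w)).
Proof. by apply: bmeas_sum => i; apply: bmeas_sum => j; exact: bmeas_dice_kernel. Qed.

Lemma measurable_regular_pair k :
  measurable_fun setT (fun w => regular_pair k (X w) (Y w)).
Proof.
have mV (Z : T -> n.-tuple R) : measurable_fun setT Z ->
    measurable_fun setT (fun w => cdf_sum (Z w)).
  by move=> mZ; apply: bmeasW; exact: bmeas_comp bmeas_cdf_sum.
apply: measurable_and; apply: measurable_fun_ltr => //; apply: measurableT_comp => //.
  by apply: measurable_funB; exact: mV.
exact: (bmeasW bmeas_kernel_sum).
Qed.

Lemma measurable_beats_iff : measurable [set w | beats (X w) (Y w) <->
  \sum_(i < n) F (tnth (X w) i) > \sum_(i < n) F (tnth (Y w) i)].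
Proof.
apply: measurable_iff; first exact: measurable_beats.
apply: measurable_true_set; apply: measurable_fun_ltr; apply: measurable_sum => i;
  exact: (measurableT_comp measurable_F).
Qed.

End dice_measurable.

(** Quantifiers over the random set become quantifiers over the three indices, that is, finite
    intersections of measurable events. Repeated dice are harmless: [t] only has to enumerate the
    set. *)
Lemma measurable_transitive (R : realType) (n : nat) (d : measure_display)
    (T : measurableType d) (X Y Z : T -> n.-tuple R) :
  measurable_fun setT X -> measurable_fun setT Y -> measurable_fun setT Z ->
  measurable [set w | transitive_dice [set X w; Y w; Z w]].
Proof.
move=> mX mY mZ; pose t (i : 'I_3) w := if i == 0 :> nat then X w else
  if i == 1%N :> nat then Y w else Z w.
have mt i : measurable_fun setT (t i) by case: i => [[|[|[|]]]].
have tS w i : [set X w; Y w; Z w] (t i w).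
  by rewrite /t; case: i => [[|[|[|]]]]//= ?; [left; left|left; right|right].
have St w u : [set X w; Y w; Z w] u -> exists i, u = t i w.
  by move=> [[]|] ->; [exists ord0|exists (@Ordinal 3 1 isT)|exists ord_max].
rewrite (_ : mkset _ =
  [set w | forall i, ~ beats (t i w) (t i w)] `&`
  ([set w | forall i j k, beats (t i w) (t j w) -> beats (t j w) (t k w) ->
    beats (t i w) (t k w)] `&`
  [set w | forall i j, ~ (t i w = t j w) -> beats (t i w) (t j w) \/ beats (t j w) (t i w)])).
  apply: measurableI; last apply: measurableI.
  - by apply: measurable_forall => i; apply: measurableC; exact: measurable_beats.
  - apply: measurable_forall => i; apply: measurable_forall => j.
    apply: measurable_forall => k; apply: measurable_imply; first exact: measurable_beats.
    by apply: measurable_imply; exact: measurable_beats.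
  - apply: measurable_forall => i; apply: measurable_forall => j; apply: measurable_imply.
      by apply: measurableC; exact: measurable_tuple_eq.
    by apply: measurableU; exact: measurable_beats.
apply/seteqP; split => w /=.
  move=> [_ [h1 h2 h3]]; split=> [i /h1|]; first exact.
  by split=> [i j k|i j]; [exact: h2|exact: h3].
move=> [h1 [h2 h3]]; split.
  by rewrite !finite_setU; do !split; exact: finite_set1.
split=> [u /St[i ->]|u v x /St[i ->] /St[j ->] /St[k ->]|u v /St[i ->] /St[j ->]].
- exact: h1.
- exact: h2.
- exact: h3.
Qed.

(** * The law of a window of fractional Gaussian noise *)

Section window_law.
Context {R : realType} (H : R) (hH : 0 < H < 1).
Context {d0 : measure_display} {T0 : measurableType d0} (P0 : probability T0 R).
Variable G : nat -> {RV P0 >-> R}.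
Hypotheses (hgauss : gaussian_sequence G) (hcent : centered_sequence G).
Hypothesis hcov : forall i j : nat,
  ('E_P0[fun w => (G i w * G j w)%R] = (s_H H (i%:Z - j%:Z)%R)%:E)%E.
Notation p := (2 * H).
Notation K := (fun i j : nat => s_H H (i%:Z - j%:Z)).

Lemma measurable_window n : measurable_fun setT (window G 0 n).
Proof.
apply/measurable_fun_tnthP => i; rewrite (_ : _ \o _ = G i) => [|]//.
by apply/funext => w; rewrite /= tnth_mktuple.
Qed.

(** The dice may live on other probability spaces; the estimates are made on this law and its
    product with itself, and carried to pairs of dice by [pair_law]. *)
Definition window_law n : probability (n.-tuple R) R :=
  distribution P0 (mfun_of (@measurable_window n)).

Let lawW n A : measurable A -> P0 (window G 0 n @^-1` A) = window_law n A.
Proof. by []. Qed.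

Lemma window_law_Rintegral n (f : n.-tuple R -> R) : bmeas f ->
  \int[window_law n]_x f x = \int[P0]_w f (window G 0 n w).
Proof.
move=> bf; have mw := @measurable_window n.
rewrite (law_Rintegral (nu := window_law n) mw (@lawW n) (bmeasW bf))//.
exact: (bmeas_integrable P0 (bmeas_comp mw bf)).
Qed.

Let cf_window n (t : 'I_n -> R) th :
  \int[window_law n]_x cos (\sum_i t i * tnth x i + th) =
  cos th * expR (- ((\sum_i \sum_j t i * t j * K i j) / 2)).
Proof.
rewrite window_law_Rintegral; last first.
  apply: bmeas_cos; apply: measurable_funD => //; apply: measurable_sum => i.
  by apply: measurable_funM => //; exact: measurable_tnth.
rewrite -(lin_cf hgauss hcent hcov); apply: eq_Rintegral => w _.
by congr (cos (_ + _)); apply: eq_bigr => i _; rewrite tnth_mktuple.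
Qed.

Let sqr_window n (i : 'I_n) :
  (window_law n).-integrable setT (EFin \o (fun x : n.-tuple R => tnth x i ^+ 2)) /\
  \int[window_law n]_x (tnth x i ^+ 2) = 2^-1.
Proof.
have mt : measurable_fun setT (fun x : n.-tuple R => tnth x i ^+ 2).
  by apply: measurable_funX; exact: measurable_tnth.
have mw := @measurable_window n.
have E : (fun w => tnth (window G 0 n w) i ^+ 2) = (fun w => G i w ^+ 2).
  by apply/funext => w; rewrite tnth_mktuple.
have i2 : P0.-integrable setT (EFin \o (fun w => tnth (window G 0 n w) i ^+ 2)).
  by rewrite E; exact: (gaussian_sequence_integrable2 hcov).
split; first exact: (law_integrable (nu := window_law n) mw (@lawW n) mt i2).
rewrite -(law_Rintegral (nu := window_law n) mw (@lawW n) mt i2) E.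
under eq_Rintegral do rewrite expr2.
by rewrite (gaussian_sequence_cov hcov) fbm_cov_diag.
Qed.

(* The functional used for resampling is the normalised sum of all coordinates;
   its covariances with the coordinates telescope to nonnegative numbers. *)
Lemma window_anticoncentration n (v0 k M : R) : (0 < n)%N -> 0 < k -> 0 < M ->
  \int[window_law n]_x (`|cdf_sum x - v0| <= k)%R%:R <=
  M^-1 + 4 * pi * Num.sqrt pi * expR M * k / Num.sqrt (n%:R `^ p / 2).
Proof.
(* V is the variance of the sum of all coordinates. With a = 1 / sqrt V the functional has variance
   1, and the m_i add up to sqrt V. *)
move=> n0 k0 M0; set V := n%:R `^ p / 2; pose al := (Num.sqrt V)^-1.
have V0 : 0 < V by rewrite divr_gt0 ?powR_gt0 ?ltr0n.
have al0 : 0 < al by rewrite invr_gt0 sqrtr_gt0.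
have alV : al ^+ 2 * V = 1 by rewrite exprVn sqr_sqrtr ?(ltW V0)// mulVf// gt_eqF.
pose a (_ : 'I_n) := al; pose m (i : 'I_n) := \sum_(j < n) K i j * a j.
have mE i : m i = al * \sum_(j < n) K i j by rewrite /m -mulr_suml mulrC.
have sm : \sum_i m i = Num.sqrt V.
  under eq_bigr do rewrite mE; rewrite -mulr_sumr fbm_cov_sum// -/V.
  by rewrite -[V in LHS](sqr_sqrtr (ltW V0)) expr2 mulKf// gt_eqF// sqrtr_gt0.
have am : \sum_i a i * m i = 1.
  by rewrite -mulr_sumr sm -alV expr2 -mulrA -sm; under eq_bigr do rewrite mE;
     rewrite -mulr_sumr fbm_cov_sum// -/V.
rewrite -sm; apply: (@cdf_sum_anticoncentration _ _ _
  (fun i j : 'I_n => K i j) _ _ a m) => //.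
- by move=> i j; exact: fbm_cov_sym.
- by move=> i; rewrite mE mulr_ge0 ?(ltW al0)// fbm_cov_row_ge0.
- by move=> i; have [] := sqr_window i.
- by move=> i; have [] := sqr_window i.
- by rewrite sm sqrtr_gt0.
Qed.

Lemma window_kernel_sum n :
  \int[(window_law n \x window_law n)%E]_z (kernel_sum z.1 z.2 ^+ 2) <=
  864 * (n%:R `^ Num.max 1 p) ^+ 2.
Proof.
have bk : bmeas (fun z : n.-tuple R * n.-tuple R => kernel_sum z.1 z.2 ^+ 2).
  rewrite (_ : (fun z => _) = (fun z : n.-tuple R * n.-tuple R =>
    kernel_sum z.1 z.2 * kernel_sum z.1 z.2)); last by apply/funext => z; rewrite expr2.
  have := @bmeas_kernel_sum R n _ (n.-tuple R * n.-tuple R)%type fst snd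
    measurable_fst measurable_snd.
  by move=> b; exact: bmeasM.
rewrite bfubini1// window_law_Rintegral; last first.
  exact: (bmeas_fubini1 (window_law n) (window_law n) bk).
apply: (@le_trans _ _ (\int[P0]_w \int[P0]_w'
    (\sum_(i < n) \sum_(j < n) dice_kernel (G i w) (G j w')) ^+ 2)).
  rewrite le_eqVlt; apply/orP; left; apply/eqP; apply: eq_Rintegral => w _.
  rewrite window_law_Rintegral; last exact: (bmeas_pair1 _ bk).
  apply: eq_Rintegral => w' _; congr (_ ^+ 2).
  apply: eq_bigr => i _; apply: eq_bigr => j _.
  by rewrite !tnth_mktuple.
apply: le_trans (dice_kernel_sum_sqr hgauss hcent hcov (fbm_cov_diag hH)
  (@fbm_cov_sym _ H) n) _.
apply: ler_wpM2l; first exact: ler0n.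
have h := fbm_cov_abs_sum hH n.
have h0 : 0 <= \sum_(i < n) \sum_(k < n) `|s_H H (i%:Z - k%:Z)|.
  by apply: sumr_ge0 => i _; apply: sumr_ge0.
by rewrite !expr2; apply: ler_pM.
Qed.

End window_law.

(** * Convergence *)

Lemma cvg_powRN (R : realType) (e : R) : 0 < e ->
  (n%:R : R) `^ (- e) @[n --> \oo] --> (0 : R).
Proof.
move=> e0; apply/cvgrPdist_le => eps eps0; near=> n.
rewrite sub0r normrN ger0_norm ?powR_ge0// powRN.
have n0 : (0 : R) < n%:R by rewrite ltr0n; near: n; exact: nbhs_infty_gt.
rewrite -[leRHS]invrK lef_pV2 ?posrE ?invr_gt0 ?powR_gt0//.
have e1 : 0 <= eps^-1 by rewrite invr_ge0 ltW.
have -> : eps^-1 = (eps^-1 `^ e^-1) `^ e by rewrite -powRrM mulVf ?gt_eqF// powRr1.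
rewrite ge0_ler_powR ?nnegrE ?powR_ge0 ?(ltW e0) ?(ltW n0)//.
by near: n; exact: nbhs_infty_ger.
Unshelve. all: by end_near. Qed.

(** Rectangles determine a measure on the product, and on them the joint law factors by
    independence. *)
Lemma pair_law (R : realType) (d d' : measure_display) (T : measurableType d)
    (U : measurableType d') (P : probability T R) (mu : probability U R)
    (X Y : T -> U) :
  measurable_fun setT X -> measurable_fun setT Y ->
  (forall A, measurable A -> P (X @^-1` A) = mu A) ->
  (forall A, measurable A -> P (Y @^-1` A) = mu A) ->
  (forall A B, measurable A -> measurable B ->
    P (X @^-1` A `&` Y @^-1` B) = (P (X @^-1` A) * P (Y @^-1` B))%E) ->
  same_law P (mu \x mu)%E (fun w => (X w, Y w)) id.
Proof.
move=> mX mY lX lY ind E mE.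
have mXY : measurable_fun setT (fun w => (X w, Y w)).
  by apply/measurable_fun_pairP; split.
pose m' := distribution P (mfun_of mXY).
apply/esym; apply: (product_measure_unique (m' := m')) => // A B mA mB.
by have := ind A B mA mB; rewrite lX// lY//; exact.
Qed.

Lemma cvg_probability1 (R : realType) (d : nat -> measure_display)
    (T : forall n, measurableType (d n)) (P : forall n, probability (T n) R)
    (E bad : forall n, set (T n)) :
  (forall n, measurable (E n)) -> (forall n, measurable (bad n)) ->
  (forall n, ~` bad n `<=` E n) -> fine (P n (bad n)) @[n --> \oo] --> (0 : R) ->
  P n (E n) @[n --> \oo] --> 1%E.
Proof.
move=> mE mb bE cb.
have le n : 1 - fine (P n (bad n)) <= fine (P n (E n)).
  rewrite -lee_fin EFinB !fineK ?fin_num_measure// -probability_setC//.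
  by apply: le_measure; rewrite ?inE; [exact: measurableC|exact: mE|exact: bE].
have le1 n : fine (P n (E n)) <= 1.
  by rewrite -lee_fin fineK ?fin_num_measure// probability_le1.
have cE : fine (P n (E n)) @[n --> \oo] --> (1 : R).
  apply: (@squeeze_cvgr _ _ _ _ (fun n => 1 - fine (P n (bad n))) (fun=> 1)).
  - by apply: nearW => n; rewrite le le1.
  - rewrite -[X in _ --> X]subr0; apply: cvgB => //; exact: cvg_cst.
  - exact: cvg_cst.
rewrite (_ : (fun n => P n (E n)) = (fun n => (fine (P n (E n)))%:E)).
  by apply: cvg_EFin; [exact: nearW|exact: cE].
by apply/funext => n; rewrite fineK// fin_num_measure.
Qed.

Section irregular_pairs.
Context {R : realType} (H : R) (hH : 0 < H < 1).
Context {d0 : measure_display} {T0 : measurableType d0} (P0 : probability T0 R).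
Variable G : nat -> {RV P0 >-> R}.
Hypotheses (hgauss : gaussian_sequence G) (hcent : centered_sequence G).
Hypothesis hcov : forall i j : nat,
  ('E_P0[fun w => (G i w * G j w)%R] = (s_H H (i%:Z - j%:Z)%R)%:E)%E.
Notation p := (2 * H).
Notation mu := (window_law G).

(** A union bound. For the near tie, the second die is frozen and its [cdf_sum] becomes the centre
    of the anticoncentration estimate; a large kernel sum is handled by Chebyshev. *)
Lemma irregular_bound (d : measure_display) (T : measurableType d)
    (P : probability T R) n (X Y : T -> n.-tuple R) (k M : R) :
  measurable_fun setT X -> measurable_fun setT Y ->
  same_law P (mu n \x mu n)%E (fun w => (X w, Y w)) id ->
  (0 < n)%N -> 0 < k -> 0 < M ->
  fine (P [set w | ~~ regular_pair k (X w) (Y w)]) <=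
  M^-1 + 4 * pi * Num.sqrt pi * expR M * k / Num.sqrt (n%:R `^ p / 2) +
  (2 * n%:R * k) ^- 2 * (864 * (n%:R `^ Num.max 1 p) ^+ 2).
Proof.
move=> mX mY L n0 k0 M0.
have mXY : measurable_fun setT (fun w => (X w, Y w)).
  by apply/measurable_fun_pairP; split.
have mreg : measurable_fun setT (fun z : n.-tuple R * n.-tuple R =>
    ~~ regular_pair k z.1 z.2).
  apply: measurable_neg.
  exact: (measurable_regular_pair (measurable_fst) (measurable_snd)).
have breg := @bmeas_bool R _ _ _ mreg.
have -> : fine (P [set w | ~~ regular_pair k (X w) (Y w)]) =
    \int[(mu n \x mu n)%E]_z (~~ regular_pair k z.1 z.2)%:R.
  rewrite -(same_law_Rintegral mXY (@measurable_id _ _ setT) L breg).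
  by apply/esym/Rintegral_bool; exact: (measurableT_comp mreg mXY).
have n0R : 0 < n%:R :> R by rewrite ltr0n.
set c := 2 * n%:R * k; have c0 : 0 < c by rewrite !mulr_gt0.
pose near_tie (z : n.-tuple R * n.-tuple R) : R :=
  (`|cdf_sum z.1 - cdf_sum z.2| <= k)%R%:R.
pose W2 (z : n.-tuple R * n.-tuple R) : R := kernel_sum z.1 z.2 ^+ 2.
have bW : bmeas W2.
  rewrite (_ : W2 = (fun z : n.-tuple R * n.-tuple R =>
    kernel_sum z.1 z.2 * kernel_sum z.1 z.2)); last by apply/funext => z; rewrite /W2 expr2.
  have := @bmeas_kernel_sum R n _ (n.-tuple R * n.-tuple R)%type fst snd
    measurable_fst measurable_snd.
  by move=> b; exact: bmeasM.
have bt : bmeas near_tie.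
  apply: bmeas_bool; apply: measurable_fun_ler => //; apply: measurableT_comp => //.
  have mV := bmeasW (@bmeas_cdf_sum R n).
  apply: measurable_funB.
    exact: (measurableT_comp mV measurable_fst).
  exact: (measurableT_comp mV measurable_snd).
have bcW : bmeas (fun z => c ^- 2 * W2 z) by apply: bmeasM => //; exact: bmeas_cst.
apply: (@le_trans _ _ (\int[(mu n \x mu n)%E]_z (near_tie z + c ^- 2 * W2 z))).
  apply: ler_bRintegral => //; first exact: bmeasD.
  move=> z; rewrite /regular_pair negb_and -leNgt -leNgt /near_tie.
  have W0 : 0 <= c ^- 2 * W2 z by rewrite mulr_ge0 ?invr_ge0 ?sqr_ge0.
  have [_|_] /= := leP _ k; first by rewrite lerDl.
  have [cW|_] := leP c; last by rewrite add0r.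
  rewrite add0r /W2 -(real_normK (num_real (kernel_sum _ _))) mulrC.
  by rewrite ler_pdivlMr ?exprn_gt0// mul1r lerXn2r ?nnegrE ?(ltW c0).
rewrite bRintegralD// RintegralM_cst//; apply: lerD; last first.
  apply: ler_wpM2l; first by rewrite invr_ge0 sqr_ge0.
  exact: (window_kernel_sum hH hgauss hcent hcov).
rewrite bfubini2// -[leRHS](Rintegral_prob_cst (mu n)); apply: ler_bRintegral.
- exact: (bmeas_fubini2 (mu n) (mu n) bt).
- exact: bmeas_cst.
- move=> y; rewrite /near_tie /=.
  exact: (window_anticoncentration hH hgauss hcent hcov (cdf_sum y) n0 k0 M0).
Qed.

(* Any exponent strictly between [q - 1] and [H] would do as [theta]. *)
Let q := Num.max 1 p.
Let theta := (H + q - 1) / 2.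
(** Both error terms have the same margin at the midpoint: dl = H - theta = 1 + theta - q. *)
Let dl := (H + 1 - q) / 2.

(** The condition q < 1 + H unfolds into 1 < 1 + H and 2H < 1 + H: each end of the range of H
    accounts for one of them. *)
Let dl_gt0 : 0 < dl.
Proof.
have /andP[h0 h1] := hH; rewrite /dl divr_gt0// subr_gt0 /q gt_max.
by apply/andP; split; lra.
Qed.

Lemma irregular_cvg0 (d : nat -> measure_display) (T : forall n, measurableType (d n))
    (P : forall n, probability (T n) R) (X Y : forall n, T n -> n.-tuple R) :
  (forall n, measurable_fun setT (X n)) -> (forall n, measurable_fun setT (Y n)) ->
  (forall n, same_law (P n) (mu n \x mu n)%E (fun w => (X n w, Y n w)) id) ->
  fine (P n [set w | ~~ regular_pair (n%:R `^ theta) (X n w) (Y n w)])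
    @[n --> \oo] --> (0 : R).
Proof.
move=> mX mY L.
(* sqrt 2 comes from the standard deviation n^H / sqrt 2 of the sum; below, 216 = 864 / 2^2 comes
   from the factor 2 in the threshold 2nk. *)
pose C (M : R) : R := 4 * pi * Num.sqrt pi * expR M * Num.sqrt 2.
have bound n M : (0 < n)%N -> 0 < M ->
    fine (P n [set w | ~~ regular_pair (n%:R `^ theta) (X n w) (Y n w)]) <=
    M^-1 + (C M * n%:R `^ (- dl) + 216 * (n%:R `^ (- dl) * n%:R `^ (- dl))).
  move=> n0 M0; have n0R : 0 < n%:R :> R by rewrite ltr0n.
  have n1 := lt0r_neq0 n0R.
  have k0 : 0 < n%:R `^ theta :> R by rewrite powR_gt0.
  apply: le_trans (irregular_bound (mX n) (mY n) (L n) n0 k0 M0) _.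
  rewrite -addrA lerD2l le_eqVlt; apply/orP; left; apply/eqP; congr (_ + _).
    have -> : Num.sqrt (n%:R `^ p / 2) = n%:R `^ H / Num.sqrt 2.
      rewrite sqrtrM ?powR_ge0// sqrtrV//; congr (_ / _).
      by rewrite mulrC powRrM powR_mulrn ?powR_ge0// sqrtr_sqr ger0_norm ?powR_ge0.
    have -> : n%:R `^ (- dl) = n%:R `^ theta / n%:R `^ H.
      rewrite -powRB; last by rewrite n1 implybT.
      by congr (_ `^ _); rewrite /dl /theta; field.
    have s2 : Num.sqrt 2 != 0 :> R by rewrite sqrtr_eq0 -ltNge.
    by rewrite /C; field; rewrite s2 gt_eqF// powR_gt0.
  have -> : n%:R `^ (- dl) = n%:R `^ q / (n%:R * n%:R `^ theta).
    have -> : n%:R * n%:R `^ theta = n%:R `^ (1 + theta) :> R.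
      by rewrite powRD ?n1 ?implybT// (powRr1 (ltW n0R)).
    rewrite -powRB; last by rewrite n1 implybT.
    by congr (_ `^ _); rewrite /dl /theta; field.
  rewrite -/q; move: (n%:R `^ q) => Q; field.
  by rewrite n1 gt_eqF.
apply/cvgrPdist_le => e e0.
(* [M] is fixed by the target error before n grows, so the e^M inside [C M] is a constant. *)
pose M := 2 / e; have M0 : 0 < M by rewrite divr_gt0.
have cv : (C M * n%:R `^ (- dl) + 216 * (n%:R `^ (- dl) * n%:R `^ (- dl)) : R)
    @[n --> \oo] --> (C M * 0 + 216 * (0 * 0) : R).
  have c0 := cvg_powRN dl_gt0.
  apply: cvgD; (apply: cvgM; first exact: cvg_cst) => //.
  exact: cvgM.
have e2 : 0 < e / 2 by rewrite divr_gt0.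
have {}cv : \forall n \near \oo, C M * n%:R `^ (- dl) +
    216 * (n%:R `^ (- dl) * n%:R `^ (- dl)) <= e / 2.
  move: cv; rewrite !mulr0 addr0 => /cvgrPdist_le/(_ _ e2); apply: filterS => n.
  by rewrite sub0r normrN; apply: le_trans; exact: ler_norm.
near=> n; rewrite sub0r normrN ger0_norm ?fine_ge0//.
apply: (le_trans (bound n M _ M0)); first by near: n; exact: nbhs_infty_gt.
rewrite /M invf_div [leRHS]splitr lerD2l.
by near: n.
Unshelve. all: by end_near. Qed.

End irregular_pairs.

(* [G i] stands for the variable of 1-based index i + 1; the dice with n sides
   may live on a probability space that depends on n. *)
Theorem theorem1p2 (R : realType) (H : R) (hH : 0 < H < 1)
  (d0 : measure_display) (T0 : measurableType d0) (P0 : probability T0 R)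
  (G : nat -> {RV P0 >-> R})
  (hgauss : gaussian_sequence G)
  (hcent : centered_sequence G)
  (hstat : stationary_sequence G)
  (hcov : forall i j : nat,
    ('E_P0[fun w => (G i w * G j w)%R] = (s_H H (i%:Z - j%:Z)%R)%:E)%E)
  (d : nat -> measure_display) (T : forall n : nat, measurableType (d n))
  (P : forall n : nat, probability (T n) R)
  (a b c : forall n : nat, {RV (P n) >-> n.-tuple R})
  (ha : forall n : nat, same_law (P n) P0 (a n) (window G 0 n))
  (hb : forall n : nat, same_law (P n) P0 (b n) (window G 0 n))
  (hc : forall n : nat, same_law (P n) P0 (c n) (window G 0 n))
  (hind : forall n : nat, independent3 (P n) (a n) (b n) (c n)) :
  (forall A : set R, measurable A ->
     distribution P0 (G 0%N) A = normal_prob 0 (Num.sqrt 2^-1) A) /\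
  (forall x : R, cdf (G 0%N) x = (F x)%:E) /\
  ((fun n : nat => P n [set w | beats (a n w) (b n w) <->
       \sum_(i < n) F (tnth (a n w) i) > \sum_(i < n) F (tnth (b n w) i)])
     @ \oo --> 1%E) /\
  ((fun n : nat => P n [set w | transitive_dice [set a n w; b n w; c n w]])
     @ \oo --> 1%E).
Proof.
have law0 (A : set R) : measurable A ->
    distribution P0 (G 0%N) A = normal_prob 0 (Num.sqrt 2^-1) A.
  move=> mA; rewrite -(fbm_cov_diag hH 0).
  apply: (gaussian_sequence_law0 hgauss hcent hcov) => //.
  by rewrite fbm_cov_diag// invr_gt0.
split=> [//|]; split=> [x|].
  by rewrite /cdf law0// set_itvNyc F_normal fineK ?fin_num_measure// -set_itvNyc.
pose theta := (H + Num.max 1 (2 * H) - 1) / 2.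
pose regular n (x y : n.-tuple R) := regular_pair (n%:R `^ theta) x y.
(* For n = 0 no pair is regular: the second inequality would bound an absolute value strictly by
   0. *)
have regular_gt0 n (x y : n.-tuple R) : regular n x y -> 0 < (n%:R : R) `^ theta.
  case: n x y => [|n] x y; last by rewrite powR_gt0.
  by case/andP => _; rewrite mulr0 mul0r normr_lt0.
have ma n : measurable_fun setT (a n) by exact: measurable_funP.
have mb n : measurable_fun setT (b n) by exact: measurable_funP.
have mc n : measurable_fun setT (c n) by exact: measurable_funP.
have mirr n (X Y : T n -> n.-tuple R) : measurable_fun setT X ->
    measurable_fun setT Y -> measurable [set w | ~~ regular n (X w) (Y w)].
  move=> mX mY; apply: measurable_true_set; apply: measurable_neg.
  exact: measurable_regular_pair.
have Lab n : same_law (P n) (window_law G n \x window_law G n)%E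
    (fun w => (a n w, b n w)) id.
  apply: (pair_law (mu := window_law G n) (ma n) (mb n) (ha n) (hb n)) => A B mA mB.
  by have := hind n A B setT mA mB measurableT; rewrite !preimage_setT setIT
    probability_setT mule1.
have Lbc n : same_law (P n) (window_law G n \x window_law G n)%E
    (fun w => (b n w, c n w)) id.
  apply: (pair_law (mu := window_law G n) (mb n) (mc n) (hb n) (hc n)) => A B mA mB.
  by have := hind n setT A B measurableT mA mB; rewrite !preimage_setT setTI
    probability_setT mul1e.
have Lac n : same_law (P n) (window_law G n \x window_law G n)%E
    (fun w => (a n w, c n w)) id.
  apply: (pair_law (mu := window_law G n) (ma n) (mc n) (ha n) (hc n)) => A B mA mB.
  by have := hind n A setT B mA measurableT mB; rewrite !preimage_setT setIT
    probability_setT mule1.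
have cab := irregular_cvg0 hH hgauss hcent hcov ma mb Lab.
have cbc := irregular_cvg0 hH hgauss hcent hcov mb mc Lbc.
have cac := irregular_cvg0 hH hgauss hcent hcov ma mc Lac.
split.
  apply: cvg_probability1 cab => n.
  - exact: measurable_beats_iff (ma n) (mb n).
  - exact: mirr (ma n) (mb n).
  - move=> w /=; have [reg _|//] := boolP (regular n (a n w) (b n w)).
    by have [] := regular_pair_beats (regular_gt0 _ _ _ reg) reg.
(* Transitivity is guaranteed when all three pairs are regular; the probabilities of failure are
   added up. *)
pose irr n (X Y : T n -> n.-tuple R) := [set w | ~~ regular n (X w) (Y w)].
apply: (@cvg_probability1 _ _ _ _ _
  (fun n => irr n (a n) (b n) `|` (irr n (b n) (c n) `|` irr n (a n) (c n)))) => [n|n|n w|].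
- exact: measurable_transitive (ma n) (mb n) (mc n).
- by apply: measurableU; last apply: measurableU; exact: mirr.
- rewrite /irr /= !not_orP => -[/negP/negPn rab [/negP/negPn rbc /negP/negPn rac]].
  exact: regular_transitive (regular_gt0 _ _ _ rab) rab rbc rac.
have leU n (A B : set (T n)) : measurable A -> measurable B ->
    fine (P n (A `|` B)) <= fine (P n A) + fine (P n B).
  move=> mA mB; rewrite -lee_fin EFinD !fineK ?fin_num_measure//; last exact: measurableU.
  exact: measureU2.
apply: (@squeeze_cvgr _ _ _ _ (fun=> 0) (fun n => fine (P n (irr n (a n) (b n))) +
  (fine (P n (irr n (b n) (c n))) + fine (P n (irr n (a n) (c n)))))).
- apply: nearW => n; rewrite fine_ge0//=.
  have m1 := mirr n _ _ (ma n) (mb n); have m2 := mirr n _ _ (mb n) (mc n).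
  have m3 := mirr n _ _ (ma n) (mc n).
  apply: le_trans (leU n _ _ m1 (measurableU _ _ m2 m3)) _.
  by rewrite lerD2l; exact: leU.
- exact: cvg_cst.
- by have := cvgD cab (cvgD cbc cac); rewrite !addr0; exact.
Qed.
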